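(* There exist absolute constants $C>0$ and $\kappa>0$ such that the following holds for every $d\in\mathbb{Z}_+$, every $c\in(0,1)$, every $\sigma\ge0$, every $\eta\in[\frac{2+c}{d},\frac{4}{\sqrt d}]$ and every $b\ge0$. For every (possibly randomized) algorithm $\mathcal{A}$ that takes as input $\eta,\sigma,b$ and $n$ labeled examples in $(\mathbb{R}\cup\{\perp\})^d\times(\mathbb{R}\cup\{\perp\})$ and outputs $\hat\beta\in\mathbb{R}^d$, there exist $\beta\in\mathbb{R}^d$ with $\|\beta\|=b$ and an adversary as in the coordinate-wise missing data model such that, when $\mathcal{A}$ is run on $\eta,\sigma,b$ and the $\eta$-coordinate-wise incomplete version of $n$ i.i.d. samples from the linear regression model with regressor $\beta$ and noise level $\sigma$, its output satisfies $$\|\hat\beta-\beta\|\ \ge\ \eta\,\frac{c\sqrt d}{C}\,\|\beta\|$$ with probability at least $\tfrac12\big(1-(d+1)e^{-\kappa c^2\eta n}\big)$.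
   Context: Linear regression model with regressor $\beta\in\mathbb{R}^d$ and noise level $\sigma\ge 0$: a labeled example $(X,y)$ with $X\sim\mathcal{N}(0,I_d)$ and $y=\beta^\top X+\xi$, where $\xi\sim\mathcal{N}(0,\sigma^2)$ is independent of $X$ ($\xi=0$ if $\sigma=0$). Coordinate-wise missing data model with rate $\eta\in[0,1]$: given a set $S=\{(X^{(i)},y^{(i)})\}_{i\in[n]}$ of $n$ i.i.d. labeled examples, an adversary (possibly randomized) inspects all of $S$ and, for each coordinate $j\in[d]$, may replace the $j$-th coordinate of at most $\eta n$ of the vectors $X^{(i)}$ by the symbol $\perp$, and may replace at most $\eta n$ of the labels $y^{(i)}$ by $\perp$; the resulting dataset is given to the algorithm. Probabilities are over the samples and the randomness of the adversary and the algorithm. *)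

(* Defs.v *)
From HB Require Import structures.
From mathcomp Require Import all_boot all_order all_algebra.
From mathcomp Require Import all_classical all_reals all_analysis.
From mathcomp Require Import Rstruct Rstruct_topology.
Set Implicit Arguments. Unset Strict Implicit. Unset Printing Implicit Defensive.
Import Order.TTheory GRing.Theory Num.Theory.
Local Open Scope classical_set_scope.
Local Open Scope ring_scope.

Definition RR : realType := Rdefinitions.R.

Definition vnorm (d : nat) (v : d.-tuple RR) : RR :=
  Num.sqrt (\sum_(j < d) (tnth v j) ^+ 2).
Definition vdist (d : nat) (u v : d.-tuple RR) : RR :=
  Num.sqrt (\sum_(j < d) (tnth u j - tnth v j) ^+ 2).

Definition example (d : nat) := (d.-tuple RR * RR)%type.
Definition dataset (n d : nat) := n.-tuple (example d).

(** A missingness mask for one example: for each coordinate j, [true] means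
    that the j-th coordinate of X is replaced by the symbol ⊥; the second
    component says whether the label is replaced by ⊥. *)
Definition mask (d : nat) := (d.-tuple bool * bool)%type.
Definition dmask (n d : nat) := n.-tuple (mask d).

(** An incomplete example in (R ∪ {⊥})^d × (R ∪ {⊥}), encoded as values plus
    ⊥-flags: an entry flagged [true] is ⊥ and its value slot is the dummy 0
    (so the hidden value is not visible). *)
Definition iexample (d : nat) :=
  ((d.-tuple RR * d.-tuple bool) * (RR * bool))%type.
Definition idataset (n d : nat) := n.-tuple (iexample d).

Definition censor_ex (d : nat) (e : example d) (m : mask d) : iexample d :=
  (([tuple (if tnth m.1 j then 0 else tnth e.1 j) | j < d], m.1),
   ((if m.2 then 0 else e.2), m.2)).
Definition censor (n d : nat) (S : dataset n d) (M : dmask n d) : idataset n d :=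
  [tuple censor_ex (tnth S i) (tnth M i) | i < n].

Definition mask_admissible (n d : nat) (eta : RR) (M : dmask n d) : Prop :=
  (forall j : 'I_d,
     (#|[set i : 'I_n | tnth (tnth M i).1 j]|)%:R <= eta * n%:R) /\
  (#|[set i : 'I_n | (tnth M i).2]|)%:R <= eta * n%:R.

(** The complete dataset of the linear regression model with regressor beta and
    noise level sigma, built from standard Gaussians G i j (the X^(i)_j) and
    Z i (so that xi^(i) = sigma * Z i ~ N(0, sigma^2), and xi = 0 if sigma = 0). *)
Definition lr_dataset (n d : nat) (Omega : Type) (beta : d.-tuple RR) (sigma : RR)
  (G : 'I_n -> 'I_d -> Omega -> RR) (Z : 'I_n -> Omega -> RR) (w : Omega)
  : dataset n d :=
  [tuple ([tuple G i j w | j < d],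
          \sum_(j < d) tnth beta j * G i j w + sigma * Z i w) | i < n].

(** Probabilistic setting on a probability space (Omega, P):
    - G i j (i < n, j < d) and Z i (i < n) are i.i.d. standard Gaussians
      (the covariates and the normalized noise of the n samples);
    - V is a uniform [0,1] seed, the randomness available to the adversary;
    - U (with values in an arbitrary measurable space) is the internal
      randomness of the algorithm, with arbitrary law;
    all of them mutually independent.  Joint independence with the given
    marginals is expressed by the product rule on measurable rectangles. *)
Definition model_setup (n d : nat) (dO : measure_display) (Omega : measurableType dO)
  (P : probability Omega RR) (dU : measure_display) (TU : measurableType dU)
  (G : 'I_n -> 'I_d -> Omega -> RR) (Z : 'I_n -> Omega -> RR)
  (V : Omega -> RR) (U : Omega -> TU) : Prop :=
  (forall i j, measurable_fun setT (G i j)) /\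
  (forall i, measurable_fun setT (Z i)) /\
  measurable_fun setT V /\ measurable_fun setT U /\
  forall (A : 'I_n -> 'I_d -> set RR) (B : 'I_n -> set RR) (D : set RR) (E : set TU),
    (forall i j, measurable (A i j)) -> (forall i, measurable (B i)) ->
    measurable D -> measurable E ->
    P ([set w | (forall i j, A i j (G i j w)) /\ (forall i, B i (Z i w)) /\
                D (V w) /\ E (U w)])
    = ((\prod_(i < n) \prod_(j < d) normal_prob 0 1 (A i j)) *
       (\prod_(i < n) normal_prob 0 1 (B i)) *
       uniform_prob (@ltr01 RR) D * P (U @^-1` E))%E.

(* Main.v *)
Require Import Defs.
From HB Require Import structures.
From mathcomp Require Import all_boot all_order all_algebra.
From mathcomp Require Import all_classical all_reals all_analysis.
From mathcomp Require Import Rstruct Rstruct_topology.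
From mathcomp Require Import exp trigo measurable_realfun.
From mathcomp Require Import ring lra zify.
Set Implicit Arguments. Unset Strict Implicit. Unset Printing Implicit Defensive.
Import Order.TTheory GRing.Theory Num.Theory.
Import numFieldNormedType.Exports.
Local Open Scope classical_set_scope.
Local Open Scope ring_scope.

(** Write [Theta] for an angle of order [c * eta * sqrt d].  Split an even number
    of coordinates into two groups of size [m = d./2] with sums [S1] and [S2], and
    let [beta] at angle [phi] predict [r * (cos phi * S1 + sin phi * S2)].  For a
    pair [a = (i, j)], changing coordinate [i] of the first group and coordinate
    [j] of the second so that [(S1, S2)] rotates by [delta] turns a sample for
    angle [w + delta] into one for angle [w] with the same label; it is a product
    of shears, so the law of the moved Gaussian vector has an explicit density
    [rho a].  Hence erasing the two moved coordinates hides which angle was used,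
    up to the deviation of [rho a] from [1].

    Reaching [Theta] takes [N] moves of angle [delta = Theta / N].  After each move
    the pair [a] is kept with probability [min (rho a) 1 / rho a], and the excess
    is transferred to pairs with [rho k < 1].  Averaged over the [m ^ 2] pairs the
    density is [1] up to [O(m * delta ^ 2)], so the total mass lost vanishes as
    [N] grows, whereas a single [rho a] is [1] up to [O(sqrt m * delta)], so a
    fixed coordinate is erased with probability at most [1 / m + O(Theta / sqrt m)].
    Mixing with an erasure of the label alone, of probability [2 / d], brings all
    erasure probabilities below [(1 - c / 6) * eta], and a Chernoff bound keeps all
    [d + 1] erasure counts below [eta * n].  The visible data then have the same
    law under both regressors, so one of them is badly estimated with probability
    at least one half. *)

(** * Gaussian product measures *)

(** The two regressors have the same norm, so passing from one to the other is a rotation, and the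
    label survives it only if the covariates compensate. Altering one coordinate per group is
    enough, and a uniformly chosen pair meets a given coordinate with probability [1 / m]; this is
    where the threshold [2 / d] comes from. For odd [d] the rate [1 / m = 2 / (d - 1)] exceeds
    [2 / d], and the label erasures repair this, since [(1 - 2 / d) / m <= 2 / d]. A single move by
    the whole angle is too lossy: its loss is only controlled by [m * Theta ^ 2], which can far
    exceed the slack [c * eta]. Many small moves make the loss negligible, but drawing a fresh pair
    for each of them would erase far too many coordinates. Hence a pair is reused and replaced only
    as often as its density forces. The path must be drawable from either end: forwards by the
    adversary of one regressor, backwards by the adversary of the other. This is why the transfer
    matrix [sw] is bounded both along rows and along columns, the column bound keeping the current
    pair at most uniform given the current point. *)

(* [gauss] and [unif] are separate constants so that unification never unfolds
   the library's laws into integrals of densities. *)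
Section gauss.
Variable R : realType.
Definition gauss : set R -> \bar R := normal_prob 0 1.
Let gauss0 : gauss set0 = 0%E. Proof. exact: (@measure0 _ _ _ (normal_prob 0 1)). Qed.
Let gauss_ge0 A : (0 <= gauss A)%E. Proof. exact: (@measure_ge0 _ _ _ (normal_prob 0 1)). Qed.
Let gauss_sa : semi_sigma_additive gauss.
Proof. exact: (@measure_semi_sigma_additive _ _ _ (normal_prob 0 1)). Qed.
HB.instance Definition _ := isMeasure.Build _ R R gauss gauss0 gauss_ge0 gauss_sa.
Let gauss_setT : gauss [set: _] = 1%E.
Proof. exact: (@probability_setT _ _ _ (normal_prob 0 1)). Qed.
HB.instance Definition _ := Measure_isProbability.Build _ _ _ gauss gauss_setT.
End gauss.

Section unif.
Variable R : realType.
Definition unif : set R -> \bar R := uniform_prob (@ltr01 R).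
Let unif0 : unif set0 = 0%E. Proof. exact: (@measure0 _ _ _ (uniform_prob _)). Qed.
Let unif_ge0 A : (0 <= unif A)%E. Proof. exact: (@measure_ge0 _ _ _ (uniform_prob _)). Qed.
Let unif_sa : semi_sigma_additive unif.
Proof. exact: (@measure_semi_sigma_additive _ _ _ (uniform_prob _)). Qed.
HB.instance Definition _ := isMeasure.Build _ R R unif unif0 unif_ge0 unif_sa.
Let unif_setT : unif [set: _] = 1%E.
Proof. exact: (@probability_setT _ _ _ (uniform_prob _)). Qed.
HB.instance Definition _ := Measure_isProbability.Build _ _ _ unif unif_setT.
End unif.

Section tpow.
Context {R : realType} {d} {T : measurableType d} (P : probability T R).

Definition tcons n (x : T * n.-tuple T) : n.+1.-tuple T := [tuple of x.1 :: x.2].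

Lemma measurable_tcons n : measurable_fun setT (@tcons n).
Proof. exact: measurable_cons. Qed.

HB.instance Definition _ n := isMeasurableFun.Build _ _ _ _ (@tcons n) (@measurable_tcons n).

(** The recursion peels off the head coordinate, so an integral over the product is an iterated
    integral and statements about it go by induction on [n]. *)
Fixpoint tpow n : probability (n.-tuple T) R :=
  if n is n'.+1 then distribution (P \x tpow n')%E (@tcons n') else dirac [tuple].

Lemma integral_tpowS n (f : n.+1.-tuple T -> \bar R) : measurable_fun [set: _.-tuple T] f ->
  (forall x, 0 <= f x)%E ->
  (\int[tpow n.+1]_t f t = \int[P]_x \int[tpow n]_t f (tcons (x, t)))%E.
Proof.
move=> mf f0 /=; rewrite ge0_integral_distribution//.
have mft : measurable_fun [set: (T * n.-tuple T)%type] (f \o @tcons n).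
  by apply: measurableT_comp; [exact: mf|exact: measurable_tcons].
by rewrite fubini_tonelli1// => x; exact: f0.
Qed.

Lemma integral_tpow0 (f : 0.-tuple T -> \bar R) : measurable_fun [set: _.-tuple T] f ->
  (\int[tpow 0]_t f t = f [tuple])%E.
Proof. by move=> mf /=; rewrite integral_dirac// diracT mul1e. Qed.

End tpow.

Section density.
Context {R : realType} {d} {T : measurableType d}.
Variables (m1 m2 : {measure set T -> \bar R}) (p : T -> R).
Hypotheses (mp : measurable_fun [set: T] p) (p0 : forall x, 0 <= p x).
Hypothesis m12 : forall A, measurable A -> m1 A = (\int[m2]_(x in A) (p x)%:E)%E.
Import HBNNSimple.

Let mpE : measurable_fun [set: T] (EFin \o p).
Proof. exact/measurable_EFinP. Qed.

Let density_nnsfun (f : {nnsfun T >-> R}) :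
  (\int[m1]_x (f x)%:E = \int[m2]_x ((f x)%:E * (p x)%:E))%E.
Proof.
under [LHS]eq_integral do rewrite fimfunE -fsumEFin//.
rewrite [LHS]ge0_integral_fsum//; last 2 first.
  - by move=> r; exact/measurable_EFinP/measurableT_comp.
  - by move=> n x _; rewrite EFinM nnfun_muleindic_ge0.
under [RHS]eq_integral.
  move=> x xD; rewrite fimfunE -fsumEFin// muleC ge0_mule_fsumr; last first.
    by move=> r; rewrite EFinM nnfun_muleindic_ge0.
  over.
rewrite [RHS]ge0_integral_fsum//; last 2 first.
  - move=> r; apply: emeasurable_funM => //.
    by apply/measurable_EFinP; exact: measurableT_comp.
  - by move=> n x _; rewrite mule_ge0 ?lee_fin// -lee_fin EFinM nnfun_muleindic_ge0.
apply: eq_fsbigr => r _.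
have mA : measurable (f @^-1` [set r]) by exact: measurable_funPTI.
have [->|r0] := eqVneq (f @^-1` [set r]) set0.
  under [LHS]eq_integral do rewrite indic0 mulr0.
  under [RHS]eq_integral do rewrite indic0 mulr0 mule0.
  by rewrite !integral0.
have r0' : 0 <= r by move/set0P: r0 => [x /= <-].
transitivity (r%:E * m1 (f @^-1` [set r]))%E.
  under eq_integral do rewrite EFinM.
  rewrite ge0_integralZl//; first by rewrite integral_indic// setIT.
  exact/measurable_EFinP/measurable_indic.
rewrite m12// integral_mkcond -ge0_integralZl//; last first.
- by move=> x _; rewrite patchE; case: ifP => //; rewrite lee_fin p0.
- exact/(measurable_restrictT _ _).1/measurable_funTS.
apply: eq_integral => x _; rewrite patchE indicE; case: ifPn => xA.
  by rewrite mulr1 muleC.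
by rewrite mulr0 !mule0.
Qed.

Lemma ge0_integral_density (f : T -> \bar R) : measurable_fun [set: T] f ->
  (forall x, 0 <= f x)%E ->
  (\int[m1]_x f x = \int[m2]_x (f x * (p x)%:E))%E.
Proof.
move=> mf f0.
pose f_ := nnsfun_approx measurableT mf.
transitivity (lim (\int[m1]_x (f_ n x)%:E @[n --> \oo])%E).
  rewrite -monotone_convergence//=.
  - by apply: eq_integral => x _; apply/esym/cvg_lim => //=; exact: cvg_nnsfun_approx.
  - by move=> n; exact/measurable_EFinP/measurable_funTS.
  - by move=> n ? _; rewrite lee_fin.
  - by move=> ? _ ? ? mn; rewrite lee_fin; exact/lefP/nd_nnsfun_approx.
rewrite (_ : (\int[m2]_x _)%E = lim
    (\int[m2]_x ((f_ n x)%:E * (p x)%:E) @[n --> \oo])%E); last first.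
  rewrite -monotone_convergence//=.
  - apply: eq_integral => x _; apply/esym/cvg_lim => //.
    by apply: cvgeZr => //; exact: cvg_nnsfun_approx.
  - by move=> n; apply: emeasurable_funM => //; exact/measurable_EFinP/measurable_funTS.
  - by move=> n ? _; rewrite mule_ge0// lee_fin.
  - by move=> ? _ ? ? mn; rewrite lee_wpmul2r ?lee_fin//; exact/lefP/nd_nnsfun_approx.
by apply: congr_lim; apply/funext => n /=; exact: density_nnsfun.
Qed.
End density.

Lemma integral_prob_cst {R : realType} d (T : measurableType d) (P : probability T R)
  (c : \bar R) : (\int[P]_x c = c)%E.
Proof. by rewrite integral_cst//= probability_setT mule1. Qed.

Section gauss_shift.
Variable R : realType.
Local Notation mu := (@lebesgue_measure R).

Lemma ge0_integral_gauss (f : R -> \bar R) : measurable_fun [set: R] f ->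
  (forall x, 0 <= f x)%E ->
  (\int[@gauss R]_x f x = \int[mu]_x (f x * (normal_pdf 0 1 x)%:E))%E.
Proof.
move=> mf f0.
(* The identity, pushed forward, transports the law from [measurableTypeR R], on which
   [lebesgue_measure] lives, to [R] itself. *)
pose phi : measurableTypeR R -> R := idfun.
have mphi : measurable_fun setT phi by move=> _ A mA; rewrite setTI; exact: mA.
transitivity (\int[pushforward (normal_prob 0 1) phi]_x f x)%E.
  exact: eq_measure_integral.
rewrite ge0_integral_pushforward//.
apply: (@ge0_integral_density R _ (measurableTypeR R) (normal_prob 0 1) mu) => //.
- exact: measurable_normal_pdf.
- by move=> x; exact: normal_pdf_ge0.
Qed.

Lemma ge0_integral_lebesgue_shift (a : R) (f : R -> \bar R) : measurable_fun [set: R] f ->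
  (forall x, 0 <= f x)%E -> (\int[mu]_x f (x + a)%R = \int[mu]_x f x)%E.
Proof.
move=> mf f0.
pose phi : measurableTypeR R -> measurableTypeR R := fun x => x + a.
have mphi : measurable_fun setT phi by exact: measurable_funD.
transitivity (\int[pushforward mu phi]_x f x)%E.
  by rewrite ge0_integral_pushforward.
apply: eq_measure_integral => /= A mA _; apply/esym.
apply: (@lebesgue_measure_unique R (pushforward mu phi)) => // _ [[b c]] _ <- /=.
rewrite /pushforward (_ : phi @^-1` _ = `](b - a), (c - a)]%classic).
  rewrite !lebesgue_measure_itv /= !lte_fin ltrD2r; case: ifP => // _.
  by rewrite -!EFinB opprB addrA subrK.
by apply/seteqP; split=> x /=; rewrite !in_itv/= /phi ltrBlDr lerBrDr.
Qed.

(** One-dimensional Cameron-Martin formula: the factor is the normal density at [x - a] divided by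
    the one at [x]. *)
Lemma ge0_integral_gauss_shift (a : R) (f : R -> \bar R) : measurable_fun [set: R] f ->
  (forall x, 0 <= f x)%E ->
  (\int[@gauss R]_x f (x + a)%R =
   \int[@gauss R]_x (f x * (expR (x * a - a ^+ 2 / 2))%:E))%E.
Proof.
move=> mf f0.
have me : measurable_fun [set: R] (fun x => (expR (x * a - a ^+ 2 / 2))%:E).
  apply/measurable_EFinP/measurableT_comp => //.
  by apply: measurable_funB => //; exact: measurable_funM.
rewrite [RHS]ge0_integral_gauss; last 2 first.
- exact: emeasurable_funM.
- by move=> x; rewrite mule_ge0// lee_fin expR_ge0.
rewrite ge0_integral_gauss//; last first.
  by apply: measurableT_comp => //; exact: measurable_funD.
rewrite -(@ge0_integral_lebesgue_shift a (fun x => f x * _ * _)%E); last 2 first.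
- apply: emeasurable_funM; first exact: emeasurable_funM.
  by apply/measurable_EFinP; exact: measurable_normal_pdf.
- by move=> x; rewrite !mule_ge0// lee_fin ?expR_ge0 ?normal_pdf_ge0.
apply: eq_integral => x _ /=; rewrite -muleA; congr (_ * _)%E.
rewrite -EFinM !normal_pdfE ?oner_neq0// /normal_fun mulrCA -expRD; congr (_ * expR _)%:E.
by rewrite expr1n; field.
Qed.

(** The shift formula for the constant function 1 says that [expR (x * a - a ^+ 2 / 2)] has integral
    1. *)
Lemma gauss_mgf (a : R) : (\int[@gauss R]_x (expR (a * x))%:E = (expR (a ^+ 2 / 2))%:E)%E.
Proof.
have E : (\int[@gauss R]_x (cst 1 x * (expR (x * a - a ^+ 2 / 2))%:E) = 1)%E.
  by rewrite -ge0_integral_gauss_shift//= ?integral_prob_cst// => x; exact: lee01.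
transitivity ((\int[@gauss R]_x ((expR (a ^+ 2 / 2))%:E * (cst 1 x * (expR (x * a - a ^+ 2 / 2))%:E)))%E).
  apply: eq_integral => x _; rewrite /= mul1e -EFinM -expRD; congr (expR _)%:E.
  by rewrite addrC subrK mulrC.
rewrite ge0_integralZl//.
- by rewrite E mule1.
- apply: emeasurable_funM => //; apply/measurable_EFinP/measurableT_comp => //.
  by apply: measurable_funB => //; exact: measurable_funM.
- by move=> x _; rewrite mule_ge0// lee_fin expR_ge0.
Qed.
End gauss_shift.

Section upd.
Context {R : realType} {d} {T : measurableType d} (P : probability T R).

Definition upd n (k : 'I_n) (x : T) (t : n.-tuple T) : n.-tuple T :=
  [tuple if j == k then x else tnth t j | j < n].

Lemma tnth_upd n (k j : 'I_n) x t : tnth (upd k x t) j = if j == k then x else tnth t j.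
Proof. by rewrite tnth_mktuple. Qed.

Lemma upd_upd n (k : 'I_n) x y t : upd k x (upd k y t) = upd k x t.
Proof. by apply: eq_from_tnth => j; rewrite !tnth_upd; case: eqP. Qed.

Lemma upd_tnth n (k : 'I_n) t : upd k (tnth t k) t = t.
Proof. by apply: eq_from_tnth => j; rewrite !tnth_upd; case: eqP => [->|]. Qed.

Lemma measurable_upd n (k : 'I_n) d' (S : measurableType d') (f : S -> T) (g : S -> n.-tuple T) :
  measurable_fun [set: S] f -> measurable_fun [set: S] g ->
  measurable_fun [set: S] (fun s => upd k (f s) (g s)).
Proof.
move=> mf mg; apply/measurable_fun_tnthP => j.
rewrite (_ : _ \o _ = fun s => if j == k then f s else tnth (g s) j); last first.
  by apply/funext => s /=; rewrite tnth_upd.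
by case: eqP => _; [exact: mf|exact: (@measurable_fun_tnthP _ _ _ _ _ g).1].
Qed.

(** Resampling one coordinate preserves a product law. This exposes coordinate [k], wherever it
    sits, as the variable of a one-dimensional integral with all the others frozen. *)
Lemma integral_upd n (k : 'I_n) (f : n.-tuple T -> \bar R) :
  measurable_fun [set: n.-tuple T] f -> (forall t, 0 <= f t)%E ->
  (\int[tpow P n]_t \int[P]_x f (upd k x t) = \int[tpow P n]_t f t)%E.
Proof.
move=> mf f0.
have mF m (l : 'I_m) (g : m.-tuple T -> \bar R) : measurable_fun [set: m.-tuple T] g ->
    measurable_fun [set: (T * m.-tuple T)%type] (fun z => g (upd l z.1 z.2)).
  by move=> mg; apply: measurableT_comp => //; exact: measurable_upd measurable_fst measurable_snd.
have mI m (l : 'I_m) (g : m.-tuple T -> \bar R) : measurable_fun [set: m.-tuple T] g ->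
    (forall t, 0 <= g t)%E ->
    measurable_fun [set: m.-tuple T] (fun t => \int[P]_x g (upd l x t))%E.
  move=> mg g0.
  apply: (@measurable_fun_fubini_tonelli_G _ _ _ _ R P (fun z => g (upd l z.1 z.2))) => //.
  exact: mF.
elim: n k f mf f0 => [[]//|n IH] k f mf f0.
have mt m (g : m.+1.-tuple T -> \bar R) : measurable_fun [set: m.+1.-tuple T] g ->
    measurable_fun [set: (T * m.-tuple T)%type] (fun z => g (tcons z)).
  by move=> mg; apply: measurableT_comp; [exact: mg|exact: measurable_tcons].
rewrite !integral_tpowS//; last 2 first.
- exact: mI.
- by move=> t; exact: integral_ge0.
have [k'|] := unliftP ord0 k => -> {k}.
  apply: eq_integral => y _; rewrite -[RHS](IH k')//; last first.
    by apply: (measurableT_comp (mt _ _ mf)) => //; exact: measurable_pair1.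
  apply: eq_integral => t _; apply: eq_integral => x _; congr f.
  apply: eq_from_tnth => j; rewrite tnth_upd.
  have [j'|] := unliftP ord0 j => -> {j}; last by rewrite !tnth0.
  by rewrite (inj_eq lift_inj) /tcons !tnthS tnth_upd.
rewrite (fubini_tonelli (fun z => f (tcons z)) (mt _ _ mf) (fun z => f0 _)).
(* The old head has been overwritten and no longer occurs in the integrand, so integrating over it
   does nothing. *)
transitivity (\int[P]_y \int[tpow P n]_t \int[P]_x f (tcons (x, t)))%E.
  apply: eq_integral => y _; apply: eq_integral => t _; apply: eq_integral => x _.
  congr f; apply: eq_from_tnth => j; rewrite tnth_upd.
  have [j'|] := unliftP ord0 j => -> {j}; last by rewrite !tnth0.
  by rewrite /tcons !tnthS.
exact: integral_prob_cst.
Qed.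
End upd.

(** * Changes of variables by shears *)

Section gauss_change.
Variables (R : realType) (d : nat).
Local Notation X := (d.-tuple R).
Local Notation pi_d := (tpow (@gauss R) d).

Definition sqn (t : X) : R := \sum_(j < d) tnth t j ^+ 2.

Lemma measurable_tnthR (j : 'I_d) : measurable_fun [set: X] (fun t : X => tnth t j).
Proof. exact: measurable_tnth. Qed.

Lemma measurable_sqn : measurable_fun [set: X] sqn.
Proof.
apply: measurable_sum => j; apply: measurable_funX; exact: measurable_tnthR.
Qed.

Lemma sqn_upd (k : 'I_d) x t : sqn (upd k x t) = sqn t - tnth t k ^+ 2 + x ^+ 2.
Proof.
rewrite /sqn (bigD1 k)//= [X in _ = X - _ + _](bigD1 k)//= tnth_upd eqxx.
rewrite addrC [X in _ = X - _ + _]addrC addrK; congr (_ + _).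
by apply: eq_bigr => j /negPf jk; rewrite tnth_upd jk.
Qed.

(** This is the change of variables formula for a volume-preserving map: the factor is the Gaussian
    density at [Phi t] divided by the one at [t]. Stated as an identity of integrals, it involves no
    derivative or determinant. *)
Record gchange (Psi Phi : X -> X) : Prop := GChange {
  gchange_mPsi : measurable_fun [set: X] Psi;
  gchange_mPhi : measurable_fun [set: X] Phi;
  gchangeK : cancel Psi Phi;
  gchangeE : forall f : X -> \bar R, measurable_fun [set: X] f -> (forall t, 0 <= f t)%E ->
    (\int[pi_d]_t f (Psi t) =
     \int[pi_d]_t (f t * (expR ((sqn t - sqn (Phi t)) / 2))%:E))%E }.

Lemma gchange_comp Psi1 Phi1 Psi2 Phi2 : gchange Psi1 Phi1 -> gchange Psi2 Phi2 ->
  gchange (Psi2 \o Psi1) (Phi1 \o Phi2).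
Proof.
move=> [mP1 mF1 K1 E1] [mP2 mF2 K2 E2]; split.
- exact: measurableT_comp.
- exact: measurableT_comp.
- exact: can_comp.
move=> f mf f0 /=.
rewrite (E1 (f \o Psi2)) /=; last 2 first.
- exact: measurableT_comp.
- by [].
pose g t := (f t * (expR ((sqn (Phi2 t) - sqn (Phi1 (Phi2 t))) / 2))%:E)%E.
transitivity (\int[pi_d]_t g (Psi2 t))%E.
  by apply: eq_integral => t _; rewrite /g K2.
rewrite E2; last 2 first.
- apply: emeasurable_funM => //; apply/measurable_EFinP/measurableT_comp => //.
  apply: measurable_funM => //; apply: measurable_funB.
    by apply: measurableT_comp => //; exact: measurable_sqn.
  apply: measurableT_comp; first exact: measurable_sqn.
  exact: measurableT_comp.
- by move=> t; rewrite mule_ge0// lee_fin expR_ge0.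
apply: eq_integral => t _; rewrite /g -muleA; congr (_ * _)%E.
by rewrite -EFinM -expRD; congr (expR _)%:E; field.
Qed.

Definition shear (k : 'I_d) (h : X -> R) (t : X) : X := upd k (tnth t k + h t) t.

Lemma measurable_shear k (h : X -> R) : measurable_fun [set: X] h -> measurable_fun [set: X] (shear k h).
Proof.
move=> mh; apply: measurable_upd; last exact: measurable_id.
by apply: measurable_funD => //; exact: measurable_tnthR.
Qed.

(** Once the other coordinates are frozen, [h t] is a constant and the shear is a translation of
    coordinate [k]; resampling that coordinate reduces the claim to the Gaussian shift. *)
Lemma gchange_shear k (h : X -> R) : measurable_fun [set: X] h ->
  (forall (x : R) (t : X), h (upd k x t) = h t) ->
  gchange (shear k h) (shear k (fun t => - h t)).
Proof.
move=> mh hk; split.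
- exact: measurable_shear.
- by apply: measurable_shear; exact: measurableT_comp.
- by move=> t; rewrite /shear hk upd_upd tnth_upd eqxx addrK upd_tnth.
move=> f mf f0.
have mu1 (t : X) : measurable_fun [set: R] (fun x => f (upd k x t)).
  apply: measurableT_comp => //.
  by apply: measurable_upd; [exact: measurable_id|exact: measurable_cst].
have me : measurable_fun [set: X]
   (fun t => (f t * (expR ((sqn t - sqn (shear k (fun u => - h u) t)) / 2))%:E)%E).
  apply: emeasurable_funM => //; apply/measurable_EFinP/measurableT_comp => //.
  apply: measurable_funM => //; apply: measurable_funB; first exact: measurable_sqn.
  apply: measurableT_comp; first exact: measurable_sqn.
  by apply: measurable_shear; exact: measurableT_comp.
rewrite -[LHS](@integral_upd _ _ _ _ _ k)//; last first.
  by apply: measurableT_comp => //; exact: measurable_shear.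
rewrite -[RHS](@integral_upd _ _ _ _ _ k)//; last first.
  by move=> t; rewrite mule_ge0// lee_fin expR_ge0.
apply: eq_integral => t _.
transitivity (\int[@gauss R]_x f (upd k (x + h t)%R t))%E.
  by apply: eq_integral => x _; rewrite /shear hk upd_upd tnth_upd eqxx.
rewrite (@ge0_integral_gauss_shift _ (h t) (fun x => f (upd k x t)))//.
apply: eq_integral => x _; congr (_ * (expR _)%:E)%E.
by rewrite /shear sqn_upd hk upd_upd !tnth_upd eqxx sqn_upd; field.
Qed.
End gauss_change.

(** * Second moments of Gaussian linear forms *)

Section moments.
Variables (R : realType).

Lemma measurable_lin d (a : 'I_d -> R) :
  measurable_fun [set: d.-tuple R] (fun t => \sum_(j < d) a j * tnth t j).
Proof.
apply: measurable_sum => j; apply: measurable_funM => //; exact: measurable_tnthR.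
Qed.

Lemma tpow_mgf d (a : 'I_d -> R) :
  (\int[tpow (@gauss R) d]_t (expR (\sum_(j < d) a j * tnth t j))%:E =
   (expR ((\sum_(j < d) a j ^+ 2) / 2))%:E)%E.
Proof.
have mL n (b : 'I_n -> R) : measurable_fun [set: n.-tuple R]
    (fun t => (expR (\sum_(j < n) b j * tnth t j))%:E).
  by apply/measurable_EFinP/measurableT_comp => //; exact: measurable_lin.
elim: d a => [|d IH] a; first by rewrite integral_tpow0// !big_ord0 mul0r.
rewrite integral_tpowS//.
transitivity (\int[@gauss R]_x ((expR (a ord0 * x))%:E *
   (expR ((\sum_(j < d) a (lift ord0 j) ^+ 2) / 2))%:E))%E.
  apply: eq_integral => x _; rewrite -IH -ge0_integralZl//; last exact: mL.
  apply: eq_integral => t _; rewrite -EFinM -expRD big_ord_recl; congr (expR (_ * _ + _))%:E.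
  by apply: eq_bigr => j _; rewrite tnthS.
rewrite ge0_integralZr//.
- by rewrite gauss_mgf -EFinM -expRD big_ord_recl; congr (expR _)%:E; field.
- by apply/measurable_EFinP/measurableT_comp => //; exact: measurable_funM.
Qed.

(** For [x >= 0], squaring [1 + x / 2 <= expR (x / 2)] gives [x ^+ 2 / 4 <= expR x]. Second moments
    can thus be read off from the moment generating function. *)
Lemma sqr_le_expR (x : R) : x ^+ 2 <= 4 * (expR x + expR (- x)).
Proof.
wlog x0 : x / 0 <= x => [H|].
  have [/H//|x0] := leP 0 x.
  by have := H (- x); rewrite oppr_ge0 ltW// sqrrN opprK addrC; exact.
have h : (1 + x / 2) ^+ 2 <= expR x.
  rewrite [X in expR X](_ : x = x / 2 + x / 2) ?expRD; last by field.
  rewrite expr2 ler_pM ?expR_ge1Dx//; lra.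
have := expR_ge0 (- x); nra.
Qed.

(** After normalizing [a] to unit length, the exponential bound gives [4 * 2 * expR (1 / 2)], and
    [expR (1 / 2) <= 2] yields 16. The exact value is 1; the loss only affects absolute
    constants. *)
Lemma tpow_sqr_lin_le d (a : 'I_d -> R) :
  (\int[tpow (@gauss R) d]_t ((\sum_(j < d) a j * tnth t j) ^+ 2)%:E <=
   (16 * \sum_(j < d) a j ^+ 2)%:E)%E.
Proof.
set A := \sum_(j < d) a j ^+ 2.
have A0 : 0 <= A by apply: sumr_ge0 => j _; exact: sqr_ge0.
have [A00|AN0] := eqVneq A 0.
  have a0 j : a j = 0.
    apply/eqP; rewrite -sqrf_eq0; apply/eqP.
    by apply: (psumr_eq0P _ A00) => // i _; exact: sqr_ge0.
  rewrite (eq_integral (cst 0%E)) ?integral0 ?A00 ?mulr0// => t _ /=.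
  by rewrite big1 ?expr0n//= => j _; rewrite a0 mul0r.
have sA : 0 < Num.sqrt A by rewrite sqrtr_gt0 lt_def AN0 A0.
pose b j := a j / Num.sqrt A.
have b1 : \sum_(j < d) b j ^+ 2 = 1.
  rewrite /b; under eq_bigr do rewrite expr_div_n sqr_sqrtr//.
  by rewrite -mulr_suml divff.
have Nb1 : \sum_(j < d) (- b j) ^+ 2 = 1.
  by under eq_bigr do rewrite sqrrN.
have mE (c : 'I_d -> R) : measurable_fun [set: d.-tuple R]
    (fun t => (expR (\sum_(j < d) c j * tnth t j))%:E).
  by apply/measurable_EFinP/measurableT_comp => //; exact: measurable_lin.
have A4 : (0 <= (A * 4)%:E)%E by rewrite lee_fin mulr_ge0.
apply: (@le_trans _ _ (\int[tpow (@gauss R) d]_t ((A * 4)%:E *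
    ((expR (\sum_(j < d) b j * tnth t j))%:E + (expR (\sum_(j < d) - b j * tnth t j))%:E)))%E).
  apply: ge0_le_integral => //.
  - by move=> t _; rewrite lee_fin sqr_ge0.
  - by apply/measurable_EFinP/measurable_funX; exact: measurable_lin.
  - by apply: emeasurable_funM => //; exact: emeasurable_funD.
  move=> t _; rewrite -EFinD -EFinM lee_fin.
  have -> : \sum_(j < d) a j * tnth t j = Num.sqrt A * \sum_(j < d) b j * tnth t j.
    rewrite mulr_sumr; apply: eq_bigr => j _; rewrite /b mulrA; congr (_ * _).
    by rewrite mulrC divfK// gt_eqF.
  have -> : \sum_(j < d) - b j * tnth t j = - \sum_(j < d) b j * tnth t j.
    by rewrite -sumrN; apply: eq_bigr => j _; rewrite mulNr.
  by rewrite exprMn sqr_sqrtr// -mulrA ler_wpM2l// sqr_le_expR.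
rewrite ge0_integralZl//; last first.
- by move=> t _; rewrite adde_ge0// lee_fin expR_ge0.
- exact: emeasurable_funD.
rewrite ge0_integralD//.
rewrite !tpow_mgf b1 Nb1 -EFinD -EFinM lee_fin.
have : expR (1 / 2 : R) <= 2.
  have := expR_ge1Dx (- (1 / 2) : R).
  have := expRxMexpNx_1 (1 / 2 : R); have := expR_gt0 (1 / 2 : R); nra.
nra.
Qed.
End moments.

(** * Switching between moves along a path *)

(* [sw a k] is the mass sent from pair [a] to pair [k]: row [a] carries at most
   [rho a], column [k] receives at most [1], and [min (rho a) 1] stays in place. *)
Section switching.
Variables (R : realType) (I : finType) (rho : I -> R).
Hypothesis rho0 : forall a, 0 <= rho a.

Definition exc a : R := Num.max (rho a - 1) 0.
Definition dfc a : R := Num.max (1 - rho a) 0.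
(** Dividing by the larger total serves both constraints at once: no row sends more than its excess
    and no column receives more than its deficit. If both totals vanish, so does every transfer. *)
Definition swmax : R := Num.max (\sum_a exc a) (\sum_a dfc a).
Definition sw a k : R := (if a == k then Num.min (rho a) 1 else 0) + exc a * dfc k / swmax.

Lemma exc_ge0 a : 0 <= exc a. Proof. by rewrite le_max lexx orbT. Qed.
Lemma dfc_ge0 a : 0 <= dfc a. Proof. by rewrite le_max lexx orbT. Qed.
Let sexc_ge0 : 0 <= \sum_a exc a. Proof. by apply: sumr_ge0 => a _; exact: exc_ge0. Qed.
Let sdfc_ge0 : 0 <= \sum_a dfc a. Proof. by apply: sumr_ge0 => a _; exact: dfc_ge0. Qed.
Lemma swmax_ge0 : 0 <= swmax. Proof. by rewrite le_max sexc_ge0. Qed.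

Lemma sw_ge0 a k : 0 <= sw a k.
Proof.
rewrite addr_ge0//; first by case: ifP => // _; rewrite le_min rho0 ler01.
by rewrite divr_ge0 ?swmax_ge0// mulr_ge0 ?exc_ge0 ?dfc_ge0.
Qed.

Let div_swmax_le1 x : 0 <= x -> x <= swmax -> x / swmax <= 1.
Proof.
move=> x0 xs; have [s0|] := eqVneq swmax 0; first by rewrite s0 invr0 mulr0 ler01.
by move=> sN0; rewrite ler_pdivrMr ?mul1r// lt_def sN0 swmax_ge0.
Qed.

Let min_exc a : Num.min (rho a) 1 + exc a = rho a.
Proof. by rewrite /exc; case: (leP (rho a) 1) => h; case: (leP (rho a - 1)) => ?; lra. Qed.

Let min_dfc a : Num.min (rho a) 1 + dfc a = 1.
Proof. by rewrite /dfc; case: (leP (rho a) 1) => h; case: (leP (1 - rho a)) => ?; lra. Qed.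

Lemma sum_sw_le a : \sum_k sw a k <= rho a.
Proof.
rewrite big_split/= -[leRHS]min_exc lerD//.
  rewrite -big_mkcond (big_pred1 a)//= => k; exact: eq_sym.
rewrite -mulr_suml -mulr_sumr -mulrA ler_piMr ?exc_ge0//.
by apply: div_swmax_le1 => //; rewrite le_max lexx orbT.
Qed.

Lemma sum_exc_dfc_le k : \sum_a exc a * dfc k / swmax <= dfc k.
Proof.
rewrite -!mulr_suml mulrAC ler_piMl ?dfc_ge0//.
by apply: div_swmax_le1 => //; rewrite le_max lexx.
Qed.

Lemma sum_sw_le1 k : \sum_a sw a k <= 1.
Proof.
rewrite big_split/= -[leRHS](min_dfc k) lerD ?sum_exc_dfc_le//.
by rewrite -big_mkcond (big_pred1 k).
Qed.

(** The transfer moves the smaller of the total excess and the total deficit, so mass is lost only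
    when the excess is the larger one. Deviations of opposite signs cancel across pairs, so the loss
    depends on the average density alone. *)
Lemma sum_rho_sw : \sum_a (rho a - \sum_k sw a k) = Num.max (\sum_a (rho a - 1)) 0.
Proof.
have E1 : \sum_a (rho a - 1) = \sum_a exc a - \sum_a dfc a.
  rewrite -sumrB; apply: eq_bigr => a _; have := min_exc a; have := min_dfc a; lra.
have E2 : \sum_a \sum_k sw a k = \sum_a Num.min (rho a) 1 + (\sum_a exc a) * (\sum_a dfc a) / swmax.
  rewrite mulr_suml mulr_suml -big_split; apply: eq_bigr => a _ /=.
  rewrite /sw big_split/= mulr_sumr mulr_suml; congr (_ + _).
  by rewrite -big_mkcond (big_pred1 a)// => k; exact: eq_sym.
have E3 : \sum_a rho a = \sum_a Num.min (rho a) 1 + \sum_a exc a.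
  by rewrite -big_split; apply: eq_bigr => a _ /=; rewrite min_exc.
rewrite sumrB E1 E2 E3.
have -> : (\sum_a exc a) * (\sum_a dfc a) / swmax = Num.min (\sum_a exc a) (\sum_a dfc a).
  rewrite /swmax; move: sexc_ge0 sdfc_ge0; set u := \sum_a exc a; set v := \sum_a dfc a => u0 v0.
  have [uv|vu] := leP u v.
    have [v_eq0|v_neq0] := eqVneq v 0; last by rewrite mulfK.
    by rewrite v_eq0 mulr0 mul0r; apply: le_anti; rewrite u0 -v_eq0 uv.
  by rewrite (mulrC u) mulfK// gt_eqF// (le_lt_trans v0).
set u := \sum_a exc a; set v := \sum_a dfc a.
by case: (leP u v) => ?; case: (leP (u - v) 0) => ?; lra.
Qed.

Lemma sw_neq a k : a != k -> sw a k = exc a * dfc k / swmax.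
Proof. by move=> /negPf ak; rewrite /sw ak add0r. Qed.
End switching.

(** A path of [N] moves lists [N + 1] pairs: the last listed pair makes the next move, after which
    its successor is appended. The final pair has therefore made no move, although [path_touch]
    counts it. *)
Fixpoint path_type (I : finType) (N : nat) : finType :=
  if N is N'.+1 then (path_type I N' * I)%type : finType else I.

Fixpoint path_last (I : finType) N : path_type I N -> I :=
  if N is N'.+1 return path_type I N -> I then fun p => p.2 else id.

Fixpoint path_touch (I : finType) (K : {pred I}) N : path_type I N -> bool :=
  if N is N'.+1 return path_type I N -> bool
  then fun p => path_touch K p.1 || (p.2 \in K) else fun a => a \in K.

Lemma sumpathS (V : nmodType) (I : finType) N (P : pred (path_type I N.+1))
  (F : path_type I N.+1 -> V) :
  \sum_(p : path_type I N.+1 | P p) F p =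
  \sum_(p : path_type I N) \sum_(k | P (p, k)) F (p, k).
Proof. by rewrite pair_big_dep /=; apply: eq_big => -[]. Qed.

Lemma measurable_sum_cond {R : realType} d (T : measurableType d)
  (J : finType) (P : pred J) (F : J -> T -> R) :
  (forall j, measurable_fun [set: T] (F j)) ->
  measurable_fun [set: T] (fun x => \sum_(j | P j) F j x).
Proof.
move=> mF; rewrite (_ : (fun _ => _) = fun x => \sum_j if P j then F j x else 0); last first.
  by apply/funext => x; rewrite big_mkcond.
by apply: measurable_sum => j; case: (P j).
Qed.

Lemma ge0_integral_sumr {R : realType} d (T : measurableType d)
  (mu : {measure set T -> \bar R}) (J : finType) (P : pred J) (F : J -> T -> R) :
  (forall j, measurable_fun [set: T] (F j)) -> (forall j x, 0 <= F j x) ->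
  (\int[mu]_x (\sum_(j | P j) F j x)%:E = \sum_(j | P j) \int[mu]_x (F j x)%:E)%E.
Proof.
move=> mF F0; under eq_integral do rewrite big_mkcond -sumEFin.
rewrite ge0_integral_sum//; first last.
- by move=> j x _; rewrite lee_fin; case: ifP.
- by move=> j; apply/measurable_EFinP; case: (P j).
rewrite [RHS]big_mkcond; apply: eq_bigr => j _; case: ifP => // _.
exact: integral0.
Qed.

Lemma measurable_inv_ge0 {R : realType} d (T : measurableType d) (f : T -> R) :
  measurable_fun [set: T] f -> (forall x, 0 <= f x) ->
  measurable_fun [set: T] (fun x => (f x)^-1).
Proof.
move=> mf f0; rewrite (_ : (fun _ => _) = fun x => f x `^ (-1)); last first.
  by apply/funext => x; rewrite powR_inv1.
exact: (measurableT_comp (measurable_powR _)).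
Qed.

Section paths.
Context {R : realType} {d} (X : measurableType d) (mu : probability X R) (I : finType).
Variables (Psi Phi : I -> X -> X) (rho : I -> X -> R).
Hypothesis mPsi : forall a, measurable_fun [set: X] (Psi a).
Hypothesis mPhi : forall a, measurable_fun [set: X] (Phi a).
Hypothesis PsiK : forall a, cancel (Psi a) (Phi a).
Hypothesis mrho : forall a, measurable_fun [set: X] (rho a).
Hypothesis rho0 : forall a x, 0 <= rho a x.
Hypothesis rhoE : forall a (f : X -> \bar R), measurable_fun [set: X] f ->
  (forall x, 0 <= f x)%E ->
  (\int[mu]_x f (Psi a x) = \int[mu]_x (f x * (rho a x)%:E))%E.
Hypothesis I0 : (0 < #|I|)%N.

Definition swx a k x : R := sw (rho^~ x) a k.
Local Notation iI := (#|I|%:R^-1 : R).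

Fixpoint path_map N : path_type I N -> X -> X :=
  if N is N'.+1 return path_type I N -> X -> X
  then fun p => Psi (path_last p.1) \o path_map p.1 else fun _ => id.

(* [path_fwd p x] is the conditional mass of the path [p] given its starting point
   [x], [path_bwd p y] the one given its end point [y = path_map p x]. *)
Fixpoint path_fwd N : path_type I N -> X -> R :=
  if N is N'.+1 return path_type I N -> X -> R
  then fun p x => let a := path_last p.1 in let z := Psi a (path_map p.1 x) in
    path_fwd p.1 x * (swx a p.2 z / rho a z)
  else fun _ _ => iI.

Fixpoint path_bwd N : path_type I N -> X -> R :=
  if N is N'.+1 return path_type I N -> X -> R
  then fun p x => let a := path_last p.1 in
    path_bwd p.1 (Phi a x) * swx a p.2 x
  else fun _ _ => iI.

Let iI0 : 0 <= iI. Proof. by rewrite invr_ge0. Qed.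

Let sumI : \sum_(a : I) iI = 1.
Proof. by rewrite sumr_const -[iI *+ _]mulr_natl mulfV// pnatr_eq0 -lt0n. Qed.

Lemma swx_ge0 a k x : 0 <= swx a k x. Proof. exact: sw_ge0. Qed.

Lemma sum_swx_le a x : \sum_k swx a k x <= rho a x.
Proof. exact: (@sum_sw_le _ _ (rho^~ x)). Qed.

Lemma sum_swx_le1 k x : \sum_a swx a k x <= 1.
Proof. exact: sum_sw_le1. Qed.

Lemma measurable_exc a : measurable_fun [set: X] (fun x => exc (rho^~ x) a).
Proof. by apply: measurable_maxr => //; exact: measurable_funB. Qed.

Lemma measurable_dfc a : measurable_fun [set: X] (fun x => dfc (rho^~ x) a).
Proof. by apply: measurable_maxr => //; exact: measurable_funB. Qed.

Lemma measurable_sw a k : measurable_fun [set: X] (swx a k).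
Proof.
apply: measurable_funD.
  by case: (a == k) => //; exact: measurable_minr.
apply: measurable_funM.
  by apply: measurable_funM; [exact: measurable_exc|exact: measurable_dfc].
apply: measurable_inv_ge0 => [|x]; last exact: swmax_ge0.
by apply: measurable_maxr; apply: measurable_sum => ?;
  [exact: measurable_exc|exact: measurable_dfc].
Qed.

Lemma measurable_path_map N (p : path_type I N) : measurable_fun [set: X] (path_map p).
Proof.
elim: N p => [|N IH] p; first exact: measurable_id.
by apply: measurableT_comp => //; exact: IH.
Qed.

Lemma measurable_path_fwd N (p : path_type I N) : measurable_fun [set: X] (path_fwd p).
Proof.
elim: N p => [|N IH] p; first exact: measurable_cst.
apply: measurable_funM; first exact: IH.
have mz : measurable_fun [set: X] (fun x => Psi (path_last p.1) (path_map p.1 x)).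
  by apply: measurableT_comp => //; exact: measurable_path_map.
apply: measurable_funM; first exact: (measurableT_comp (measurable_sw _ _) mz).
by apply: measurable_inv_ge0 => //; exact: (measurableT_comp (mrho _) mz).
Qed.

Lemma measurable_path_bwd N (p : path_type I N) : measurable_fun [set: X] (path_bwd p).
Proof.
elim: N p => [|N IH] p; first exact: measurable_cst.
apply: measurable_funM; last exact: measurable_sw.
by apply: measurableT_comp; first exact: IH.
Qed.

Lemma path_fwd_ge0 N (p : path_type I N) x : 0 <= path_fwd p x.
Proof.
elim: N p x => [|N IH] p x //=.
by rewrite mulr_ge0// divr_ge0// swx_ge0.
Qed.

Lemma path_bwd_ge0 N (p : path_type I N) x : 0 <= path_bwd p x.
Proof. by elim: N p x => [|N IH] p x //=; rewrite mulr_ge0// swx_ge0. Qed.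

(** Time reversal. Each move is a change of variables producing a factor [rho], which cancels the
    denominator in [path_fwd]. So the path and its end point have the same joint law whether the
    path is drawn from its start or from its end. *)
Lemma path_change N (p : path_type I N) (f : X -> \bar R) : measurable_fun [set: X] f ->
  (forall x, 0 <= f x)%E ->
  (\int[mu]_x (f (path_map p x) * (path_fwd p x)%:E) =
   \int[mu]_x (f x * (path_bwd p x)%:E))%E.
Proof.
elim: N p f => [|N IH] p f mf f0 //=.
set a := path_last p.1.
pose g z := (f (Psi a z) * (swx a p.2 (Psi a z) / rho a (Psi a z))%:E)%E.
have mg : measurable_fun [set: X] g.
  apply: emeasurable_funM; first exact: measurableT_comp.
  apply/measurable_EFinP; apply: measurable_funM.
    exact: (measurableT_comp (measurable_sw _ _) (mPsi a)).
  by apply: measurable_inv_ge0 => //; exact: (measurableT_comp (mrho _) (mPsi a)).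
have g0 z : (0 <= g z)%E by rewrite mule_ge0// lee_fin divr_ge0// swx_ge0.
transitivity (\int[mu]_x (g (path_map p.1 x) * (path_fwd p.1 x)%:E))%E.
  by apply: eq_integral => x _; rewrite /g -muleA -EFinM [(_ / _ * _)%R]mulrC.
rewrite IH//.
pose h x := (f x * (swx a p.2 x / rho a x)%:E * (path_bwd p.1 (Phi a x))%:E)%E.
transitivity (\int[mu]_x h (Psi a x))%E.
  by apply: eq_integral => x _; rewrite /h PsiK.
rewrite rhoE; last 2 first.
- apply: emeasurable_funM.
    apply: emeasurable_funM => //; apply/measurable_EFinP; apply: measurable_funM.
      exact: measurable_sw.
    exact: measurable_inv_ge0.
  by apply/measurable_EFinP; apply: measurableT_comp => //; exact: measurable_path_bwd.
- move=> x; rewrite mule_ge0//; first by rewrite mule_ge0// lee_fin divr_ge0// swx_ge0.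
  by rewrite lee_fin path_bwd_ge0.
apply: eq_integral => x _; rewrite /h -!muleA; congr (_ * _)%E; rewrite -!EFinM; congr EFin.
(* Where [rho a x] vanishes the quotient is a division by zero, but the row of [sw] is bounded by
   [rho a x] and vanishes with it. *)
have [r0|rN0] := eqVneq (rho a x) 0; last by field.
have : swx a p.2 x = 0.
  apply: le_anti; rewrite swx_ge0// andbT -[leRHS]r0.
  apply: le_trans (sum_swx_le a x); rewrite (bigD1 p.2)//= lerDl.
  by apply: sumr_ge0 => k _; exact: swx_ge0.
by move=> ->; rewrite !(mul0r, mulr0).
Qed.

Lemma sum_path_fwd_le1 N x : \sum_(p : path_type I N) path_fwd p x <= 1.
Proof.
elim: N => [|N IH].
  by rewrite /= sumI.
rewrite sumpathS; apply: le_trans IH; apply: ler_sum => p _ /=.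
rewrite -mulr_sumr ler_piMr ?path_fwd_ge0// -mulr_suml.
set z := Psi _ _; have := sum_swx_le (path_last p) z.
have [->|r0] := eqVneq (rho (path_last p) z) 0; first by rewrite invr0 mulr0 ler01.
by move=> h; rewrite ler_pdivrMr ?mul1r// lt_def r0 rho0.
Qed.

(** The invariant of the walk: given the current point, the current pair is at most uniformly
    distributed. It propagates because the columns of [sw] sum to at most 1. *)
Lemma sum_path_bwd_last_le N a x :
  \sum_(p : path_type I N | path_last p == a) path_bwd p x <= iI.
Proof.
elim: N a x => [|N IH] a x; first by rewrite (big_pred1 a).
rewrite sumpathS/=.
under eq_bigr do rewrite (big_pred1 a)//=.
rewrite (partition_big (@path_last I N) xpredT)//=.
apply: (@le_trans _ _ (\sum_b iI * swx b a x)).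
  apply: ler_sum => b _.
  apply: (@le_trans _ _ ((\sum_(p : path_type I N | path_last p == b) path_bwd p (Phi b x)) * swx b a x)).
    by rewrite mulr_suml ler_sum// => p /eqP ->.
  by rewrite ler_wpM2r ?swx_ge0.
by rewrite -mulr_sumr ler_piMr// sum_swx_le1.
Qed.

Lemma sum_path_bwd_le1 N x : \sum_(p : path_type I N) path_bwd p x <= 1.
Proof.
rewrite (partition_big (@path_last I N) xpredT)//=.
apply: (@le_trans _ _ (\sum_(a : I) iI)).
  by apply: ler_sum => a _; exact: sum_path_bwd_last_le.
by rewrite sumI.
Qed.

(* One more move [Psi (path_last p)] is undone at the price of the density. *)
Let integral_sum_bwd N (P : pred (path_type I N)) :
  (\int[mu]_x (\sum_(p | P p) path_bwd p x)%:E =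
   \int[mu]_x (\sum_(p | P p) path_bwd p (Phi (path_last p) x) * rho (path_last p) x)%:E)%E.
Proof.
rewrite ge0_integral_sumr//; last 2 first.
- by move=> p; exact: measurable_path_bwd.
- by move=> p x; exact: path_bwd_ge0.
rewrite ge0_integral_sumr//; last 2 first.
- move=> p; apply: measurable_funM => //.
  by apply: measurableT_comp => //; exact: measurable_path_bwd.
- by move=> p x; rewrite mulr_ge0// path_bwd_ge0.
apply: eq_bigr => p _.
transitivity (\int[mu]_x (path_bwd p (Phi (path_last p) (Psi (path_last p) x)))%:E)%E.
  by apply: eq_integral => x _; rewrite PsiK.
rewrite (rhoE _ (f := fun x => (path_bwd p (Phi (path_last p) x))%:E)).
- by apply: eq_integral => x _; rewrite EFinM.
- by apply/measurable_EFinP; apply: measurableT_comp => //; exact: measurable_path_bwd.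
- by move=> x; rewrite lee_fin path_bwd_ge0.
Qed.

Let sum_bwd_le N (G : I -> R) (P : pred I) x : (forall a, 0 <= G a) ->
  \sum_(p : path_type I N | P (path_last p)) path_bwd p (Phi (path_last p) x) * G (path_last p)
  <= iI * \sum_(a | P a) G a.
Proof.
move=> G0; rewrite (partition_big (@path_last I N) P)//= mulr_sumr.
apply: ler_sum => a Pa.
apply: (@le_trans _ _ ((\sum_(p : path_type I N | path_last p == a) path_bwd p (Phi a x)) * G a)).
  rewrite mulr_suml big_mkcond [leRHS]big_mkcond ler_sum// => p _.
  case: (eqVneq (path_last p) a) => [->|_]; last by rewrite andbF.
  by rewrite Pa.
by rewrite ler_wpM2r// sum_path_bwd_last_le.
Qed.

Let rho_int1 a : (\int[mu]_x (rho a x)%:E = 1)%E.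
Proof.
have := rhoE a (measurable_cst (1%E : \bar R)) (fun _ => lee01).
rewrite /= integral_prob_cst => ->; apply: eq_integral => x _; by rewrite mul1e.
Qed.

(** Each [rho a] has mean 1, so the positive and negative parts of the total deviation have equal
    integrals. A one-sided upper bound on [1 - rho a], which is what convexity of the exponential
    provides, therefore controls the mass lost. *)
Let int_rho_sum : (\int[mu]_x (Num.max (\sum_a (rho a x - 1)) 0)%:E =
  \int[mu]_x (Num.max (\sum_a (1 - rho a x)) 0)%:E)%E.
Proof.
have mE (F : I -> X -> R) : (forall a, measurable_fun [set: X] (F a)) ->
    measurable_fun [set: X] (fun x => (Num.max (\sum_a F a x) 0)%:E).
  by move=> mF; apply/measurable_EFinP/measurable_maxr => //; exact: measurable_sum_cond.
have E0 (r : R) : (0 <= (Num.max r 0)%:E)%E by rewrite lee_fin le_max lexx orbT.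
have sr : (\int[mu]_x (\sum_a rho a x)%:E = (#|I|%:R)%:E)%E.
  rewrite ge0_integral_sumr//.
  under eq_bigr do rewrite rho_int1.
  by rewrite sumEFin sumr_const.
set A := (X in X = _); set B := (X in _ = X).
suff H : ((#|I|%:R)%:E + A = (#|I|%:R)%:E + B)%E.
  by apply: le_anti; apply/andP; split; rewrite -(leeD2lE _ _ (x := (#|I|%:R)%:E))// H.
rewrite /A /B {A B}.
rewrite -{2}sr -{1}(integral_prob_cst mu (#|I|%:R)%:E) -!ge0_integralD//; first last.
- by apply: mE => a; exact: measurable_funB.
- by apply: mE => a; exact: measurable_funB.
- by apply/measurable_EFinP; exact: measurable_sum_cond.
- by move=> x _; rewrite lee_fin sumr_ge0.
apply: eq_integral => x _; rewrite -!EFinD; congr EFin.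
rewrite !sumrB sumr_const; set s := \sum_a rho a x; set n : R := 1 *+ _.
by case: (leP (s - n) 0); case: (leP (n - s) 0) => ? ?; lra.
Qed.

Variable loss : R.
Hypothesis lossP :
  (\int[mu]_x (Num.max (\sum_a (1 - rho a x)) 0)%:E <= (#|I|%:R * loss)%:E)%E.

(** By the uniformity invariant, one more move loses at most the uniform average over [a] of
    [rho a - \sum_k sw a k], and [sum_rho_sw] evaluates it. *)
Lemma path_mass_ge N :
  (1 <= \int[mu]_x (\sum_(p : path_type I N) path_bwd p x)%:E + (N%:R * loss)%:E)%E.
Proof.
elim: N => [|N IH].
  by rewrite /= mul0r adde0 sumI integral_prob_cst.
apply: le_trans IH _; rewrite -natr1 mulrDl mul1r [(_ * loss + loss)%R]addrC EFinD addeA leeD2r//.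
have mb N' (p : path_type I N') : measurable_fun [set: X] (path_bwd p).
  exact: measurable_path_bwd.
have mm : measurable_fun [set: X] (fun x => Num.max (\sum_a (rho a x - 1)) 0).
  by apply: measurable_maxr => //; apply: measurable_sum_cond => a; exact: measurable_funB.
have E0 (r : R) : 0 <= Num.max r 0 by rewrite le_max lexx orbT.
apply: (@le_trans _ _ (\int[mu]_x ((\sum_(p : path_type I N.+1) path_bwd p x)%:E +
    (iI * Num.max (\sum_a (rho a x - 1)) 0)%:E))%E).
  rewrite integral_sum_bwd; apply: ge0_le_integral => //.
  - by move=> x _; rewrite lee_fin sumr_ge0// => p _; rewrite mulr_ge0// path_bwd_ge0.
  - apply/measurable_EFinP/measurable_sum_cond => p; apply: measurable_funM => //.
    exact: (measurableT_comp (mb _ _)).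
  - apply: emeasurable_funD; apply/measurable_EFinP; first exact: measurable_sum_cond.
    exact: measurable_funM.
  move=> x _; rewrite -EFinD lee_fin -lerBlDl sumpathS /=.
  rewrite -sumrB (eq_bigr (fun p => path_bwd p (Phi (path_last p) x) *
    (rho (path_last p) x - \sum_k swx (path_last p) k x))); last first.
    by move=> p _; rewrite mulrBr mulr_sumr.
  rewrite -(sum_rho_sw (rho^~ x)).
  apply: (@sum_bwd_le N (fun a => rho a x - \sum_k swx a k x) xpredT) => a.
  by rewrite subr_ge0 sum_swx_le.
rewrite ge0_integralD//; first last.
- by apply/measurable_EFinP; exact: measurable_funM.
- by move=> x _; rewrite lee_fin mulr_ge0.
- by apply/measurable_EFinP; exact: measurable_sum_cond.
- by move=> x _; rewrite lee_fin sumr_ge0// => p _; exact: path_bwd_ge0.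
rewrite leeD2l//; under eq_integral do rewrite EFinM.
rewrite ge0_integralZl//; last 2 first.
- exact/measurable_EFinP.
- by move=> x _; rewrite lee_fin.
rewrite int_rho_sum; apply: (le_trans (lee_wpmul2l _ lossP)); first by rewrite lee_fin.
by rewrite -EFinM lee_fin mulKf// pnatr_eq0 -lt0n.
Qed.

Variables (K : {pred I}) (tau : R).
Hypothesis tauP :
  (\int[mu]_x (\sum_(k in K) Num.max (1 - rho k x) 0)%:E <= (#|I|%:R * tau)%:E)%E.

(** A path meets [K] either at its initial pair, which is uniform, or by a transfer into [K] from
    outside. A transfer into [k] is paid for by the deficit of [k], whence one term [tau] per
    move. *)
Lemma path_touch_le N :
  (\int[mu]_x (\sum_(p : path_type I N | path_touch K p) path_bwd p x)%:E <=
   (#|K|%:R / #|I|%:R + N%:R * tau)%:E)%E.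
Proof.
elim: N => [|N IH].
  by rewrite /= mul0r addr0 sumr_const integral_prob_cst lee_fin mulrC mulr_natr.
have mb N' (p : path_type I N') : measurable_fun [set: X] (path_bwd p).
  exact: measurable_path_bwd.
have ms : measurable_fun [set: X] (fun x => \sum_(k in K) Num.max (1 - rho k x) 0).
  by apply: measurable_sum_cond => k; apply: measurable_maxr => //; exact: measurable_funB.
have s0 x : 0 <= \sum_(k in K) Num.max (1 - rho k x) 0.
  by apply: sumr_ge0 => k _; rewrite le_max lexx orbT.
rewrite -natr1 mulrDl mul1r addrA EFinD.
apply: (@le_trans _ _ (\int[mu]_x ((\sum_(p : path_type I N | path_touch K p)
    path_bwd p (Phi (path_last p) x) * rho (path_last p) x)%:E +
    (iI * \sum_(k in K) Num.max (1 - rho k x) 0)%:E))%E).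
  apply: ge0_le_integral => //.
  - by move=> x _; rewrite lee_fin sumr_ge0// => p _; exact: path_bwd_ge0.
  - by apply/measurable_EFinP; exact: measurable_sum_cond.
  - apply: emeasurable_funD; apply/measurable_EFinP; last exact: measurable_funM.
    apply: measurable_sum_cond => p; apply: measurable_funM => //.
    exact: (measurableT_comp (mb _ _)).
  move=> x _; rewrite -EFinD lee_fin sumpathS /=.
  rewrite (bigID (@path_touch I K N))/= lerD//.
    apply: ler_sum => p /= ->; rewrite /= -mulr_sumr ler_wpM2l ?path_bwd_ge0//.
    exact: sum_swx_le.
  apply: (@le_trans _ _ (\sum_(p : path_type I N) \sum_(k in K)
      path_bwd p (Phi (path_last p) x) *
      (exc (rho^~ x) (path_last p) * dfc (rho^~ x) k / swmax (rho^~ x)))).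
    rewrite [leLHS]big_mkcond; apply: ler_sum => p _.
    have t0 k : 0 <= path_bwd p (Phi (path_last p) x) *
      (exc (rho^~ x) (path_last p) * dfc (rho^~ x) k / swmax (rho^~ x)).
      by rewrite mulr_ge0 ?path_bwd_ge0// divr_ge0 ?swmax_ge0// mulr_ge0 ?exc_ge0 ?dfc_ge0.
    case: ifPn => [/negPf tp|_]; last exact: sumr_ge0.
    (* An untouched path currently sits outside [K], so the diagonal part of [sw] does not
       contribute. *)
    rewrite tp/=; apply: ler_sum => k kK; rewrite /swx sw_neq//.
    apply/eqP => lk; move: tp; suff -> : path_touch K p by [].
    by move: kK; rewrite -lk; case: (N) (p) => //= N' p' ->; rewrite orbT.
  rewrite exchange_big mulr_sumr/=; apply: ler_sum => k _.
  apply: le_trans (@sum_bwd_le N (fun a => exc (rho^~ x) a * dfc (rho^~ x) k / swmax (rho^~ x)) xpredT x _) _.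
    by move=> a; rewrite divr_ge0 ?swmax_ge0// mulr_ge0 ?exc_ge0 ?dfc_ge0.
  by rewrite ler_wpM2l// sum_exc_dfc_le.
rewrite ge0_integralD//; first last.
- by apply/measurable_EFinP; exact: measurable_funM.
- by move=> x _; rewrite lee_fin mulr_ge0.
- apply/measurable_EFinP; apply: measurable_sum_cond => p; apply: measurable_funM => //.
  exact: (measurableT_comp (mb _ _)).
- by move=> x _; rewrite lee_fin sumr_ge0// => p _; rewrite mulr_ge0// path_bwd_ge0.
rewrite leeD -?integral_sum_bwd//; under eq_integral do rewrite EFinM.
rewrite ge0_integralZl//; last 2 first.
- exact/measurable_EFinP.
- by move=> x _; rewrite lee_fin.
apply: (le_trans (lee_wpmul2l _ tauP)); first by rewrite lee_fin.
by rewrite -EFinM lee_fin mulKf// pnatr_eq0 -lt0n.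
Qed.
End paths.

(** * Rotating the two group sums *)

Section rotation.
Variables (R : realType) (d m : nat) (e1 e2 : 'I_m -> 'I_d).
Hypotheses (e1I : injective e1) (e2I : injective e2) (e12 : forall i j, e1 i != e2 j).
Local Notation X := (d.-tuple R).
Local Notation pi_d := (tpow (@gauss R) d).

Definition gsum (e : 'I_m -> 'I_d) (t : X) : R := \sum_(i < m) tnth t (e i).

Lemma gsum_upd_out (e : 'I_m -> 'I_d) l (x : R) t : (forall i, e i != l) ->
  gsum e (upd l x t) = gsum e t.
Proof. by move=> el; apply: eq_bigr => i _; rewrite tnth_upd (negPf (el i)). Qed.

Lemma gsum_upd (e : 'I_m -> 'I_d) i (x : R) t : injective e ->
  gsum e (upd (e i) x t) = gsum e t - tnth t (e i) + x.
Proof.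
move=> eI; rewrite /gsum (bigD1 i)//= [X in _ = X - _ + _](bigD1 i)//= tnth_upd eqxx.
rewrite addrC [X in _ = X - _ + _]addrC addrK; congr (_ + _).
by apply: eq_bigr => j ji; rewrite tnth_upd (inj_eq eI) (negPf ji).
Qed.

Lemma measurable_gsum (e : 'I_m -> 'I_d) : measurable_fun [set: X] (gsum e).
Proof. by apply: measurable_sum => i; exact: measurable_tnthR. Qed.

Lemma integral_gsum_sqr_le (e : 'I_m -> 'I_d) : injective e ->
  (\int[pi_d]_t (gsum e t ^+ 2)%:E <= (16 * m%:R)%:E)%E.
Proof.
(* [a] is the indicator vector of the image of [e]; by injectivity its squared norm is [m]. *)
move=> eI; pose a j : R := \sum_(i < m) (e i == j)%:R.
have -> : m%:R = \sum_(j < d) a j ^+ 2 :> R.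
  transitivity (\sum_(i < m) \sum_(i' < m) \sum_(j < d) (e i == j)%:R * (e i' == j)%:R : R).
    rewrite -[m in LHS]card_ord -sum1_card natr_sum; apply: eq_bigr => i _.
    rewrite (bigD1 i)//= (bigD1 (e i))//= eqxx mulr1 big1 ?addr0 => [|j /negPf ji]; last first.
      by rewrite eq_sym ji mul0r.
    rewrite big1 ?addr0// => i' /negPf ii'; apply: big1 => j _.
    by case: eqP => [<-|_]; rewrite ?mul0r// (inj_eq eI) ii' mulr0.
  under eq_bigr do rewrite exchange_big/=.
  rewrite exchange_big/=; apply: eq_bigr => j _.
  by rewrite expr2 mulr_suml; apply: eq_bigr => i _; rewrite mulr_sumr.
apply: le_trans (tpow_sqr_lin_le a); rewrite le_eqVlt; apply/orP; left; apply/eqP.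
apply: eq_integral => t _; congr (_ ^+ 2)%:E.
under [RHS]eq_bigr do rewrite mulr_suml.
rewrite exchange_big/=; apply: eq_bigr => i _.
rewrite (bigD1 (e i))//= eqxx mul1r big1 ?addr0// => j /negPf ji.
by rewrite eq_sym ji mul0r.
Qed.

Lemma integral_tnth_sqr_le (l : 'I_d) : (\int[pi_d]_t (tnth t l ^+ 2)%:E <= 16%:E)%E.
Proof.
have := @tpow_sqr_lin_le R d (fun j => (j == l)%:R).
rewrite (bigD1 l)//= eqxx expr1n big1 ?addr0 ?mulr1; last first.
  by move=> j /negPf ->; rewrite expr0n.
congr (_ <= _)%E; apply: eq_integral => t _; congr (_ ^+ 2)%:E.
by rewrite (bigD1 l)//= eqxx mul1r big1 ?addr0// => j /negPf ->; rewrite mul0r.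
Qed.

(* With [tt = tan (delta / 2)] and [sn = sin delta], these three shears compose to
   the rotation of angle [- delta] of the plane [(gsum e1, gsum e2)]. *)
Definition rot (tt sn : R) (a : 'I_m * 'I_m) (t : X) : X :=
  shear (e1 a.1) (fun t => tt * gsum e2 t)
   (shear (e2 a.2) (fun t => - sn * gsum e1 t)
     (shear (e1 a.1) (fun t => tt * gsum e2 t) t)).

Let e21 i j : e2 i != e1 j. Proof. by rewrite eq_sym. Qed.

Lemma gchange_rot tt sn a : gchange (rot tt sn a) (rot (- tt) (- sn) a).
Proof.
have G1 : gchange (shear (e1 a.1) (fun t => tt * gsum e2 t))
                  (shear (e1 a.1) (fun t => - tt * gsum e2 t)).
  rewrite (_ : (fun t => - tt * gsum e2 t) = (fun t => - (tt * gsum e2 t))); last first.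
    by apply/funext => t; rewrite mulNr.
  apply: gchange_shear; first by apply: measurable_funM => //; exact: measurable_gsum.
  by move=> x t; rewrite gsum_upd_out.
have G2 : gchange (shear (e2 a.2) (fun t => - sn * gsum e1 t))
                  (shear (e2 a.2) (fun t => - - sn * gsum e1 t)).
  rewrite (_ : (fun t => - - sn * gsum e1 t) = (fun t => - (- sn * gsum e1 t))); last first.
    by apply/funext => t; rewrite !mulNr.
  apply: gchange_shear; first by apply: measurable_funM => //; exact: measurable_gsum.
  by move=> x t; rewrite gsum_upd_out.
exact: (gchange_comp (gchange_comp G1 G2) G1).
Qed.

Section params.
Variables (cs sn tt : R).
Hypotheses (tt1 : tt * (1 + cs) = sn) (tt2 : tt * sn = 1 - cs).

Lemma rotE a t : rot tt sn a t =
  upd (e1 a.1) (tnth t (e1 a.1) + ((cs - 1) * gsum e1 t + sn * gsum e2 t))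
   (upd (e2 a.2) (tnth t (e2 a.2) + (- sn * gsum e1 t + (cs - 1) * gsum e2 t)) t).
Proof.
have E12 := negPf (e12 a.1 a.2); have E21 := negPf (e21 a.2 a.1).
rewrite /rot /shear !(gsum_upd, gsum_upd_out, tnth_upd, eqxx, E12, E21, upd_upd)//.
apply: eq_from_tnth => l; rewrite !tnth_upd.
set g1 := gsum e1 t; set g2 := gsum e2 t; set x := tnth t (e1 a.1); set y := tnth t (e2 a.2).
case: (l == e1 a.1).
  apply/eqP; rewrite -subr_eq0; apply/eqP.
  transitivity ((tt * (1 + cs) - sn) * g2 - (tt * sn - (1 - cs)) * (g1 + tt * g2)); first by ring.
  by rewrite tt1 tt2 !subrr !mul0r subr0.
case: (l == e2 a.2) => //.
apply/eqP; rewrite -subr_eq0; apply/eqP.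
transitivity (- (tt * sn - (1 - cs)) * g2); first by ring.
by rewrite tt2 subrr oppr0 mul0r.
Qed.

Lemma gsum1_rot a t : gsum e1 (rot tt sn a t) = cs * gsum e1 t + sn * gsum e2 t.
Proof.
rewrite rotE gsum_upd// gsum_upd_out// tnth_upd (negPf (e12 _ _)).
by set x := tnth _ _; ring.
Qed.

Lemma gsum2_rot a t : gsum e2 (rot tt sn a t) = - sn * gsum e1 t + cs * gsum e2 t.
Proof.
rewrite rotE gsum_upd_out// gsum_upd//.
by set x := tnth _ _; ring.
Qed.

Lemma tnth_rot a t l : l != e1 a.1 -> l != e2 a.2 -> tnth (rot tt sn a t) l = tnth t l.
Proof. by rewrite rotE !tnth_upd => /negPf -> /negPf ->. Qed.
End params.

Section density.
Variables (cs sn tt : R).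
Hypotheses (tt1 : tt * (1 + cs) = sn) (tt2 : tt * sn = 1 - cs) (cs1 : cs <= 1).

Definition rot_density (a : 'I_m * 'I_m) (t : X) : R :=
  expR ((sqn t - sqn (rot (- tt) (- sn) a t)) / 2).

Lemma measurable_rot_density a : measurable_fun [set: X] (rot_density a).
Proof.
apply: measurableT_comp => //; apply: measurable_funM => //.
apply: measurable_funB; first exact: measurable_sqn.
apply: measurableT_comp; first exact: measurable_sqn.
exact: gchange_mPhi (gchange_rot tt sn a).
Qed.

(** [xi] and [zeta] are the increments that the inverse move adds to its two coordinates. *)
Let xi t := (cs - 1) * gsum e1 t - sn * gsum e2 t.
Let zeta t := sn * gsum e1 t + (cs - 1) * gsum e2 t.

Let sn2 : sn ^+ 2 = 1 - cs ^+ 2.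
Proof. by rewrite expr2 -{1}tt1 mulrAC tt2; ring. Qed.

Let xi_zeta t : xi t ^+ 2 + zeta t ^+ 2 = 2 * (1 - cs) * (gsum e1 t ^+ 2 + gsum e2 t ^+ 2).
Proof.
transitivity (((cs - 1) ^+ 2 + sn ^+ 2) * (gsum e1 t ^+ 2 + gsum e2 t ^+ 2)).
  by rewrite /xi /zeta; ring.
by rewrite sn2; ring.
Qed.

Let sqn_rot a t : sqn (rot (- tt) (- sn) a t) - sqn t =
  2 * tnth t (e1 a.1) * xi t + xi t ^+ 2 + (2 * tnth t (e2 a.2) * zeta t + zeta t ^+ 2).
Proof.
have h1 : - tt * (1 + cs) = - sn by rewrite mulNr tt1.
have h2 : - tt * - sn = 1 - cs by rewrite mulrNN.
rewrite (rotE h1 h2) sqn_upd sqn_upd tnth_upd (negPf (e12 _ _)) /xi /zeta opprK.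
by set x := tnth _ _; set y := tnth _ _; ring.
Qed.

Let rot_density_ge a t : 1 - rot_density a t <=
  (2 * tnth t (e1 a.1) * xi t + xi t ^+ 2 + (2 * tnth t (e2 a.2) * zeta t + zeta t ^+ 2)) / 2.
Proof.
rewrite -sqn_rot lerBlDr -lerBlDl; apply: le_trans (expR_ge1Dx _).
lra.
Qed.

Let sum_pair (F : 'I_m -> R) : \sum_(a : 'I_m * 'I_m) F a.1 = m%:R * \sum_i F i.
Proof.
rewrite -(pair_bigA _ (fun i _ => F i))/= mulr_sumr; apply: eq_bigr => i _.
by rewrite sumr_const card_ord mulr_natl.
Qed.

Let sum_pair2 (F : 'I_m -> R) : \sum_(a : 'I_m * 'I_m) F a.2 = m%:R * \sum_i F i.
Proof.
rewrite -(pair_bigA _ (fun _ j => F j))/= sumr_const card_ord mulr_natl//.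
Qed.

(** In the sum over all pairs, the terms linear in single coordinates become the inner product of
    the group sums with [(xi, zeta)]. A rotation displaces almost orthogonally to the position, so
    this product equals [- (1 - cs)] times the squared radius: the first order in the angle
    cancels. *)
Lemma sum_rot_density_le t : Num.max (\sum_a (1 - rot_density a t)) 0 <=
  m%:R ^+ 2 * (1 - cs) * (gsum e1 t ^+ 2 + gsum e2 t ^+ 2).
Proof.
have B0 : 0 <= (1 - cs) * (gsum e1 t ^+ 2 + gsum e2 t ^+ 2).
  by rewrite mulr_ge0 ?subr_ge0// addr_ge0 ?sqr_ge0.
rewrite ge_max; apply/andP; split; last by rewrite -mulrA mulr_ge0// sqr_ge0.
apply: le_trans (ler_sum _ (fun a _ => rot_density_ge a t)) _.
have sF e z : \sum_(i < m) (2 * tnth t (e i) * z + z ^+ 2) = 2 * gsum e t * z + m%:R * z ^+ 2.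
  by rewrite big_split/= -mulr_suml -mulr_sumr sumr_const card_ord -[_ *+ m]mulr_natl.
rewrite -mulr_suml big_split/=.
rewrite (sum_pair (fun i => 2 * tnth t (e1 i) * xi t + xi t ^+ 2)).
rewrite (sum_pair2 (fun i => 2 * tnth t (e2 i) * zeta t + zeta t ^+ 2)) !sF.
have E : gsum e1 t * xi t + gsum e2 t * zeta t =
    - (1 - cs) * (gsum e1 t ^+ 2 + gsum e2 t ^+ 2) by rewrite /xi /zeta; ring.
have E2 := xi_zeta t.
set M : R := m%:R; have M0 : 0 <= M by [].
set Q := gsum e1 t ^+ 2 + gsum e2 t ^+ 2 in B0 E E2 *.
rewrite [leLHS](_ : _ = M * (gsum e1 t * xi t + gsum e2 t * zeta t) +
  M ^+ 2 * (xi t ^+ 2 + zeta t ^+ 2) / 2); last by field.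
rewrite E E2 -subr_ge0 [leRHS](_ : _ = M * ((1 - cs) * Q)); last by field.
exact: mulr_ge0.
Qed.

(** For a single pair nothing cancels, and the cross term between a coordinate of order 1 and an
    increment of order [sqrt m * delta] is split by the weighted arithmetic-geometric inequality.
    The weight [eps] stays free until the parameters are chosen. *)
Lemma rot_density_max_le a t (eps : R) : 0 < eps -> Num.max (1 - rot_density a t) 0 <=
  eps / 2 * (tnth t (e1 a.1) ^+ 2 + tnth t (e2 a.2) ^+ 2) +
  (eps^-1 + 1) * ((1 - cs) * (gsum e1 t ^+ 2 + gsum e2 t ^+ 2)).
Proof.
move=> eps0; have ei0 : 0 < eps^-1 by rewrite invr_gt0.
have ag x z : 2 * x * z <= eps * x ^+ 2 + eps^-1 * z ^+ 2.
  have : 0 <= eps^-1 * (eps * x - z) ^+ 2 by rewrite mulr_ge0 ?sqr_ge0// ltW.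
  have -> : eps^-1 * (eps * x - z) ^+ 2 = eps * x ^+ 2 + eps^-1 * z ^+ 2 - 2 * x * z.
    by field; rewrite gt_eqF.
  lra.
have Q0 : 0 <= gsum e1 t ^+ 2 + gsum e2 t ^+ 2 by rewrite addr_ge0 ?sqr_ge0.
have -> : (1 - cs) * (gsum e1 t ^+ 2 + gsum e2 t ^+ 2) = (xi t ^+ 2 + zeta t ^+ 2) / 2.
  by rewrite xi_zeta; field.
rewrite ge_max; apply/andP; split.
  apply: le_trans (rot_density_ge a t) _.
  have := ag (tnth t (e1 a.1)) (xi t); have := ag (tnth t (e2 a.2)) (zeta t); lra.
by rewrite addr_ge0 ?mulr_ge0 ?divr_ge0 ?addr_ge0 ?sqr_ge0 ?ltW.
Qed.
End density.
End rotation.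

Definition complete_ex d (beta : d.-tuple RR) (sigma : RR) (xz : d.-tuple RR * RR) : example d :=
  (xz.1, \sum_(j < d) tnth beta j * tnth xz.1 j + sigma * xz.2).

Definition gauss_row d : probability (d.-tuple RR * RR)%type RR :=
  (tpow (@gauss RR) d \x @gauss RR)%E.

(** * Mask schemes *)

(* A randomized choice of a mask for one row: under [beta s], given the covariates
   [x], choice [c] is made with probability [ms_w s c x].  Field [ms_vis] says that
   the joint law of the choice and of the visible part of the row does not depend
   on [s].  The erasure probabilities need only be bounded under [beta true]. *)
Record mask_scheme d (sigma p : RR) (beta : bool -> d.-tuple RR) : Type := MaskScheme {
  ms_choice : finType;
  ms_mask : ms_choice -> Defs.mask d;
  ms_w : bool -> ms_choice -> d.-tuple RR -> RR;
  ms_measurable : forall s c, measurable_fun [set: d.-tuple RR] (ms_w s c);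
  ms_ge0 : forall s c x, 0 <= ms_w s c x;
  ms_sum : forall s x, \sum_c ms_w s c x = 1;
  ms_vis : forall c (g : iexample d -> \bar RR), measurable_fun [set: iexample d] g ->
    (forall v, 0 <= g v)%E ->
    (\int[gauss_row d]_z (g (censor_ex (complete_ex (beta true) sigma z) (ms_mask c))
        * (ms_w true c z.1)%:E) =
     \int[gauss_row d]_z (g (censor_ex (complete_ex (beta false) sigma z) (ms_mask c))
        * (ms_w false c z.1)%:E))%E;
  ms_coord : forall j : 'I_d,
    (\sum_(c | tnth (ms_mask c).1 j) \int[tpow (@gauss RR) d]_x (ms_w true c x)%:E <= p%:E)%E;
  ms_label :
    (\sum_(c | (ms_mask c).2) \int[tpow (@gauss RR) d]_x (ms_w true c x)%:E <= p%:E)%E }.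

Section visible.
Variables (d : nat) (sigma : RR).
Implicit Types (beta : d.-tuple RR) (M : Defs.mask d).

Lemma measurable_complete_ex beta :
  measurable_fun [set: (d.-tuple RR * RR)%type] (complete_ex beta sigma).
Proof.
apply: measurable_fun_pair; first exact: measurable_fst.
apply: measurable_funD.
  by apply: (measurableT_comp (measurable_lin (fun j => tnth beta j)) measurable_fst).
by apply: measurable_funM => //; exact: measurable_snd.
Qed.

Lemma measurable_censor_ex M :
  measurable_fun [set: example d] (fun e : example d => censor_ex e M).
Proof.
apply: measurable_fun_pair; last first.
  apply: measurable_fun_pair; last exact: measurable_cst.
  by case: (M.2); [exact: measurable_cst|exact: measurable_snd].
apply: measurable_fun_pair; last exact: measurable_cst.
apply/measurable_fun_tnthP => j.
rewrite (_ : _ \o _ = fun e : example d => if tnth M.1 j then 0 else tnth e.1 j); last first.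
  by apply/funext => e /=; rewrite tnth_mktuple.
case: (tnth M.1 j); first exact: measurable_cst.
exact: (@measurable_fun_tnthP _ _ _ _ _ fst).1.
Qed.

Lemma censor_ex_ext M (e e' : example d) : e.2 = e'.2 ->
  (forall j, ~~ tnth M.1 j -> tnth e.1 j = tnth e'.1 j) -> censor_ex e M = censor_ex e' M.
Proof.
move=> e2 e1; rewrite /censor_ex e2; congr (_, _, _).
apply: eq_from_tnth => j; rewrite !tnth_mktuple.
by case: ifPn => // /e1.
Qed.

Lemma integral_gauss_row (f : d.-tuple RR * RR -> \bar RR) :
  measurable_fun [set: (d.-tuple RR * RR)%type] f -> (forall z, 0 <= f z)%E ->
  (\int[gauss_row d]_z f z = \int[tpow (@gauss RR) d]_x \int[@gauss RR]_z f (x, z))%E.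
Proof. by move=> mf f0; rewrite fubini_tonelli1. Qed.
End visible.

Section two_group_vector.
Variables (d m : nat) (e1 e2 : 'I_m -> 'I_d).
Hypotheses (e1I : injective e1) (e2I : injective e2) (e12 : forall i j, e1 i != e2 j).

(** Constant [u] on the first group, [v] on the second, 0 elsewhere; the sum form turns inner
    products into group sums directly. *)
Definition gvec (u v : RR) : d.-tuple RR :=
  [tuple \sum_(i < m) (u * (e1 i == j)%:R + v * (e2 i == j)%:R) | j < d].

Lemma sum_gvec u v (x : d.-tuple RR) :
  \sum_(j < d) tnth (gvec u v) j * tnth x j = u * gsum e1 x + v * gsum e2 x.
Proof.
under eq_bigr do rewrite tnth_mktuple mulr_suml.
rewrite exchange_big/= !mulr_sumr -big_split/=; apply: eq_bigr => i _.
under eq_bigr do rewrite mulrDl.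
rewrite big_split/=; congr (_ + _).
  rewrite (bigD1 (e1 i))//= eqxx mulr1 big1 ?addr0// => j /negPf ji.
  by rewrite eq_sym ji mulr0 mul0r.
rewrite (bigD1 (e2 i))//= eqxx mulr1 big1 ?addr0// => j /negPf ji.
by rewrite eq_sym ji mulr0 mul0r.
Qed.

Lemma gvecB u v u' v' (j : 'I_d) :
  tnth (gvec u v) j - tnth (gvec u' v') j = tnth (gvec (u - u') (v - v')) j.
Proof. by rewrite !tnth_mktuple -sumrB; apply: eq_bigr => i _; ring. Qed.

Lemma sum_gvec_sqr u v : \sum_(j < d) tnth (gvec u v) j ^+ 2 = m%:R * (u ^+ 2 + v ^+ 2).
Proof.
under eq_bigr do rewrite expr2.
rewrite sum_gvec.
have E1 : gsum e1 (gvec u v) = m%:R * u.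
  rewrite /gsum mulr_natl -[m in RHS]card_ord -sumr_const; apply: eq_bigr => i _.
  rewrite tnth_mktuple (bigD1 i)//= eqxx mulr1 big1 ?addr0 => [|i' ii']; last first.
    by rewrite (inj_eq e1I) (negPf ii') eq_sym (negPf (e12 _ _)) !mulr0 addr0.
  by rewrite eq_sym (negPf (e12 _ _)) mulr0 addr0.
have E2 : gsum e2 (gvec u v) = m%:R * v.
  rewrite /gsum mulr_natl -[m in RHS]card_ord -sumr_const; apply: eq_bigr => i _.
  rewrite tnth_mktuple (bigD1 i)//= eqxx mulr1 big1 ?addr0 => [|i' ii']; last first.
    by rewrite (inj_eq e2I) (negPf ii') (negPf (e12 _ _)) !mulr0 addr0.
  by rewrite (negPf (e12 _ _)) mulr0 add0r.
by rewrite E1 E2; ring.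
Qed.
End two_group_vector.

(** * The mask scheme given by paths of rotations *)

Section rotation_scheme.
Variables (d m N : nat) (e1 e2 : 'I_m -> 'I_d).
Hypotheses (e1I : injective e1) (e2I : injective e2) (e12 : forall i j, e1 i != e2 j).
Hypothesis m0 : (0 < m)%N.
Variables (delta tt : RR).
Local Notation cs := (trigo.cos delta).
Local Notation sn := (trigo.sin delta).
Hypotheses (tt1 : tt * (1 + cs) = sn) (tt2 : tt * sn = 1 - cs).
Local Notation X := (d.-tuple RR).
Local Notation pi_d := (tpow (@gauss RR) d).
Local Notation I := ('I_m * 'I_m)%type.
Local Notation Psi := (rot e1 e2 tt sn).
Local Notation Phi := (rot e1 e2 (- tt) (- sn)).
Local Notation rho := (rot_density e1 e2 sn tt).
Local Notation fwd := (@path_fwd RR _ X I Psi rho N).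
Local Notation bwd := (@path_bwd RR _ X I Phi rho N).
Local Notation pmap p := (@path_map _ X I Psi _ p).

Let mPsi a : measurable_fun [set: X] (Psi a).
Proof. exact: gchange_mPsi (gchange_rot e12 tt sn a). Qed.
Let mPhi a : measurable_fun [set: X] (Phi a).
Proof. exact: gchange_mPhi (gchange_rot e12 tt sn a). Qed.
Let PsiK a : cancel (Psi a) (Phi a).
Proof. exact: gchangeK (gchange_rot e12 tt sn a). Qed.
Let mrho a : measurable_fun [set: X] (rho a).
Proof. exact: measurable_rot_density. Qed.
Let rho0 a x : 0 <= rho a x. Proof. exact: expR_ge0. Qed.
Let rhoE a (f : X -> \bar RR) : measurable_fun [set: X] f -> (forall x, 0 <= f x)%E ->
  (\int[pi_d]_x f (Psi a x) = \int[pi_d]_x (f x * (rho a x)%:E))%E.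
Proof. exact: gchangeE (gchange_rot e12 tt sn a) _. Qed.
Let I0 : (0 < #|{: I}|)%N. Proof. by rewrite card_prod card_ord muln_gt0 m0. Qed.

Definition coord_pairs (l : 'I_d) : {pred I} := [pred a | (e1 a.1 == l) || (e2 a.2 == l)].

(** At most [m] of the [m ^ 2] pairs move a given coordinate: this is the erasure rate [1 / m]. *)
Lemma card_coord_pairs l : (#|coord_pairs l| <= m)%N.
Proof.
have [[i e1i]|ne1] := pselect (exists i, e1 i = l).
  rewrite (eq_card (B := [predX pred1 i & predT])); last first.
    move=> [a b]; rewrite !inE/= -e1i (inj_eq e1I) andbT.
    by rewrite [e2 b == _]eq_sym (negPf (e12 _ _)) orbF.
  by rewrite cardX card1 mul1n card_ord.
have [[i e2i]|ne2] := pselect (exists i, e2 i = l).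
  rewrite (eq_card (B := [predX predT & pred1 i])); last first.
    by move=> [a b]; rewrite !inE/= -e2i (inj_eq e2I) (negPf (e12 _ _)).
  by rewrite cardX card1 muln1 card_ord.
rewrite eq_card0// => -[a b]; rewrite !inE/=.
by apply/negbTE; rewrite negb_or; apply/andP; split; apply/eqP => h;
  [apply: ne1; exists a|apply: ne2; exists b].
Qed.

Lemma path_map_untouched k (p : path_type I k) x l :
  ~~ path_touch (coord_pairs l) p -> tnth (pmap p x) l = tnth x l.
Proof.
elim: k p => [//|k IH] p /=; rewrite negb_or => /andP[pl _].
have lastl : path_last p.1 \notin coord_pairs l.
  move: pl; case: (k) (p.1) => [//|k' p'] /=; by rewrite negb_or => /andP[].
move: lastl; rewrite inE negb_or => /andP[l1 l2].
by rewrite (tnth_rot e1I e2I e12 tt1 tt2) ?IH// eq_sym.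
Qed.

(** Each move lowers the angle by [delta] and rotates the group sums to match, so the noiseless
    label is unchanged along the path. *)
Lemma path_map_angle k (p : path_type I k) x w :
  trigo.cos (w + k%:R * delta) * gsum e1 x + trigo.sin (w + k%:R * delta) * gsum e2 x =
  trigo.cos w * gsum e1 (pmap p x) + trigo.sin w * gsum e2 (pmap p x).
Proof.
elim: k p w => [|k IH] p w; first by rewrite mul0r addr0.
rewrite -natr1 mulrDl mul1r [_ * delta + delta]addrC addrA (IH p.1) trigo.cosD trigo.sinD /=.
rewrite (gsum1_rot e1I e2I e12 tt1 tt2) (gsum2_rot e1I e2I e12 tt1 tt2).
by set g1 := gsum e1 _; set g2 := gsum e2 _; ring.
Qed.

Let mfwd p : measurable_fun [set: X] (fwd p).
Proof. exact: measurable_path_fwd. Qed.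
Let mbwd p : measurable_fun [set: X] (bwd p).
Proof. exact: measurable_path_bwd. Qed.

Let fwd_bwd p : (\int[pi_d]_x (fwd p x)%:E = \int[pi_d]_x (bwd p x)%:E)%E.
Proof.
have := path_change mPsi mPhi PsiK mrho rho0 rhoE p (measurable_cst (1%E : \bar RR)) (fun _ => lee01).
under eq_integral do rewrite mul1e.
by under [X in _ = X -> _]eq_integral do rewrite mul1e.
Qed.

Let sum_fwd_bwd (P : pred (path_type I N)) :
  (\int[pi_d]_x (\sum_(p | P p) fwd p x)%:E = \int[pi_d]_x (\sum_(p | P p) bwd p x)%:E)%E.
Proof.
rewrite !ge0_integral_sumr//; first by apply: eq_bigr => p _; exact: fwd_bwd.
- by move=> p x; exact: path_bwd_ge0.
- by move=> p x; exact: path_fwd_ge0.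
Qed.

(* [loss] bounds the mass lost in one move, [tv] (for any [eps], to be optimized)
   the deviation of the density of a single move from [1]. *)
Local Notation loss := (32 * m%:R * (1 - cs) : RR).
Let lossP : (\int[pi_d]_x (Num.max (\sum_a (1 - rho a x)) 0)%:E <=
  (#|{: I}|%:R * loss)%:E)%E.
Proof.
have gm (e : 'I_m -> 'I_d) : measurable_fun [set: X] (fun x => (gsum e x ^+ 2)%:E).
  by apply/measurable_EFinP; apply: measurable_funX; exact: measurable_gsum.
have c0 : 0 <= m%:R ^+ 2 * (1 - cs) by rewrite mulr_ge0 ?sqr_ge0// subr_ge0 trigo.cos_le1.
apply: (@le_trans _ _ (\int[pi_d]_x ((m%:R ^+ 2 * (1 - cs))%:E *
    ((gsum e1 x ^+ 2)%:E + (gsum e2 x ^+ 2)%:E)))%E).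
  apply: ge0_le_integral => //.
  - by move=> x _; rewrite lee_fin le_max lexx orbT.
  - apply/measurable_EFinP; apply: measurable_maxr => //; apply: measurable_sum => a.
    exact: measurable_funB.
  - by apply: emeasurable_funM => //; exact: emeasurable_funD.
  move=> x _; rewrite -EFinD -EFinM lee_fin.
  exact: (sum_rot_density_le e1I e2I e12 tt1 tt2 (trigo.cos_le1 _)).
have g0 (e : 'I_m -> 'I_d) (x : X) : (0 <= (gsum e x ^+ 2)%:E)%E by rewrite lee_fin sqr_ge0.
rewrite ge0_integralZl//; last 2 first.
- exact: emeasurable_funD.
- by move=> x _; rewrite adde_ge0.
rewrite ge0_integralD//.
apply: (@le_trans _ _ ((m%:R ^+ 2 * (1 - cs))%:E * ((16 * m%:R)%:E + (16 * m%:R)%:E))%E).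
  by rewrite lee_wpmul2l ?lee_fin// leeD ?integral_gsum_sqr_le.
rewrite -EFinD -EFinM lee_fin card_prod card_ord natrM.
by rewrite le_eqVlt; apply/orP; left; apply/eqP; ring.
Qed.

Variable eps : RR.
Hypothesis eps0 : 0 < eps.
Local Notation tv := (16 * eps + (eps^-1 + 1) * ((1 - cs) * (32 * m%:R)) : RR).
Let tv0 : 0 <= tv.
Proof.
have c0 : 0 <= 1 - cs by rewrite subr_ge0 trigo.cos_le1.
have ei0 : 0 <= eps^-1 + 1 by rewrite addr_ge0// invr_ge0 ltW.
apply: addr_ge0; first by rewrite mulr_ge0// ltW.
by apply: mulr_ge0 => //; apply: mulr_ge0 => //; exact: mulr_ge0.
Qed.

Let tvP (a : I) : (\int[pi_d]_x (Num.max (1 - rho a x) 0)%:E <= tv%:E)%E.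
Proof.
have gm (e : 'I_m -> 'I_d) : measurable_fun [set: X] (fun x => (gsum e x ^+ 2)%:E).
  by apply/measurable_EFinP; apply: measurable_funX; exact: measurable_gsum.
have tm (l : 'I_d) : measurable_fun [set: X] (fun x : X => (tnth x l ^+ 2)%:E).
  by apply/measurable_EFinP; apply: measurable_funX; exact: measurable_tnthR.
have g0 (e : 'I_m -> 'I_d) (x : X) : (0 <= (gsum e x ^+ 2)%:E)%E by rewrite lee_fin sqr_ge0.
have t0 (l : 'I_d) (x : X) : (0 <= (tnth x l ^+ 2)%:E)%E by rewrite lee_fin sqr_ge0.
have c0 : 0 <= (eps^-1 + 1) * (1 - cs).
  by rewrite mulr_ge0// ?subr_ge0 ?trigo.cos_le1// addr_ge0// invr_ge0 ltW.
have e20 : 0 <= eps / 2 by rewrite divr_ge0// ltW.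
apply: (@le_trans _ _ (\int[pi_d]_x (
   (eps / 2)%:E * ((tnth x (e1 a.1) ^+ 2)%:E + (tnth x (e2 a.2) ^+ 2)%:E) +
   ((eps^-1 + 1) * (1 - cs))%:E * ((gsum e1 x ^+ 2)%:E + (gsum e2 x ^+ 2)%:E)))%E).
  apply: ge0_le_integral => //.
  - by move=> x _; rewrite lee_fin le_max lexx orbT.
  - by apply/measurable_EFinP; apply: measurable_maxr => //; exact: measurable_funB.
  - by apply: emeasurable_funD; apply: emeasurable_funM => //; exact: emeasurable_funD.
  move=> x _; rewrite -!EFinD -?EFinM -?EFinD lee_fin -[X in _ <= _ + X]mulrA.
  exact: (rot_density_max_le e1I e2I e12 tt1 tt2).
rewrite ge0_integralD//; first last.
- by apply: emeasurable_funM => //; exact: emeasurable_funD.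
- by move=> x _; rewrite mule_ge0// adde_ge0.
- by apply: emeasurable_funM => //; exact: emeasurable_funD.
- by move=> x _; rewrite mule_ge0// adde_ge0.
rewrite !ge0_integralZl//; last 4 first.
- exact: emeasurable_funD.
- by move=> x _; rewrite adde_ge0.
- exact: emeasurable_funD.
- by move=> x _; rewrite adde_ge0.
rewrite !ge0_integralD//.
apply: (@le_trans _ _ ((eps / 2)%:E * (16%:E + 16%:E) +
  ((eps^-1 + 1) * (1 - cs))%:E * ((16 * m%:R)%:E + (16 * m%:R)%:E))%E).
  apply: leeD; rewrite lee_wpmul2l ?lee_fin// leeD ?integral_gsum_sqr_le//;
    exact: integral_tnth_sqr_le.
rewrite -!EFinD -?EFinM -?EFinD lee_fin.
by rewrite le_eqVlt; apply/orP; left; apply/eqP; field; rewrite gt_eqF.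
Qed.

Let tauP l : (\int[pi_d]_x (\sum_(k in coord_pairs l) Num.max (1 - rho k x) 0)%:E <=
  (#|{: I}|%:R * (m%:R^-1 * tv))%:E)%E.
Proof.
rewrite ge0_integral_sumr; first last.
- by move=> k x; rewrite le_max lexx orbT.
- by move=> k; apply: measurable_maxr => //; exact: measurable_funB.
apply: (@le_trans _ _ (\sum_(k in coord_pairs l) tv%:E)%E).
  by apply: lee_sum => k _; exact: tvP.
rewrite sumEFin lee_fin sumr_const -[tv *+ _]mulr_natl card_prod card_ord natrM.
rewrite -mulrA mulVKf ?pnatr_eq0 -?lt0n// ler_wpM2r// ler_nat.
exact: card_coord_pairs.
Qed.

Lemma touch_fwd_le l :
  (\int[pi_d]_x (\sum_(p | path_touch (coord_pairs l) p) fwd p x)%:E <=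
   (m%:R^-1 + N%:R * (m%:R^-1 * tv))%:E)%E.
Proof.
rewrite sum_fwd_bwd; apply: le_trans (path_touch_le mPhi PsiK mrho rho0 rhoE I0 (tauP l) N) _.
rewrite lee_fin lerD2r card_prod card_ord natrM invfM mulrA ler_piMl ?invr_ge0//.
by rewrite ler_pdivrMr ?ltr0n// mul1r ler_nat card_coord_pairs.
Qed.

(** Forward and backward masses have equal integrals, so the bound proved for [path_bwd] applies to
    [path_fwd]. *)
Lemma residual_fwd_le :
  (\int[pi_d]_x (1 - \sum_p fwd p x)%:E <= (N%:R * loss)%:E)%E.
Proof.
have s1 x : \sum_p fwd p x <= 1 by exact: sum_path_fwd_le1.
have s0 x : 0 <= \sum_p fwd p x by apply: sumr_ge0 => p _; exact: path_fwd_ge0.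
have ms : measurable_fun [set: X] (fun x => \sum_p fwd p x) by exact: measurable_sum_cond.
have fin : (\int[pi_d]_x (\sum_p fwd p x)%:E)%E \is a fin_num.
  rewrite ge0_fin_numE; last by apply: integral_ge0 => x _; rewrite lee_fin.
  apply: (@le_lt_trans _ _ (\int[pi_d]_x 1)%E); last by rewrite integral_prob_cst ltry.
  by apply: ge0_le_integral => //; first [exact/measurable_EFinP|by move=> x _; rewrite lee_fin].
rewrite -(leeD2lE _ _ fin).
have := path_mass_ge mPhi PsiK mrho rho0 rhoE I0 lossP N.
rewrite -sum_fwd_bwd; apply: le_trans.
rewrite -ge0_integralD//; first last.
- by apply/measurable_EFinP; exact: measurable_funB.
- by move=> x _; rewrite lee_fin subr_ge0.
- exact/measurable_EFinP.
- by move=> x _; rewrite lee_fin.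
rewrite (eq_integral (cst 1%E)) ?integral_prob_cst// => x _.
by rewrite -EFinD addrC subrK.
Qed.

Variables (sigma p lambda r : RR).
Hypothesis lambda01 : 0 <= lambda <= 1.
Hypothesis p_coord :
  (1 - lambda) * (m%:R^-1 + N%:R * (m%:R^-1 * tv)) + N%:R * loss <= p.
Hypothesis p_label : lambda + N%:R * loss <= p.

(** With angle [N * delta] the data are the start of a path, drawn forwards; with angle 0 they are
    its end, and the path is drawn backwards. *)
Let wgt (s : bool) : path_type I N -> X -> RR := if s then fwd else bwd.
Let mw s q : measurable_fun [set: X] (wgt s q).
Proof. by case: s; [exact: mfwd|exact: mbwd]. Qed.
Let w0 s q x : 0 <= wgt s q x.
Proof. by case: s; [exact: path_fwd_ge0|exact: path_bwd_ge0]. Qed.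
Let sw1 s x : \sum_q wgt s q x <= 1.
Proof. by case: s; [exact: sum_path_fwd_le1|exact: sum_path_bwd_le1]. Qed.

(* [inl true] erases only the label, [inl false] erases everything (it absorbs the
   mass lost by the paths), [inr q] erases the coordinates touched by [q]. *)
Definition rot_choice : finType := (bool + path_type I N)%type.

Definition rot_mask (c : rot_choice) : Defs.mask d :=
  match c with
  | inl b => ([tuple ~~ b | j < d], true)
  | inr q => ([tuple path_touch (coord_pairs j) q | j < d], false)
  end.

Definition rot_weight (s : bool) (c : rot_choice) (x : X) : RR :=
  match c with
  | inl true => lambda
  | inl false => (1 - lambda) * (1 - \sum_q wgt s q x)
  | inr q => (1 - lambda) * wgt s q x
  end.

Definition rot_beta (s : bool) : X :=
  gvec e1 e2 (r * trigo.cos (if s then N%:R * delta else 0))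
             (r * trigo.sin (if s then N%:R * delta else 0)).

Let l0 : 0 <= lambda. Proof. by case/andP: lambda01. Qed.
Let l1 : 0 <= 1 - lambda. Proof. by rewrite subr_ge0; case/andP: lambda01. Qed.

Lemma measurable_rot_weight s c : measurable_fun [set: X] (rot_weight s c).
Proof.
case: c => [[]|q]; first exact: measurable_cst.
  apply: measurable_funM => //; apply: measurable_funB => //.
  exact: measurable_sum_cond.
exact: measurable_funM.
Qed.

Lemma rot_weight_ge0 s c x : 0 <= rot_weight s c x.
Proof. by case: c => [[]|q] //=; rewrite mulr_ge0// subr_ge0. Qed.

Lemma sum_rot_weight s x : \sum_c rot_weight s c x = 1.
Proof. by rewrite big_sumType big_bool/= -mulr_sumr; ring. Qed.

Lemma sum_rot_beta s x :
  \sum_(j < d) tnth (rot_beta s) j * tnth x j =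
  r * (trigo.cos (if s then N%:R * delta else 0) * gsum e1 x +
       trigo.sin (if s then N%:R * delta else 0) * gsum e2 x).
Proof. by rewrite sum_gvec; ring. Qed.

Lemma rot_visible q x z :
  censor_ex (complete_ex (rot_beta true) sigma (x, z)) (rot_mask (inr q)) =
  censor_ex (complete_ex (rot_beta false) sigma (pmap q x, z)) (rot_mask (inr q)).
Proof.
apply: censor_ex_ext => /= [|j].
  rewrite !sum_rot_beta; congr (r * _ + _).
  by rewrite -(path_map_angle q x 0) add0r.
by rewrite tnth_mktuple => qj; rewrite path_map_untouched.
Qed.

Let mrow (g : iexample d -> \bar RR) s c : measurable_fun [set: iexample d] g ->
  measurable_fun [set: (X * RR)%type]
    (fun z => g (censor_ex (complete_ex (rot_beta s) sigma z) (rot_mask c))).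
Proof.
move=> mg; apply: measurableT_comp => //.
exact: (measurableT_comp (measurable_censor_ex _) (measurable_complete_ex _ _)).
Qed.

Lemma rot_scheme_vis c (g : iexample d -> \bar RR) : measurable_fun [set: iexample d] g ->
  (forall v, 0 <= g v)%E ->
  (\int[gauss_row d]_z (g (censor_ex (complete_ex (rot_beta true) sigma z) (rot_mask c))
      * (rot_weight true c z.1)%:E) =
   \int[gauss_row d]_z (g (censor_ex (complete_ex (rot_beta false) sigma z) (rot_mask c))
      * (rot_weight false c z.1)%:E))%E.
Proof.
move=> mg g0.
have mG s : measurable_fun [set: (X * RR)%type]
    (fun z => (g (censor_ex (complete_ex (rot_beta s) sigma z) (rot_mask c)) *
      (rot_weight s c z.1)%:E)%E).
  apply: emeasurable_funM; first exact: mrow.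
  apply/measurable_EFinP; apply: (measurableT_comp (measurable_rot_weight s c)).
  exact: measurable_fst.
have G0 s z : (0 <= g (censor_ex (complete_ex (rot_beta s) sigma z) (rot_mask c)) *
      (rot_weight s c z.1)%:E)%E.
  by rewrite mule_ge0// lee_fin rot_weight_ge0.
case: c mG G0 => [[]|q] mG G0.
(* Only the covariates are visible, and neither they nor the weight [lambda] depend on the
   regressor. *)
- by apply: eq_integral => z _ /=; congr (g _ * _)%E.
(* Nothing is visible, so only the total weight of this choice matters; it agrees on both sides by
   [sum_fwd_bwd]. *)
- pose g00 := g (censor_ex (complete_ex (rot_beta true) sigma ([tuple 0 | j < d], 0))
    (rot_mask (inl false))).
  have gE s z : g (censor_ex (complete_ex (rot_beta s) sigma z) (rot_mask (inl false))) = g00.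
    rewrite /g00 /censor_ex/=; congr (g (_, _, _)).
    by apply: eq_from_tnth => j; rewrite !tnth_mktuple.
  have E s : (\int[gauss_row d]_z
      (g (censor_ex (complete_ex (rot_beta s) sigma z) (rot_mask (inl false))) *
       (rot_weight s (inl false) z.1)%:E) =
      g00 * ((1 - lambda)%:E * \int[pi_d]_x (1 - \sum_q wgt s q x)%:E))%E.
    have mr : measurable_fun [set: X] (fun x => (1 - \sum_q wgt s q x)%:E).
      by apply/measurable_EFinP/measurable_funB => //; exact: measurable_sum_cond.
    have r0 x : (0 <= (1 - \sum_q wgt s q x)%:E)%E by rewrite lee_fin subr_ge0.
    rewrite (integral_gauss_row (mG s) (G0 s)) -ge0_integralZl//.
    rewrite -ge0_integralZl//; last 3 first.
    - by apply: emeasurable_funM.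
    - by move=> x _; rewrite mule_ge0.
    - exact: g0.
    apply: eq_integral => x _ /=; under eq_integral do rewrite gE EFinM.
    by rewrite integral_prob_cst.
  rewrite (E true) (E false); congr (_ * (_ * _))%E.
  have rE s : (\int[pi_d]_x (1 - \sum_q wgt s q x)%:E =
      1 - \int[pi_d]_x (\sum_q wgt s q x)%:E)%E.
    have ms : measurable_fun [set: X] (fun x => \sum_q wgt s q x) by exact: measurable_sum_cond.
    have s0 x : 0 <= \sum_q wgt s q x by exact: sumr_ge0.
    have ->  : (1 = \int[pi_d]_x (1 - \sum_q wgt s q x)%:E +
        \int[pi_d]_x (\sum_q wgt s q x)%:E :> \bar RR)%E.
      rewrite -ge0_integralD//; first last.
      - exact/measurable_EFinP.
      - by move=> x _; rewrite lee_fin.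
      - by apply/measurable_EFinP; exact: measurable_funB.
      - by move=> x _; rewrite lee_fin subr_ge0.
      rewrite (eq_integral (cst 1%E)) ?integral_prob_cst// => x _.
      by rewrite -EFinD subrK.
    rewrite addeK// ge0_fin_numE; last by apply: integral_ge0 => x _; rewrite lee_fin.
    apply: (@le_lt_trans _ _ (\int[pi_d]_x 1)%E); last by rewrite integral_prob_cst ltry.
    by apply: ge0_le_integral => //; first [exact/measurable_EFinP|by move=> x _; rewrite lee_fin].
  by rewrite (rE true) (rE false) sum_fwd_bwd.
(* The noise is integrated out first: the move leaves it alone, so [path_change] is needed only for
   the covariates. *)
pose F s x := (\int[@gauss RR]_z
    g (censor_ex (complete_ex (rot_beta s) sigma (x, z)) (rot_mask (inr q))))%E.
have mF s : measurable_fun [set: X] (F s).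
  apply: (@measurable_fun_fubini_tonelli_F _ _ _ _ RR (@gauss RR)
    (fun xz => g (censor_ex (complete_ex (rot_beta s) sigma xz) (rot_mask (inr q))))) => //.
  exact: mrow.
have F0 s x : (0 <= F s x)%E by exact: integral_ge0.
have E s : (\int[gauss_row d]_z (g (censor_ex (complete_ex (rot_beta s) sigma z)
     (rot_mask (inr q))) * (rot_weight s (inr q) z.1)%:E) =
   (1 - lambda)%:E * \int[pi_d]_x (F s x * (wgt s q x)%:E))%E.
  rewrite (integral_gauss_row (mG s) (G0 s)) -ge0_integralZl//; first last.
  - by move=> x _; rewrite mule_ge0// lee_fin.
  - by apply: emeasurable_funM => //; exact/measurable_EFinP.
  apply: eq_integral => x _; rewrite /F.
  transitivity (\int[@gauss RR]_z (g (censor_ex (complete_ex (rot_beta s) sigma (x, z))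
    (rot_mask (inr q))) * (rot_weight s (inr q) x)%:E))%E; first by [].
  rewrite ge0_integralZr//; first by rewrite /= EFinM muleCA.
  - by apply: (measurableT_comp (mrow s _ mg)); exact: measurable_pair1.
  - by rewrite lee_fin rot_weight_ge0.
have AB : (\int[pi_d]_x (F true x * (wgt true q x)%:E) =
    \int[pi_d]_x (F false x * (wgt false q x)%:E))%E.
  rewrite -(path_change mPsi mPhi PsiK mrho rho0 rhoE q (mF false) (F0 false)).
  apply: eq_integral => x _; congr (_ * _)%E; apply: eq_integral => z _.
  by rewrite rot_visible.
by rewrite (E true) (E false) AB.
Qed.

Let int_weight_sum (P : pred rot_choice) :
  (\sum_(c | P c) \int[pi_d]_x (rot_weight true c x)%:E =
   (if P (inl true) then lambda%:E else 0) +
   (if P (inl false) then (1 - lambda)%:E * \int[pi_d]_x (1 - \sum_q fwd q x)%:E else 0) +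
   (1 - lambda)%:E * \int[pi_d]_x (\sum_(q | P (inr q)) fwd q x)%:E)%E.
Proof.
rewrite big_mkcond big_sumType big_bool/=; congr (_ + _ + _)%E.
- by case: ifP => // _; rewrite integral_prob_cst.
- case: ifP => // _; under eq_integral do rewrite EFinM.
  rewrite ge0_integralZl//.
  + by apply/measurable_EFinP/measurable_funB => //; exact: measurable_sum_cond.
  + by move=> x _; rewrite lee_fin subr_ge0 (sw1 true).
rewrite -big_mkcond/= ge0_integral_sumr//; last by move=> q x; exact: (w0 true).
rewrite ge0_sume_distrr; last first.
  by move=> q _; apply: integral_ge0 => x _; rewrite lee_fin (w0 true).
apply: eq_bigr => q _; rewrite -ge0_integralZl//.
- exact/measurable_EFinP.
- by move=> x _; rewrite lee_fin (w0 true).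
Qed.

Let loss_res : ((1 - lambda)%:E * \int[pi_d]_x (1 - \sum_q fwd q x)%:E <= (N%:R * loss)%:E)%E.
Proof.
apply: (@le_trans _ _ (1 * \int[pi_d]_x (1 - \sum_q fwd q x)%:E)%E).
  rewrite lee_wpmul2r//; last by rewrite lee_fin gerBl.
  by apply: integral_ge0 => x _; rewrite lee_fin subr_ge0 (sw1 true).
by rewrite mul1e; exact: residual_fwd_le.
Qed.

Lemma rot_scheme_coord (j : 'I_d) :
  (\sum_(c | tnth (rot_mask c).1 j) \int[pi_d]_x (rot_weight true c x)%:E <= p%:E)%E.
Proof.
rewrite int_weight_sum /= !tnth_mktuple/= add0e.
apply: (@le_trans _ _ ((N%:R * loss)%:E +
    (1 - lambda)%:E * (m%:R^-1 + N%:R * (m%:R^-1 * tv))%:E)%E); last first.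
  by rewrite -EFinM -EFinD lee_fin addrC.
apply: leeD => //; rewrite lee_wpmul2l ?lee_fin//.
under eq_integral do under eq_bigl do rewrite tnth_mktuple.
exact: touch_fwd_le.
Qed.

Lemma rot_scheme_label :
  (\sum_(c | (rot_mask c).2) \int[pi_d]_x (rot_weight true c x)%:E <= p%:E)%E.
Proof.
rewrite int_weight_sum /=.
rewrite [X in (_ + _ * X)%E](_ : _ = 0%E) ?mule0 ?adde0; last first.
  by rewrite (eq_integral (cst 0%E)) ?integral0// => x _; rewrite big_pred0_eq.
apply: (@le_trans _ _ (lambda%:E + (N%:R * loss)%:E)%E); last by rewrite -EFinD lee_fin.
by rewrite leeD2l.
Qed.

Definition rot_scheme : mask_scheme sigma p rot_beta :=
  MaskScheme measurable_rot_weight rot_weight_ge0 sum_rot_weight rot_scheme_vis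
    rot_scheme_coord rot_scheme_label.
End rotation_scheme.

(** * The law of the model *)

Section generating.

(** A pi-system of measurable sets that contains the whole space and generates the sigma-algebra.
    Two probabilities agreeing on it are equal, and the notion passes to products and tuples. *)
Record generating d (T : measurableType d) (G : set (set T)) : Prop := Generating {
  gen_sub : measurable `<=` <<s G >>;
  gen_measurable : G `<=` measurable;
  gen_setI : setI_closed G;
  gen_setT : G setT }.

Lemma generating_measurable d (T : measurableType d) : generating (@measurable d T).
Proof.
by split=> // A B; exact: measurableI.
Qed.

Lemma probability_unique d (T : measurableType d) (R : realType) (G : set (set T))
  (m1 m2 : probability T R) : generating G -> (forall A, G A -> m1 A = m2 A) ->
  forall A, measurable A -> m1 A = m2 A.
Proof.
move=> [sG mG GI GT] m12 A mA.
apply: (@g_sigma_algebra_measure_unique _ _ _ G mG (fun=> setT)) => //.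
- by rewrite bigcup_const.
- by move=> k /=; rewrite probability_setT ltry.
- exact: sG.
Qed.

Lemma sigma_preimage (T1 T2 : Type) (f : T1 -> T2) (G : set (set T2)) (H : set (set T1)) :
  (forall B, G B -> <<s H >> (f @^-1` B)) -> forall B, <<s G >> B -> <<s H >> (f @^-1` B).
Proof.
move=> GH B GB; apply: (GB [set B | <<s H >> (f @^-1` B)]); split=> //; split.
- by rewrite /= preimage_set0; exact: sigma_algebra0.
- move=> C HC; rewrite /= setTD preimage_setC -setTD; exact: sigma_algebraCD.
- by move=> F HF; rewrite /= preimage_bigcup; exact: sigma_algebra_bigcup.
Qed.

Lemma generating_prod d1 d2 (T1 : measurableType d1) (T2 : measurableType d2) G1 G2 :
  generating (G1 : set (set T1)) -> generating (G2 : set (set T2)) ->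
  generating [set A `*` B | A in G1 & B in G2].
Proof.
move=> [s1 m1 I1 t1] [s2 m2 I2 t2]; split.
- apply: smallest_sub; first exact: smallest_sigma_algebra.
  move=> C [|] [A mA <-]; rewrite setTI.
    apply: (sigma_preimage _ (s1 _ mA)) => B G1B; apply: sub_sigma_algebra.
    by exists B => //; exists setT => //; rewrite setXT.
  apply: (sigma_preimage _ (s2 _ mA)) => B G2B; apply: sub_sigma_algebra.
  by exists setT => //; exists B => //; rewrite setTX.
- by move=> _ [A GA] [B GB] <-; apply: measurableX; [exact: m1|exact: m2].
- move=> _ _ [A GA] [B GB] <- [A' GA'] [B' GB'] <-; rewrite -setXI.
  by exists (A `&` A'); [exact: I1|exists (B `&` B'); [exact: I2|]].
- by exists setT => //; exists setT => //; rewrite setXTT.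
Qed.

Definition box n (T : Type) (A : 'I_n -> set T) : set (n.-tuple T) :=
  [set t | forall i, A i (tnth t i)].

Lemma generating_tuple d (T : measurableType d) (G : set (set T)) n : generating G ->
  generating [set C | exists2 A : 'I_n -> set T, (forall i, G (A i)) & C = box A].
Proof.
move=> [sG mG GI GT]; split.
- apply: smallest_sub; first exact: smallest_sigma_algebra.
  move=> C; case: n C => [|n] C; first by rewrite big_ord0.
  rewrite -bigcup_mkord_ord => -[i _ [A mA <-]]; rewrite setTI.
  apply: (sigma_preimage _ (sG _ mA)) => B GB; apply: sub_sigma_algebra.
  exists (fun j => if j == inord i then B else setT) => [j|]; first by case: ifP.
  apply/seteqP; split=> [t Bt j|t /(_ (inord i))]; last by rewrite eqxx.
  by case: eqP => // ->.
- move=> _ [A GA ->].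
  rewrite (_ : box A = \bigcap_(i in setT) ((fun t => tnth t i) @^-1` A i)); last first.
    by apply/seteqP; split=> t At i; [move=> _; exact: At|exact: At i I].
  apply: fin_bigcap_measurable => // i _.
  by rewrite -[X in measurable X]setTI; apply: measurable_tnth => //; exact: mG.
- move=> _ _ [A GA ->] [B GB ->]; exists (fun i => A i `&` B i) => [i|]; first exact: GI.
  by apply/seteqP; split=> [t [At Bt] i|t ABt]; [split|split=> i; have [] := ABt i].
- exists (fun=> setT) => //; by apply/seteqP; split.
Qed.

Lemma tpow_box d (T : measurableType d) (R : realType) (P : probability T R) n
  (A : 'I_n -> set T) : (forall i, measurable (A i)) ->
  (tpow P n (box A) = \prod_(i < n) P (A i))%E.
Proof.
elim: n A => [|n IH] A mA.
  rewrite big_ord0 /= diracE mem_set// => -[]//.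
rewrite big_ord_recl -IH//= -product_measure1E//; last first.
  by apply: (gen_measurable (generating_tuple n (generating_measurable T))); exists (fun i => A (lift ord0 i)).
rewrite /distribution /pushforward; congr (_ _).
apply/seteqP; split=> [[x t] /= At|[x t] /= [Ax At] i].
  split=> /=; first by have := At ord0; rewrite /tcons tnth0.
  by move=> i; have := At (lift ord0 i); rewrite /tcons tnthS.
by have [j|] := unliftP ord0 i => ->; rewrite /tcons ?tnth0 ?tnthS.
Qed.
End generating.

Section model_law.
Context (n d : nat) (dO : measure_display) (Omega : measurableType dO)
  (P : probability Omega RR) (dU : measure_display) (TU : measurableType dU).
Variables (G : 'I_n -> 'I_d -> Omega -> RR) (Z : 'I_n -> Omega -> RR)
  (V : Omega -> RR) (U : Omega -> TU).
Hypothesis setup : model_setup P G Z V U.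

Definition raw_rows (w : Omega) : n.-tuple (d.-tuple RR * RR) :=
  [tuple ([tuple G i j w | j < d], Z i w) | i < n].

Lemma measurable_raw_rows : measurable_fun setT raw_rows.
Proof.
have [mG [mZ _]] := setup.
apply/measurable_fun_tnthP => i.
rewrite (_ : _ \o _ = fun w => ([tuple G i j w | j < d], Z i w)); last first.
  by apply/funext => w /=; rewrite tnth_mktuple.
apply: measurable_fun_pair => //; apply/measurable_fun_tnthP => j.
rewrite (_ : _ \o _ = G i j)//.
by apply/funext => w /=; rewrite tnth_mktuple.
Qed.

(** [model_setup] gives the probabilities of rectangles only. These form a generating pi-system, so
    the joint law is the product law. *)
Lemma model_law (PU : probability TU RR) : (forall E, measurable E -> PU E = P (U @^-1` E)) ->
  forall A, measurable A ->
  P [set w | A (raw_rows w, V w, U w)] = ((tpow (gauss_row d) n \x @unif RR) \x PU)%E A.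
Proof.
move=> PUE; have [mG [mZ [mV [mU law]]]] := setup.
pose Y w := (raw_rows w, V w, U w).
have mY : measurable_fun setT Y.
  by apply: measurable_fun_pair => //; apply: measurable_fun_pair => //; exact: measurable_raw_rows.
pose Y' : {RV P >-> _} := HB.pack Y (isMeasurableFun.Build _ _ _ _ Y mY).
have g0 := generating_measurable RR.
have gen := generating_prod (generating_prod (generating_tuple n
  (generating_prod (generating_tuple d g0) g0)) g0) (generating_measurable TU).
move=> A mA; rewrite -[LHS]/(distribution P Y' A).
apply: (probability_unique gen _ mA) => {A mA} _ [_ [_ [R gR ->] [D mD <-]]] [E mE <-].
have {gR} [AB ABP] : {AB : 'I_n -> ('I_d -> set RR) * set RR &
    forall i, [/\ forall j, measurable ((AB i).1 j), measurable (AB i).2 &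
      R i = box (AB i).1 `*` (AB i).2]}.
  apply: (@choice _ _ (fun i AB => [/\ forall j, measurable (AB.1 j), measurable AB.2 &
      R i = box AB.1 `*` AB.2])) => i.
  by have [_ [A mA ->] [B mB <-]] := gR i; exists (A, B).
have mbox i : measurable (box (AB i).1).
  apply: (gen_measurable (generating_tuple d g0)); exists (AB i).1 => // j.
  by have [] := ABP i.
rewrite [RHS]product_measure1E//; last first.
  apply: measurableX => //.
  apply: (gen_measurable (generating_tuple n (generating_measurable _))).
  by exists R => // i; have [_ mB ->] := ABP i; exact: measurableX.
rewrite [X in (X * _)%E]product_measure1E//; last first.
  apply: (gen_measurable (generating_tuple n (generating_measurable _))).
  by exists R => // i; have [_ mB ->] := ABP i; exact: measurableX.
have := law (fun i j => (AB i).1 j) (fun i => (AB i).2) D E.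
move=> /(_ (fun i j => let: And3 h _ _ := ABP i in h j) (fun i => let: And3 _ h _ := ABP i in h) mD mE) lawE.
transitivity (P [set w | (forall i j, (AB i).1 j (G i j w)) /\
    (forall i, (AB i).2 (Z i w)) /\ D (V w) /\ E (U w)]).
  rewrite /distribution /pushforward; congr (P _).
  apply/seteqP; split=> [w /= [[Rw Dw] Ew]|w /= [Aw [Bw [Dw Ew]]]].
    split; last split=> //.
      move=> i j; have := Rw i; have [_ _ ->] := ABP i.
      by rewrite tnth_mktuple/= => -[/(_ j)]; rewrite tnth_mktuple.
    by move=> i; have := Rw i; have [_ _ ->] := ABP i; rewrite tnth_mktuple/= => -[].
  split=> //=; split=> //= i; have [_ _ ->] := ABP i; rewrite tnth_mktuple/=.
  by split=> //= j; rewrite tnth_mktuple.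
have tb : (tpow (gauss_row d) n (box R) = \prod_(i < n) gauss_row d (R i))%E.
  by apply: tpow_box => i; have [_ mB ->] := ABP i; exact: measurableX.
rewrite lawE; apply/esym; congr (_ * _ * _)%E; last exact: PUE.
rewrite -big_split/=; apply: etrans; first exact: tb.
apply: eq_bigr => i _; have [mA mB ->] := ABP i.
apply: etrans; first exact: product_measure1E.
congr (_ * _)%E; exact: tpow_box.
Qed.
End model_law.

(** * Samples of size n *)

Section tpow_products.
Context {R : realType} d (T : measurableType d) (mu : probability T R).

Lemma measurable_tpow_prod n (f : 'I_n -> T -> R) : (forall i, measurable_fun [set: T] (f i)) ->
  measurable_fun [set: n.-tuple T] (fun t => \prod_(i < n) f i (tnth t i)).
Proof.
move=> mf; apply: measurable_prod => i _.
by apply: (measurableT_comp (mf i)); exact: measurable_tnth.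
Qed.

Lemma integral_tpow_prod n (f : 'I_n -> T -> R) : (forall i, measurable_fun [set: T] (f i)) ->
  (forall i x, 0 <= f i x) ->
  (\int[tpow mu n]_t (\prod_(i < n) f i (tnth t i))%:E = \prod_(i < n) \int[mu]_x (f i x)%:E)%E.
Proof.
elim: n f => [|n IH] f mf f0.
  rewrite integral_tpow0 ?big_ord0//; apply/measurable_EFinP.
  exact: measurable_tpow_prod.
rewrite integral_tpowS; last 2 first.
- by apply/measurable_EFinP; exact: measurable_tpow_prod.
- by move=> t; rewrite lee_fin prodr_ge0.
have mP : measurable_fun [set: n.-tuple T]
    (fun t => (\prod_(i < n) f (lift ord0 i) (tnth t i))%:E).
  apply/measurable_EFinP.
  exact: (measurable_tpow_prod (f := fun i => f (lift ord0 i)) (fun i => mf _)).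
rewrite big_ord_recl -(IH (fun i => f (lift ord0 i)))//.
rewrite -ge0_integralZr//; last 3 first.
- exact/measurable_EFinP.
- by move=> x _; rewrite lee_fin.
- by apply: integral_ge0 => t _; rewrite lee_fin prodr_ge0.
apply: eq_integral => x _; rewrite -ge0_integralZl//; last 2 first.
- by move=> t _; rewrite lee_fin prodr_ge0.
- by rewrite lee_fin.
apply: eq_integral => t _; rewrite -EFinM big_ord_recl; congr (f _ _ * _)%:E.
by apply: eq_bigr => i _; rewrite tnthS.
Qed.

Section replacement.
Context (C : Type) d' (Y : measurableType d').
Variables (nu : bool -> C -> T -> Y) (om : bool -> C -> T -> R).
Hypothesis mnu : forall s c, measurable_fun [set: T] (nu s c).
Hypothesis mom : forall s c, measurable_fun [set: T] (om s c).
Hypothesis om0 : forall s c x, 0 <= om s c x.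
Hypothesis nuE : forall c (g : Y -> \bar R), measurable_fun [set: Y] g -> (forall y, 0 <= g y)%E ->
  (\int[mu]_x (g (nu true c x) * (om true c x)%:E) =
   \int[mu]_x (g (nu false c x) * (om false c x)%:E))%E.

Definition tup_map n s (k : 'I_n -> C) (t : n.-tuple T) : n.-tuple Y :=
  [tuple nu s (k i) (tnth t i) | i < n].

Lemma measurable_tup_map n s (k : 'I_n -> C) : measurable_fun [set: n.-tuple T] (tup_map s k).
Proof.
apply/measurable_fun_tnthP => i.
rewrite (_ : _ \o _ = fun t => nu s (k i) (tnth t i)); last first.
  by apply/funext => t /=; rewrite tnth_mktuple.
by apply: (measurableT_comp (mnu s (k i))); exact: measurable_tnth.
Qed.

Lemma tup_map_tcons n s (k : 'I_n.+1 -> C) x t :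
  tup_map s k (tcons (x, t)) = tcons (nu s (k ord0) x, tup_map s (fun i => k (lift ord0 i)) t).
Proof.
apply: eq_from_tnth => i; rewrite tnth_mktuple.
by have [j|] := unliftP ord0 i => ->; rewrite /tcons ?tnth0// !tnthS tnth_mktuple.
Qed.

(** A hybrid argument: the one-row identity [nuE] is applied to one row at a time, the other rows
    being frozen. *)
Lemma integral_tup_map n (k : 'I_n -> C) (h : n.-tuple Y -> \bar R) :
  measurable_fun [set: n.-tuple Y] h -> (forall y, 0 <= h y)%E ->
  (\int[tpow mu n]_t (h (tup_map true k t) * (\prod_(i < n) om true (k i) (tnth t i))%:E) =
   \int[tpow mu n]_t (h (tup_map false k t) * (\prod_(i < n) om false (k i) (tnth t i))%:E))%E.
Proof.
have mO m s (l : 'I_m -> C) : measurable_fun [set: m.-tuple T]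
    (fun t => (\prod_(i < m) om s (l i) (tnth t i))%:E).
  apply/measurable_EFinP.
  exact: (measurable_tpow_prod (f := fun i => om s (l i)) (fun i => mom _ _)).
have O0 m s (l : 'I_m -> C) t : (0 <= (\prod_(i < m) om s (l i) (tnth t i))%:E)%E.
  by rewrite lee_fin prodr_ge0.
have mF m s (l : 'I_m -> C) (g : m.-tuple Y -> \bar R) : measurable_fun [set: m.-tuple Y] g ->
    measurable_fun [set: m.-tuple T]
      (fun t => (g (tup_map s l t) * (\prod_(i < m) om s (l i) (tnth t i))%:E)%E).
  move=> mg.
  exact: (emeasurable_funM (measurableT_comp mg (measurable_tup_map s l)) (mO m s l)).
elim: n k h => [|n IH] k h mh h0.
  rewrite !integral_tpow0; [|exact: mF|exact: mF].
  by rewrite !big_ord0; congr (h _ * _)%E; apply: eq_from_tnth => -[].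
rewrite !integral_tpowS; first last.
- by move=> t; rewrite mule_ge0.
- exact: mF.
- by move=> t; rewrite mule_ge0.
- exact: mF.
pose k' i := k (lift ord0 i).
pose O s (t : n.-tuple T) := (\prod_(i < n) om s (k' i) (tnth t i))%:E.
have split_row s x t : (h (tup_map s k (tcons (x, t))) *
    (\prod_(i < n.+1) om s (k i) (tnth (tcons (x, t)) i))%:E =
   h (tcons (nu s (k ord0) x, tup_map s k' t)) * (om s (k ord0) x)%:E * O s t)%E.
  rewrite tup_map_tcons big_ord_recl EFinM muleA; congr (_ * _ * _%:E)%E.
  by apply: eq_bigr => i _; rewrite tnthS.
have mh1 y : measurable_fun [set: n.-tuple Y] (fun v => h (tcons (y, v))).
  apply: (measurableT_comp mh); apply: (measurableT_comp (@measurable_tcons _ _ n)).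
  exact: measurable_pair1.
have mh2 v : measurable_fun [set: Y] (fun y => h (tcons (y, v))).
  apply: (measurableT_comp mh); apply: (measurableT_comp (@measurable_tcons _ _ n)).
  exact: measurable_pair2.
(* The intermediate hybrid: the tail already follows [false], the head still follows [true]. *)
transitivity (\int[mu]_x \int[tpow mu n]_t
    (h (tcons (nu true (k ord0) x, tup_map false k' t)) * (om true (k ord0) x)%:E * O false t))%E.
  apply: eq_integral => x _; under eq_integral do rewrite split_row.
  apply: (IH k' (fun v => h (tcons (nu true (k ord0) x, v)) * (om true (k ord0) x)%:E)%E).
    by apply: emeasurable_funM => //; exact: measurable_cst.
  by move=> v; rewrite mule_ge0// lee_fin.
have mJ s : measurable_fun [set: (T * n.-tuple T)%type]
    (fun z => (h (tcons (nu s (k ord0) z.1, tup_map false k' z.2)) *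
       (om s (k ord0) z.1)%:E * O false z.2)%E).
  apply: emeasurable_funM; last by apply: (measurableT_comp (mO n false k')); exact: measurable_snd.
  apply: emeasurable_funM.
    apply: (measurableT_comp mh); apply: (measurableT_comp (@measurable_tcons _ _ n)).
    apply: measurable_fun_pair.
      by apply: (measurableT_comp (mnu s (k ord0))); exact: measurable_fst.
    by apply: (measurableT_comp (measurable_tup_map false k')); exact: measurable_snd.
  apply/measurable_EFinP; apply: (measurableT_comp (mom s (k ord0))); exact: measurable_fst.
have J0 s z : (0 <= h (tcons (nu s (k ord0) z.1, tup_map false k' z.2)) *
       (om s (k ord0) z.1)%:E * O false z.2)%E.
  by apply: mule_ge0; [apply: mule_ge0; [|rewrite lee_fin]|exact: (O0 n false k')].
rewrite (fubini_tonelli _ (mJ true) (J0 true)).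
under [RHS]eq_integral do under eq_integral do rewrite split_row.
rewrite (fubini_tonelli _ (mJ false) (J0 false)).
apply: eq_integral => t _.
have Or : O false t = (\prod_(i < n) om false (k' i) (tnth t i))%:E by [].
rewrite /=.
have E s : (\int[mu]_x (h (tcons (nu s (k ord0) x, tup_map false k' t)) *
    (om s (k ord0) x)%:E * O false t) =
   (\int[mu]_x (h (tcons (nu s (k ord0) x, tup_map false k' t)) * (om s (k ord0) x)%:E)) *
   O false t)%E.
  rewrite ge0_integralZr//; [|by move=> x _; rewrite mule_ge0// lee_fin|exact: O0].
  apply: emeasurable_funM; last exact/measurable_EFinP.
  exact: (measurableT_comp (mh2 _) (mnu s (k ord0))).
rewrite (E true) (E false) (nuE _ (mh2 _))//.
Qed.
End replacement.
End tpow_products.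

(** * Chernoff bounds for the erasure counts *)

Section chernoff.
Context {R : realType} d (T : measurableType d) (mu : probability T R) (Ch : finType).
Variable w : Ch -> T -> R.
Hypothesis mw : forall c, measurable_fun [set: T] (w c).
Hypothesis w0 : forall c x, 0 <= w c x.
Hypothesis w1 : forall x, \sum_c w c x = 1.
Variable n : nat.

Definition tup_weight (k : 'I_n -> Ch) (t : n.-tuple T) : R := \prod_(i < n) w (k i) (tnth t i).

Lemma tup_weight_ge0 k t : 0 <= tup_weight k t.
Proof. by rewrite prodr_ge0. Qed.

Lemma measurable_tup_weight k : measurable_fun [set: n.-tuple T] (tup_weight k).
Proof. exact: (measurable_tpow_prod (f := fun i => w (k i)) (fun i => mw _)). Qed.

Lemma sum_tup_weight t : \sum_(k : {ffun 'I_n -> Ch}) tup_weight k t = 1.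
Proof.
rewrite -(bigA_distr_bigA (fun i c => w c (tnth t i))) big1// => i _; exact: w1.
Qed.

Definition hits (J : pred Ch) (k : 'I_n -> Ch) : nat := #|[set i | J (k i)]%SET|.

Lemma chernoff_hits (J : pred Ch) (p lam a : R) : 0 <= lam ->
  (\sum_(c | J c) \int[mu]_x (w c x)%:E <= p%:E)%E ->
  (\int[tpow mu n]_t (\sum_(k : {ffun 'I_n -> Ch} | ~~ ((hits J k)%:R <= a)) tup_weight k t)%:E
   <= (expR ((expR lam - 1) * p * n%:R - lam * a))%:E)%E.
Proof.
move=> lam0 wJ.
have e1 : 1 <= expR lam by rewrite -expR0 ler_expR.
pose g x := 1 + (expR lam - 1) * \sum_(c | J c) w c x.
have g0 x : 0 <= g x.
  by rewrite addr_ge0// mulr_ge0 ?subr_ge0// sumr_ge0.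
have mg : measurable_fun [set: T] g.
  apply: measurable_funD => //; apply: measurable_funM => //; exact: measurable_sum_cond.
have gE x : g x = \sum_c w c x * (if J c then expR lam else 1).
  rewrite /g -[X in X + _](w1 x) mulr_sumr (big_mkcond J)/= -big_split/=; apply: eq_bigr => c _.
  by case: ifP => _; ring.
have intg : (\int[mu]_x (g x)%:E <= (expR ((expR lam - 1) * p))%:E)%E.
  rewrite (_ : (fun x => (g x)%:E) = fun x => (1 + (expR lam - 1)%:E * (\sum_(c | J c) w c x)%:E)%E)//.
  rewrite ge0_integralD//; first last.
  - apply: emeasurable_funM => //; apply/measurable_EFinP; exact: measurable_sum_cond.
  - by move=> x _; rewrite mule_ge0 ?lee_fin ?subr_ge0// sumr_ge0.
  rewrite integral_prob_cst ge0_integralZl//; first last.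
  - by rewrite lee_fin subr_ge0.
  - by move=> x _; rewrite lee_fin sumr_ge0.
  - apply/measurable_EFinP; exact: measurable_sum_cond.
  rewrite ge0_integral_sumr//.
  apply: (@le_trans _ _ (1 + (expR lam - 1)%:E * p%:E)%E).
    by rewrite leeD2l// lee_wpmul2l// lee_fin subr_ge0.
  by rewrite -EFinM -EFinD lee_fin expR_ge1Dx.
have bound t : \sum_(k : {ffun 'I_n -> Ch} | ~~ ((hits J k)%:R <= a)) tup_weight k t <=
    expR (- (lam * a)) * \prod_(i < n) g (tnth t i).
  (* Expanding the product over rows gives a sum over all [k] of the weight times
     [expR (lam * hits)], and this exponential is at least [expR (lam * a)] on the bad event. *)
  under [X in _ <= _ * X]eq_bigr do rewrite gE.
  rewrite bigA_distr_bigA mulr_sumr big_mkcond/=; apply: ler_sum => k _.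
  have -> : \prod_i (w (k i) (tnth t i) * (if J (k i) then expR lam else 1)) =
      tup_weight k t * expR (lam * (hits J k)%:R).
    rewrite big_split/=; congr (_ * _).
    by rewrite -big_mkcond/= prodr_const expRM_natr /hits cardsE.
  rewrite mulrCA -expRD; case: ifPn => [|_]; last first.
    by rewrite mulr_ge0 ?tup_weight_ge0 ?expR_ge0.
  rewrite -ltNge => ah; rewrite ler_peMr ?tup_weight_ge0// -[leLHS]expR0 ler_expR.
  by rewrite addrC -mulrBr mulr_ge0// subr_ge0 ltW.
have mP : measurable_fun [set: n.-tuple T] (fun t => \prod_(i < n) g (tnth t i)).
  exact: (measurable_tpow_prod (f := fun=> g) (fun=> mg)).
apply: (@le_trans _ _ (\int[tpow mu n]_t ((expR (- (lam * a)))%:E * (\prod_(i < n) g (tnth t i))%:E))%E).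
  apply: ge0_le_integral => //.
  - by move=> t _; rewrite lee_fin sumr_ge0// => k _; exact: tup_weight_ge0.
  - by apply/measurable_EFinP; apply: measurable_sum_cond => k; exact: measurable_tup_weight.
  - by apply: emeasurable_funM => //; exact/measurable_EFinP.
  - by move=> t _; rewrite -EFinM lee_fin.
rewrite ge0_integralZl//; first last.
- by move=> t _; rewrite lee_fin prodr_ge0.
- exact/measurable_EFinP.
rewrite (integral_tpow_prod mu (f := fun=> g))//.
have int0 : (0 <= \int[mu]_x (g x)%:E)%E by apply: integral_ge0 => x _; rewrite lee_fin.
have intfin : (\int[mu]_x (g x)%:E)%E \is a fin_num.
  by rewrite ge0_fin_numE// (le_lt_trans intg)// ltry.
rewrite -(fineK intfin) prodEFin -EFinM lee_fin prodr_const card_ord addrC expRD.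
rewrite ler_wpM2l ?expR_ge0// expRM_natr lerXn2r ?nnegrE ?expR_ge0 ?fine_ge0//.
by rewrite -lee_fin fineK.
Qed.

Lemma union_bound_hits (F : finType) (J : F -> pred Ch) (a e : R) :
  (forall f, \int[tpow mu n]_t
     (\sum_(k : {ffun 'I_n -> Ch} | ~~ ((hits (J f) k)%:R <= a)) tup_weight k t)%:E <= e%:E)%E ->
  ((1 - #|F|%:R * e)%:E <= \int[tpow mu n]_t
     (\sum_(k : {ffun 'I_n -> Ch} | [forall f, (hits (J f) k)%:R <= a]) tup_weight k t)%:E)%E.
Proof.
move=> Je.
rewrite EFinB leeBlDr// -(integral_prob_cst (tpow mu n) 1).
pose bad f t := \sum_(k : {ffun 'I_n -> Ch} | ~~ ((hits (J f) k)%:R <= a)) tup_weight k t.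
pose good t := \sum_(k : {ffun 'I_n -> Ch} | [forall f, (hits (J f) k)%:R <= a]) tup_weight k t.
have mbad f : measurable_fun [set: n.-tuple T] (bad f).
  by apply: measurable_sum_cond => k; exact: measurable_tup_weight.
have mgood : measurable_fun [set: n.-tuple T] good.
  by apply: measurable_sum_cond => k; exact: measurable_tup_weight.
have bad0 f t : 0 <= bad f t by rewrite sumr_ge0// => k _; exact: tup_weight_ge0.
have good0 t : 0 <= good t by rewrite sumr_ge0// => k _; exact: tup_weight_ge0.
apply: (@le_trans _ _ (\int[tpow mu n]_t ((good t)%:E + (\sum_f bad f t)%:E))%E).
  apply: ge0_le_integral => //.
  - apply/measurable_EFinP; apply: measurable_funD => //; exact: measurable_sum_cond.
  - move=> t _; rewrite -EFinD lee_fin -(sum_tup_weight t) (bigID (fun k : {ffun 'I_n -> Ch} =>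
      [forall f, (hits (J f) k)%:R <= a]))/= lerD2l.
    rewrite /bad (exchange_big_dep predT)//= big_mkcond/=; apply: ler_sum => k _.
    case: ifPn => [/forallPn[f kf]|_]; last by rewrite sumr_ge0// => f _; exact: tup_weight_ge0.
    by rewrite (bigD1 f)//= lerDl sumr_ge0// => f' _; exact: tup_weight_ge0.
rewrite ge0_integralD//; first last.
- apply/measurable_EFinP; exact: measurable_sum_cond.
- by move=> t _; rewrite lee_fin sumr_ge0.
- exact/measurable_EFinP.
- by move=> t _; rewrite lee_fin.
rewrite leeD2l// ge0_integral_sumr//.
apply: (@le_trans _ _ (\sum_(f : F) e%:E)%E); first by apply: lee_sum => f _; exact: Je.
by rewrite sumEFin sumr_const mulr_natl.
Qed.
End chernoff.

(** With [l = c / 12], half of the relative slack [c / 6], and [expR l - 1 <= l + 12 / 11 * l ^+ 2],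
    the quadratic terms add up to [- 10 / 11 * l ^+ 2], that is [- c ^+ 2 / 158.4]; hence 160. *)
Lemma chernoff_exponent {R : realType} (c x : R) : 0 < c < 1 -> 0 <= x ->
  (expR (c / 12) - 1) * ((1 - c / 6) * x) - c / 12 * x <= - (160^-1 * c ^+ 2 * x).
Proof.
move=> /andP[c0 c1] x0.
set l := c / 12.
have -> : c = 12 * l by rewrite /l; field.
have l0 : 0 < l by rewrite /l; lra.
have l1 : l < 12^-1 by rewrite /l; lra.
have el : (1 - l) * expR l <= 1.
  have h : (1 - l) <= expR (- l) by rewrite expR_ge1Dx.
  have := ler_wpM2r (expR_ge0 l) h.
  by rewrite -expRD addNr expR0.
have e1 : expR l - 1 <= l + 12 / 11 * l ^+ 2.
  have h : (1 - l) * (1 + l + 12 / 11 * l ^+ 2) >= 1 by nra.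
  have : (1 - l) * (expR l) <= (1 - l) * (1 + l + 12 / 11 * l ^+ 2) by apply: le_trans h.
  rewrite ler_pM2l; last lra.
  lra.
have : (expR l - 1) * ((1 - 12 * l / 6) * x) <= (l + 12 / 11 * l ^+ 2) * ((1 - 12 * l / 6) * x).
  apply: ler_wpM2r => //; apply: mulr_ge0 => //; lra.
have l2x : 0 <= l ^+ 2 * x by rewrite mulr_ge0// sqr_ge0.
have l3x : 0 <= l ^+ 3 * x by rewrite mulr_ge0// exprn_ge0// ltW.
nra.
Qed.

(* A uniform seed [v] draws [k] when it falls in the [k]-th of consecutive intervals
   of lengths [W k]. *)
Section interval_choice.
Context {R : realType}.

Lemma unif_itv (a w : R) : 0 <= a -> 0 <= w -> a + w <= 1 ->
  @unif R [set v | a <= v < a + w] = w%:E.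
Proof.
move=> a0 w0 aw1.
rewrite (_ : [set v | a <= v < a + w] = `[a, (a + w)[%classic); last first.
  by apply/seteqP; split=> v /=; rewrite in_itv.
rewrite /unif /uniform_prob (eq_integral (fun=> 1%E)); last first.
  move=> x; rewrite inE/= in_itv/= => /andP[ax xw].
  by rewrite /uniform_pdf (le_trans a0 ax) (le_trans (ltW xw) aw1)/= subr0 invr1.
rewrite integral_cst//= mul1e lebesgue_measure_itv/= lte_fin.
case: ifPn => [_|]; first by rewrite -EFinB addrAC subrr add0r.
by rewrite -leNgt -{2}[a]addr0 lerD2l => w0'; congr _%:E; apply/le_anti; rewrite w0 w0'.
Qed.

Variables (K : finType) (W : K -> R).
Hypotheses (W0 : forall k, 0 <= W k) (W1 : \sum_k W k = 1).

Definition cumul (k : K) : R := \sum_(k' | (enum_rank k' < enum_rank k)%N) W k'.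

Definition choice_itv (k : K) : set R := [set v | cumul k <= v < cumul k + W k].

Lemma cumul_next (k : K) : cumul k + W k = \sum_(k' | (enum_rank k' <= enum_rank k)%N) W k'.
Proof.
rewrite [RHS](bigD1 k)//= addrC; congr (_ + _); apply: eq_bigl => k'.
by rewrite ltn_neqAle andbC -(inj_eq enum_rank_inj).
Qed.

Lemma unif_choice_itv (k : K) : @unif R (choice_itv k) = (W k)%:E.
Proof.
apply: unif_itv => //; first by rewrite sumr_ge0.
rewrite cumul_next -W1 [leRHS](bigID (fun k' => (enum_rank k' <= enum_rank k)%N))/= lerDl.
by rewrite sumr_ge0.
Qed.

Lemma choice_itv_inj k k' v : choice_itv k v -> choice_itv k' v -> k = k'.
Proof.
wlog kk' : k k' / (enum_rank k <= enum_rank k')%N => [H|].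
  by case: (leqP (enum_rank k) (enum_rank k')) => [|/ltnW] h v1 v2;
    [exact: H|apply/esym/H].
rewrite /choice_itv/= => /andP[_ v1] /andP[v2 _]; apply: contraTeq v1 => nkk'.
rewrite -leNgt (le_trans _ v2)// cumul_next /cumul.
have lt : (enum_rank k < enum_rank k')%N.
  by rewrite ltn_neqAle kk' andbT (inj_eq val_inj) (inj_eq enum_rank_inj).
rewrite [leRHS](bigID (fun k' => (enum_rank k' <= enum_rank k)%N))/=.
rewrite [in leRHS](eq_bigl (fun k' => (enum_rank k' <= enum_rank k)%N)); last first.
  by move=> k0; apply: andb_idl => /leq_ltn_trans; apply.
by rewrite lerDl sumr_ge0.
Qed.

End interval_choice.

Lemma measurable_finite_choice (K : finType) d1 d2 (X : measurableType d1) (Y : measurableType d2)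
  (sel : X -> K) (F : K -> X -> Y) : (forall k, measurable (sel @^-1` [set k])) ->
  (forall k, measurable_fun [set: X] (F k)) -> measurable_fun [set: X] (fun x => F (sel x) x).
Proof.
move=> msel mF _ B mB; rewrite setTI.
rewrite (_ : _ @^-1` B = \bigcup_(k in [set: K]) (sel @^-1` [set k] `&` F k @^-1` B)); last first.
  by apply/seteqP; split=> [x Bx|x [k _ [<-]]//]; exists (sel x).
apply: fin_bigcup_measurable; first exact: finite_finset.
by move=> k _; apply: measurableI => //; rewrite -[X in measurable X]setTI; exact: mF.
Qed.

Lemma pick_unique (K : finType) (X : Type) (Q : K -> set X) (P : pred K) k x :
  (forall k k' x, Q k x -> Q k' x -> k = k') -> P k -> Q k x ->
  [pick k | P k && `[< Q k x >]] = Some k.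
Proof.
move=> Qinj Pk Qk; case: pickP => [k' /andP[_ /asboolP Qk']|/(_ k)].
  by congr Some; exact: Qinj Qk' Qk.
by rewrite Pk/= asboolT.
Qed.

Lemma measurable_pick (K : finType) d1 (X : measurableType d1) (Q : K -> set X) (P : pred K) :
  (forall k, measurable (Q k)) -> (forall k k' x, Q k x -> Q k' x -> k = k') ->
  forall o, measurable ((fun x => [pick k | P k && `[< Q k x >]]) @^-1` [set o]).
Proof.
move=> mQ Qinj.
case=> [k|].
  case Pk : (P k); last first.
    rewrite (_ : _ @^-1` _ = set0)//; apply/seteqP; split=> x //=.
    by case: pickP => // k' /andP[Pk' _] [kk']; move: Pk; rewrite -kk' Pk'.
  rewrite (_ : _ @^-1` _ = Q k)//; apply/seteqP; split=> x /=; last exact: pick_unique.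
  by case: pickP => // k' /andP[_ /asboolP Qk'] [<-].
rewrite (_ : _ @^-1` _ = ~` \bigcup_(k in [set k | P k]) Q k).
  by apply/measurableC/fin_bigcup_measurable => //; exact: finite_finset.
apply/seteqP; split=> x /=.
  by case: pickP => // noQ _ [k Pk Qk]; have := noQ k; rewrite Pk/= asboolT.
by move=> noQ; case: pickP => // k /andP[Pk /asboolP Qk]; exfalso; apply: noQ; exists k.
Qed.

Lemma measurable_vdist d (v : d.-tuple RR) : measurable_fun [set: d.-tuple RR] (fun u => vdist u v).
Proof.
apply: (measurableT_comp (continuous_measurable_fun (@sqrt_continuous RR))).
apply: measurable_sum_cond => j; apply: measurable_funX; apply: measurable_funB => //.
exact: measurable_tnth.
Qed.

(** The squared triangle inequality [(u - v)^2 <= 2 (a - u)^2 + 2 (a - v)^2], summed over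
    coordinates, excludes that both distances are below [r]. *)
Lemma vdist_two_points d (r : RR) (a u v : d.-tuple RR) : 0 <= r ->
  4 * r ^+ 2 <= \sum_(j < d) (tnth u j - tnth v j) ^+ 2 -> r <= vdist a u \/ r <= vdist a v.
Proof.
move=> r0 uv; apply/orP; rewrite -[_ || _]negbK negb_or -!ltNge; apply/negP => /andP[ru rv].
have sq b : vdist a b < r -> \sum_(j < d) (tnth a j - tnth b j) ^+ 2 < r ^+ 2.
  move=> abr; rewrite -[ltLHS]sqr_sqrtr; last by rewrite sumr_ge0// => j _; exact: sqr_ge0.
  by rewrite ltrXn2r// nnegrE sqrtr_ge0.
have : \sum_(j < d) (tnth u j - tnth v j) ^+ 2 <=
    2 * \sum_(j < d) (tnth a j - tnth u j) ^+ 2 + 2 * \sum_(j < d) (tnth a j - tnth v j) ^+ 2.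
  rewrite !mulr_sumr -big_split/=; apply: ler_sum => j _.
  rewrite -subr_ge0 (_ : _ - _ = (tnth a j - tnth u j + (tnth a j - tnth v j)) ^+ 2); last by ring.
  exact: sqr_ge0.
by have := sq _ ru; have := sq _ rv; lra.
Qed.

(** * The two-point argument *)

Section two_point.
Context (n d : nat) (dU : measure_display) (TU : measurableType dU) (PU : probability TU RR).
Variables (sigma eta c r : RR) (beta : bool -> d.-tuple RR).
Hypotheses (eta0 : 0 <= eta) (c01 : 0 < c < 1) (r0 : 0 <= r).
Hypothesis sep : 4 * r ^+ 2 <= \sum_(j < d) (tnth (beta true) j - tnth (beta false) j) ^+ 2.
Variable sch : mask_scheme sigma ((1 - c / 6) * eta) beta.
Variable Alg : TU * idataset n d -> d.-tuple RR.
Hypothesis mAlg : measurable_fun setT Alg.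
Local Notation row := (d.-tuple RR * RR)%type.
Local Notation Ch := (ms_choice sch).
Local Notation K := {ffun 'I_n -> Ch}.

Definition scheme_data s (t : n.-tuple row) : dataset n d :=
  [tuple complete_ex (beta s) sigma (tnth t i) | i < n].

Definition scheme_masks (k : 'I_n -> Ch) : dmask n d := [tuple ms_mask (k i) | i < n].

Definition no_mask : dmask n d := [tuple ([tuple false | j < d], false) | i < n].

(** Only the covariates enter. Raw rows (covariates, noise) and examples (covariates, label) have
    the same type, so the weight the adversary computes from the data equals the one of the raw
    row. *)
Definition row_weight s (ch : Ch) (e : row) : RR := ms_w s ch e.1.

Definition hidden_entry (f : option 'I_d) (ch : Ch) : bool :=
  if f is Some j then tnth (ms_mask ch).1 j else (ms_mask ch).2.

(* The adversary erases nothing when the drawn masks exceed the budget. *)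
Definition within_budget (k : K) : bool :=
  [forall f, (hits (hidden_entry f) k)%:R <= eta * n%:R].

Definition drawn s (k : K) : set (dataset n d * RR) :=
  [set Sv | choice_itv (fun k : K => tup_weight (row_weight s) k Sv.1) k Sv.2].

Definition scheme_pick s (Sv : dataset n d * RR) : option K :=
  [pick k | within_budget k && `[< drawn s k Sv >]].

Definition option_masks (o : option K) : dmask n d := if o is Some k then scheme_masks k else no_mask.

Definition scheme_adv s (Sv : dataset n d * RR) : dmask n d := option_masks (scheme_pick s Sv).

Lemma scheme_adv_admissible s Sv : mask_admissible eta (scheme_adv s Sv).
Proof.
have cE (B B' : 'I_n -> bool) : B =1 B' -> #|[set i | B i]%classic| = #|[set i | B' i]%SET|.
  by move=> BB'; apply: eq_card => i; rewrite inE -BB'; apply/idP/idP; rewrite in_setE.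
rewrite /scheme_adv /scheme_pick; case: pickP => [k /andP[/forallP kB _]|_] /=.
  split=> [j|].
    rewrite (cE _ (fun i => hidden_entry (Some j) (k i))) => [|i]; first exact: kB (Some j).
    by rewrite tnth_mktuple.
  rewrite (cE _ (fun i => hidden_entry None (k i))) => [|i]; first exact: kB None.
  by rewrite tnth_mktuple.
have c0 : #|[set i : 'I_n | false]%SET| = 0%N by apply: eq_card0 => i; rewrite inE.
by split=> [j|]; rewrite (cE _ (fun=> false)) ?c0 ?mulr_ge0// => i; rewrite !tnth_mktuple.
Qed.

Let mrow_weight s ch : measurable_fun [set: row] (row_weight s ch).
Proof. by apply: (measurableT_comp (f := ms_w s ch)); [exact: ms_measurable|exact: measurable_fst]. Qed.
Let row_weight0 s ch e : 0 <= row_weight s ch e. Proof. exact: ms_ge0. Qed.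
Let row_weight1 s e : \sum_ch row_weight s ch e = 1. Proof. exact: ms_sum. Qed.
Let W0 s (S : n.-tuple row) (k : K) : 0 <= tup_weight (row_weight s) k S.
Proof. exact: tup_weight_ge0. Qed.
Let W1 s (S : n.-tuple row) : \sum_(k : K) tup_weight (row_weight s) k S = 1.
Proof. exact: sum_tup_weight. Qed.
Let mW s (k : K) : measurable_fun [set: n.-tuple row] (tup_weight (row_weight s) k).
Proof. exact: measurable_tup_weight. Qed.

Lemma measurable_drawn s k : measurable (drawn s k).
Proof.
have mc : measurable_fun [set: (n.-tuple row * RR)%type]
    (fun Sv => cumul (fun k : K => tup_weight (row_weight s) k Sv.1) k).
  apply: (@measurable_sum_cond RR _ (n.-tuple row * RR)%type K
    (fun k' => enum_rank k' < enum_rank k)%N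
    (fun k' Sv => tup_weight (row_weight s) k' Sv.1)) => k'.
  exact: (measurableT_comp (mW s k') measurable_fst).
have mw : measurable_fun [set: (n.-tuple row * RR)%type]
    (fun Sv => tup_weight (row_weight s) k Sv.1).
  exact: (measurableT_comp (mW s k) measurable_fst).
have -> : drawn s k = [set Sv | (cumul (fun k : K => tup_weight (row_weight s) k Sv.1) k <= Sv.2) &&
    (Sv.2 < cumul (fun k : K => tup_weight (row_weight s) k Sv.1) k + tup_weight (row_weight s) k Sv.1)].
  by [].
have mb := measurable_and (measurable_fun_ler mc measurable_snd)
  (measurable_fun_ltr (measurable_snd : measurable_fun setT _) (measurable_funD mc mw)).
by have := mb measurableT [set true] Logic.I; rewrite setTI.
Qed.

Let drawn_inj s k k' Sv : drawn s k Sv -> drawn s k' Sv -> k = k'.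
Proof. exact: choice_itv_inj (W0 s Sv.1) _ _ _. Qed.

Lemma measurable_scheme_pick s o : measurable (scheme_pick s @^-1` [set o]).
Proof. exact: (measurable_pick _ (measurable_drawn s) (@drawn_inj s)). Qed.

Lemma measurable_scheme_adv s : measurable_fun setT (scheme_adv s).
Proof.
apply: (measurable_finite_choice (F := fun o _ => option_masks o) (measurable_scheme_pick s)).
by move=> o; exact: measurable_cst.
Qed.

Lemma measurable_censor (M : dmask n d) : measurable_fun setT (fun S : dataset n d => censor S M).
Proof.
apply/measurable_fun_tnthP => i.
rewrite (_ : _ \o _ = fun S => censor_ex (tnth S i) (tnth M i)); last first.
  by apply/funext => S /=; rewrite tnth_mktuple.
apply: (measurableT_comp (measurable_censor_ex (tnth M i))); exact: measurable_tnth.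
Qed.

Lemma measurable_censor_adv s :
  measurable_fun setT (fun Sv : dataset n d * RR => censor Sv.1 (scheme_adv s Sv)).
Proof.
apply: (measurable_finite_choice (F := fun o Sv => censor Sv.1 (option_masks o))
  (measurable_scheme_pick s)) => o.
exact: (measurableT_comp (measurable_censor _) measurable_fst).
Qed.

Lemma measurable_scheme_data s : measurable_fun setT (scheme_data s).
Proof.
apply/measurable_fun_tnthP => i.
rewrite (_ : _ \o _ = fun t => complete_ex (beta s) sigma (tnth t i)); last first.
  by apply/funext => S /=; rewrite tnth_mktuple.
apply: (measurableT_comp (measurable_complete_ex _ _)); exact: measurable_tnth.
Qed.

Definition far s : set (TU * idataset n d) := [set uv | r <= vdist (Alg uv) (beta s)].

Lemma measurable_far s : measurable (far s).
Proof.
have m := measurableT_comp (measurable_vdist (beta s)) mAlg.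
have mb := measurable_fun_ler (measurable_cst r) m.
by have := mb measurableT [set true] Logic.I; rewrite setTI.
Qed.

Definition attacked s : set ((n.-tuple row * RR) * TU) :=
  [set z | far s (z.2, censor (scheme_data s z.1.1) (scheme_adv s (scheme_data s z.1.1, z.1.2)))].

Lemma measurable_attacked s : measurable (attacked s).
Proof.
rewrite -[attacked s]setTI.
apply: (_ : measurable_fun setT (fun z : (n.-tuple row * RR) * TU =>
  (z.2, censor (scheme_data s z.1.1) (scheme_adv s (scheme_data s z.1.1, z.1.2))))) => //; last first.
  exact: measurable_far.
apply: measurable_fun_pair; first exact: measurable_snd.
apply: (measurableT_comp (measurable_censor_adv s) (g := fun z : (n.-tuple row * RR) * TU =>
  (scheme_data s z.1.1, z.1.2))).
apply: measurable_fun_pair.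
  apply: (measurableT_comp (measurable_scheme_data s)).
  exact: (measurableT_comp measurable_fst measurable_fst).
exact: (measurableT_comp measurable_snd measurable_fst).
Qed.

(** The conditional probability of a large error given the visible data, the randomness of the
    algorithm being integrated out. *)
Definition far_prob s (v : idataset n d) : RR := fine (PU [set u | far s (u, v)]).

Lemma far_probE s v : (far_prob s v)%:E = PU [set u | far s (u, v)].
Proof.
rewrite /far_prob fineK// fin_num_measure//.
rewrite (_ : [set u | _] = ysection (far s) v); last by apply/seteqP; split=> u; rewrite /ysection/= inE.
exact: measurable_ysection (measurable_far s).
Qed.

Lemma far_prob_ge0 s v : 0 <= far_prob s v.
Proof. by rewrite -lee_fin far_probE. Qed.

Lemma measurable_far_prob s : measurable_fun setT (far_prob s).
Proof.
apply/measurable_EFinP.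
rewrite (_ : _ \o _ = PU \o ysection (far s)).
  exact: measurable_fun_ysection (measurable_far s).
apply/funext => v /=; rewrite far_probE; congr (PU _).
by apply/seteqP; split=> u; rewrite /ysection/= inE.
Qed.

Lemma far_prob_sum v : 1 <= far_prob true v + far_prob false v.
Proof.
have sec s : measurable [set u | far s (u, v)].
  rewrite (_ : [set u | _] = ysection (far s) v); last by apply/seteqP; split=> u; rewrite /ysection/= inE.
  exact: measurable_ysection (measurable_far s).
rewrite -lee_fin EFinD !far_probE.
apply: (le_trans _ (measureU2 PU (sec true) (sec false))).
have -> : [set u | far true (u, v)] `|` [set u | far false (u, v)] = setT.
  by apply/seteqP; split=> // u _; exact: vdist_two_points.
by rewrite -(@probability_setT _ _ _ PU).
Qed.

Local Notation rows := (tpow (gauss_row d) n).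

Definition row_view s (ch : Ch) (e : row) : iexample d :=
  censor_ex (complete_ex (beta s) sigma e) (ms_mask ch).

Lemma measurable_row_view s ch : measurable_fun [set: row] (row_view s ch).
Proof. exact: (measurableT_comp (measurable_censor_ex _) (measurable_complete_ex _ _)). Qed.

Lemma censor_scheme s (k : K) t : censor (scheme_data s t) (scheme_masks k) = tup_map row_view s k t.
Proof. by apply: eq_from_tnth => i; rewrite !tnth_mktuple. Qed.

Lemma row_weight_data s (k : K) t :
  tup_weight (row_weight s) k (scheme_data s t) = tup_weight (row_weight s) k t.
Proof. by apply: eq_bigr => i _; rewrite tnth_mktuple. Qed.

Let m_hit s (k : K) : measurable_fun [set: n.-tuple row]
  (fun t => far_prob s (tup_map row_view s k t)).
Proof.
apply: (measurableT_comp (measurable_far_prob s)).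
exact: (measurable_tup_map measurable_row_view s k).
Qed.

(** Draws beyond the budget are simply discarded from the lower bound. On the others the adversary
    applies exactly the drawn masks. *)
Lemma attacked_ge s :
  (\sum_(k : K | within_budget k) \int[rows]_t
     ((far_prob s (tup_map row_view s k t))%:E * (tup_weight (row_weight s) k t)%:E)
   <= ((rows \x @unif RR) \x PU) (attacked s))%E.
Proof.
pose D k : set (n.-tuple row * RR) := [set tv | drawn s k (scheme_data s tv.1, tv.2)].
have mD k : measurable (D k).
  rewrite -[D k]setTI.
  apply: (_ : measurable_fun setT (fun tv : n.-tuple row * RR => (scheme_data s tv.1, tv.2))) => //;
    last exact: measurable_drawn.
  apply: measurable_fun_pair; last exact: measurable_snd.
  exact: (measurableT_comp (measurable_scheme_data s) measurable_fst).
pose F (k : K) (tv : n.-tuple row * RR) : RR := \1_(D k) tv * far_prob s (tup_map row_view s k tv.1).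
have mF k : measurable_fun setT (F k).
  apply: measurable_funM; first exact: measurable_indic.
  exact: (measurableT_comp (m_hit s k) measurable_fst).
have F0 k tv : 0 <= F k tv by rewrite mulr_ge0// far_prob_ge0.
have -> : (\sum_(k : K | within_budget k) \int[rows]_t
     ((far_prob s (tup_map row_view s k t))%:E * (tup_weight (row_weight s) k t)%:E) =
   \int[rows \x @unif RR]_tv (\sum_(k : K | within_budget k) F k tv)%:E)%E.
  rewrite ge0_integral_sumr//; apply: eq_bigr => k _.
  rewrite fubini_tonelli1//.
  apply: eq_integral => t _; rewrite /fubini_F/=.
  under eq_integral do rewrite /F/= EFinM.
  rewrite ge0_integralZr//; first last.
  - by rewrite lee_fin far_prob_ge0.
  - apply/measurable_EFinP.
    apply: (measurableT_comp (measurable_indic (mD k)) (g := fun v => (t, v))).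
    exact: measurable_pair1.
  (* Integrating over the seed turns the indicator of the interval of [k] into its length, the
     weight of [k]. *)
  rewrite muleC; congr (_ * _)%E; rewrite -row_weight_data -(unif_choice_itv (W0 s _) (W1 s _)).
  set I := choice_itv _ _.
  have DI v : D k (t, v) = I v by [].
  have mI : measurable I.
    rewrite (_ : I = xsection (D k) t); first exact: measurable_xsection.
    by apply/seteqP; split=> v; rewrite /xsection/= inE.
  transitivity (\int[@unif RR]_v (\1_I v)%:E)%E.
    by rewrite integral_indic// setIT.
  apply: eq_integral => v _; rewrite !indicE; congr (_%:R)%:E.
- exact/measurable_EFinP.
- by move=> y; rewrite lee_fin.
apply: (@le_trans _ _ (\int[rows \x @unif RR]_y (PU \o xsection (attacked s)) y)%E); last by [].
apply: ge0_le_integral => //.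
- by move=> y _; rewrite lee_fin sumr_ge0.
- by apply/measurable_EFinP; apply: measurable_sum_cond.
- exact: measurable_fun_xsection (measurable_attacked s).
move=> y _.
have [[k kB Dk]|noD] := pselect (exists2 k, within_budget k & D k y); last first.
  rewrite big1 ?measure_ge0// => k kB; rewrite /F indicE.
  by rewrite (_ : y \in D k = false) ?mul0r//; apply/negbTE/negP; rewrite in_setE => Dk; apply: noD; exists k.
rewrite (bigD1 k)//= big1 ?addr0 => [|k' /andP[_ k'k]]; last first.
  rewrite /F indicE (_ : y \in D k' = false) ?mul0r//.
  by apply/negbTE/negP; rewrite in_setE => Dk'; move/eqP: k'k; apply; exact: drawn_inj Dk' Dk.
rewrite /F indicE mem_set// mul1r far_probE le_eqVlt; apply/orP; left; apply/eqP; congr (PU _).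
have advE : scheme_adv s (scheme_data s y.1, y.2) = scheme_masks k.
  by rewrite /scheme_adv /scheme_pick (pick_unique (@drawn_inj s) kB Dk).
by apply/seteqP; split=> u; rewrite /xsection/= ?inE /attacked/= advE censor_scheme.
Qed.

Lemma mass_within_budget :
  ((1 - d.+1%:R * expR (- (160^-1 * c ^+ 2 * eta * n%:R)))%:E <=
   \sum_(k : K | within_budget k) \int[rows]_t (tup_weight (row_weight true) k t)%:E)%E.
Proof.
have cardF : d.+1 = #|{: option 'I_d}| by rewrite card_option card_ord.
rewrite -ge0_integral_sumr; [|exact: mW|by move=> k t; exact: W0].
rewrite [in leLHS]cardF; apply: union_bound_hits; [exact: mrow_weight|exact: row_weight0|exact: row_weight1|].
move=> f.
have [c0 c1] := andP c01.
have c12 : 0 <= c / 12 by lra.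
apply: (le_trans (@chernoff_hits _ _ _ (gauss_row d) _ _ (mrow_weight true)
  (row_weight0 true) (row_weight1 true) n (hidden_entry f)
  ((1 - c / 6) * eta) (c / 12) _ c12 _)); last first.
  rewrite lee_fin ler_expR.
  have := @chernoff_exponent RR c (eta * n%:R) c01 (mulr_ge0 eta0 (ler0n _ _)).
  by rewrite !mulrA.
have int1 ch : (\int[gauss_row d]_x (row_weight true ch x)%:E =
    \int[tpow (@gauss RR) d]_x (ms_w true ch x)%:E)%E.
  rewrite integral_gauss_row; [|exact/measurable_EFinP|by move=> z; rewrite lee_fin].
  by apply: eq_integral => x _; rewrite /row_weight/= integral_prob_cst.
rewrite (eq_bigr _ (fun ch _ => int1 ch)).
by case: f => [j|]; [exact: ms_coord|exact: ms_label].
Qed.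

(** For each draw within the budget the visible data have the same weighted law under both
    regressors, so both error probabilities can be integrated against it, and their sum is at least
    1 pointwise. This also explains why the erasure rates are needed under [beta true] only. *)
Lemma attacked_sum :
  ((1 - d.+1%:R * expR (- (160^-1 * c ^+ 2 * eta * n%:R)))%:E <=
   ((rows \x @unif RR) \x PU) (attacked true) + ((rows \x @unif RR) \x PU) (attacked false))%E.
Proof.
apply: (le_trans mass_within_budget).
apply: (le_trans _ (leeD (attacked_ge true) (attacked_ge false))).
rewrite -big_split/=; apply: lee_sum => k _.
have vis ch g := @ms_vis _ _ _ _ sch ch g.
have replace (g : idataset n d -> \bar RR) : measurable_fun setT g -> (forall v, 0 <= g v)%E ->
    (\int[rows]_t (g (tup_map row_view true k t) * (tup_weight (row_weight true) k t)%:E) =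
     \int[rows]_t (g (tup_map row_view false k t) * (tup_weight (row_weight false) k t)%:E))%E.
  exact: (integral_tup_map measurable_row_view mrow_weight row_weight0 vis).
have := replace (fun=> 1%E) (measurable_cst _) (fun=> lee01).
under eq_integral do rewrite mul1e.
under [X in _ = X -> _]eq_integral do rewrite mul1e.
move=> ->.
rewrite (replace (fun v => (far_prob true v)%:E)); first last.
- by move=> v; rewrite lee_fin far_prob_ge0.
- by apply/measurable_EFinP; exact: measurable_far_prob.
have mp s s' : measurable_fun setT (fun t => ((far_prob s (tup_map row_view s' k t))%:E *
    (tup_weight (row_weight s') k t)%:E)%E).
  apply: emeasurable_funM; apply/measurable_EFinP => //.
  apply: (measurableT_comp (measurable_far_prob s)).
  exact: (measurable_tup_map measurable_row_view s' k).
have p0 s s' t : (0 <= (far_prob s (tup_map row_view s' k t))%:E *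
    (tup_weight (row_weight s') k t)%:E)%E.
  by rewrite -EFinM lee_fin mulr_ge0 ?far_prob_ge0.
rewrite -ge0_integralD//; apply: ge0_le_integral => //.
- by move=> t _; rewrite lee_fin.
- exact/measurable_EFinP.
- exact: emeasurable_funD.
by move=> t _; rewrite -!EFinM -EFinD lee_fin -mulrDl ler_peMl// far_prob_sum.
Qed.
End two_point.

Theorem two_point_lower_bound (n d : nat) (dO : measure_display) (Omega : measurableType dO)
    (P : probability Omega RR) (dU : measure_display) (TU : measurableType dU)
    (G : 'I_n -> 'I_d -> Omega -> RR) (Z : 'I_n -> Omega -> RR)
    (V : Omega -> RR) (U : Omega -> TU)
    (sigma eta c r : RR) (beta : bool -> d.-tuple RR) (Alg : TU * idataset n d -> d.-tuple RR) :
  model_setup P G Z V U -> 0 <= eta -> 0 < c < 1 -> 0 <= r ->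
  4 * r ^+ 2 <= \sum_(j < d) (tnth (beta true) j - tnth (beta false) j) ^+ 2 ->
  mask_scheme sigma ((1 - c / 6) * eta) beta ->
  measurable_fun setT Alg ->
  exists s adv, [/\ measurable_fun setT adv, forall S v, mask_admissible eta (adv (S, v)) &
    ((1 / 2 * (1 - d.+1%:R * expR (- (160^-1 * c ^+ 2 * eta * n%:R))))%:E <=
     P [set w | (r <= vdist (Alg (U w, censor (lr_dataset (beta s) sigma G Z w)
       (adv (lr_dataset (beta s) sigma G Z w, V w)))) (beta s))%R])%E].
Proof.
move=> setup eta0 c01 r0 sep sch mAlg.
have [_ [_ [_ [mU _]]]] := setup.
pose U' : {RV P >-> _} := HB.pack U (isMeasurableFun.Build _ _ _ _ U mU).
pose PU : probability TU RR := distribution P U'.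
pose Q := ((tpow (gauss_row d) n \x @unif RR) \x PU)%E.
pose A s := attacked r sch Alg s.
have PE s : P [set w | (r <= vdist (Alg (U w, censor (lr_dataset (beta s) sigma G Z w)
       (scheme_adv sch s (lr_dataset (beta s) sigma G Z w, V w)))) (beta s))%R] = Q (A s).
  have rowsE w : lr_dataset (beta s) sigma G Z w = scheme_data sigma beta s (raw_rows G Z w).
    apply: eq_from_tnth => i; rewrite !tnth_mktuple /complete_ex/=; congr (_, _ + _).
    by apply: eq_bigr => j _; rewrite tnth_mktuple.
  transitivity (P [set w | A s (raw_rows G Z w, V w, U w)]); last first.
    by apply: (model_law setup (PU := PU)) => //; exact: measurable_attacked.
  by congr (P _); apply/seteqP; split=> w /=; rewrite /A /attacked /far/= -rowsE.
have sumQ := attacked_sum PU eta0 c01 r0 sep sch mAlg.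
set rho := 1 - d.+1%:R * _ in sumQ *.
have [le1|lt1] := leP (1 / 2 * rho)%:E (Q (A true)).
  exists true, (scheme_adv sch true); split=> [|S v|]; [|exact: scheme_adv_admissible|].
    exact: measurable_scheme_adv.
  by rewrite PE.
exists false, (scheme_adv sch false); split=> [|S v|]; [|exact: scheme_adv_admissible|].
  exact: measurable_scheme_adv.
rewrite PE leNgt; apply/negP => lt2.
have := le_lt_trans sumQ (lteD lt1 lt2).
by rewrite -EFinD (_ : 1 / 2 * rho + 1 / 2 * rho = rho) ?ltxx//; field.
Qed.

(** * Choice of the parameters *)

Section trig_bounds.
Context {R : realType}.
Implicit Types x : R.

Lemma sin_mean_value x : 0 <= x -> exists2 y, 0 <= y <= x & sin x = cos y * x.
Proof.
move=> x0; have [|y + E] := @MVT_segment R sin cos 0 x x0 (fun y _ => is_derive_sin y).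
  exact/continuous_subspaceT/continuous_sin.
by rewrite in_itv/= => yx; exists y => //; move: E; rewrite sin0 !subr0.
Qed.

Lemma one_sub_cos_le x : 0 <= x -> 1 - cos x <= x ^+ 2 / 2.
Proof.
move=> x0; have h0 : 0 <= x / 2 by rewrite divr_ge0.
have -> : x = x / 2 *+ 2 by rewrite -mulr_natr; field.
rewrite cos_mulr2n.
have [y _ E] := sin_mean_value h0.
have := cos2Dsin2 (x / 2); rewrite E exprMn.
have y1 : cos y ^+ 2 <= 1 by have := cos2Dsin2 y; have := sqr_ge0 (sin y); lra.
have := ler_wpM2r (sqr_ge0 (x / 2)) y1.
rewrite mul1r => uh.
rewrite -[cos _ ^+ 2 *+ 2]mulr_natr -[x / 2 *+ 2]mulr_natr; lra.
Qed.

Lemma sin_ge_half x : 0 <= x <= 1 -> x / 2 <= sin x.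
Proof.
move=> /andP[x0 x1]; have [y /andP[y0 yx] ->] := sin_mean_value x0.
rewrite [leRHS]mulrC; apply: ler_wpM2l => //.
have := one_sub_cos_le y0; nra.
Qed.
End trig_bounds.

(** Here [eps = q * delta] with [q = sqrt M], which balances the two main terms at [16 * delta / q]
    each. After multiplication by the number of moves the remainder [16 * delta ^+ 2] becomes
    negligible. *)
Lemma step_cost_le {R : realType} (M q delta u : R) : 0 < q -> q ^+ 2 = M -> 0 < delta ->
  0 <= u -> u <= delta ^+ 2 / 2 ->
  0 <= M^-1 * (16 * (q * delta) + ((q * delta)^-1 + 1) * (u * (32 * M))) <=
    32 * (delta / q) + 16 * delta ^+ 2.
Proof.
move=> q0 <- d0 u0 ud; have q20 : 0 < q ^+ 2 by rewrite exprn_gt0.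
have k0 : 0 <= (q * delta)^-1 + 1 by rewrite addr_ge0// invr_ge0 mulr_ge0 ?ltW.
have u32 : 0 <= u * (32 * q ^+ 2) by have := mulr_ge0 u0 (ltW q20); lra.
have uM : u * (32 * q ^+ 2) <= 16 * q ^+ 2 * delta ^+ 2.
  by have := ler_wpM2r (ltW q20) ud; lra.
have -> : 32 * (delta / q) + 16 * delta ^+ 2 =
    (q ^+ 2)^-1 * (16 * (q * delta) + ((q * delta)^-1 + 1) * (16 * q ^+ 2 * delta ^+ 2)).
  by field; rewrite !gt_eqF.
apply/andP; split.
  apply: mulr_ge0; first by rewrite invr_ge0 ltW.
  apply: addr_ge0; last exact: mulr_ge0.
  by have := mulr_ge0 (ltW q0) (ltW d0); lra.
by rewrite ler_wpM2l ?invr_ge0 ?(ltW q20)// lerD2l ler_wpM2l.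
Qed.

Lemma rotation_parameters {R : realType} (M D th eta c : R) :
  1 <= M -> 2 * M <= D -> D <= 2 * M + 1 -> 0 < c < 1 -> (2 + c) / D <= eta ->
  th = c * eta * Num.sqrt D / 1024 ->
  exists N : nat, exists delta tt eps lambda : R,
  [/\ N%:R * delta = th,
      tt * (1 + cos delta) = sin delta /\ tt * sin delta = 1 - cos delta,
      0 < eps /\ 0 <= lambda <= 1,
      (1 - lambda) * (M^-1 + N%:R * (M^-1 *
        (16 * eps + (eps^-1 + 1) * ((1 - cos delta) * (32 * M))))) +
        N%:R * (32 * M * (1 - cos delta)) <= (1 - c / 6) * eta &
      lambda + N%:R * (32 * M * (1 - cos delta)) <= (1 - c / 6) * eta].
Proof.
move=> M1 MD DM /andP[c0 c1] etaD thE.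
have M0 : 0 < M by lra.
have D0 : 0 < D by lra.
have eta0 : 0 < eta by apply: lt_le_trans etaD; rewrite divr_gt0//; lra.
have ce0 : 0 < c * eta by rewrite mulr_gt0.
have th0 : 0 < th.
  by rewrite thE; have := mulr_gt0 ce0 (_ : 0 < Num.sqrt D); rewrite sqrtr_gt0 => /(_ D0); lra.
have dimle : 2 / D <= (1 - c / 3) * eta.
  (* The point is [(1 - c / 3) * (2 + c) >= 2], valid because [c <= 1]. A fraction [c / 3] of [eta]
     is thus left over: half of it pays for the rotations, half for the Chernoff bound. *)
  have c3 : 0 <= 1 - c / 3 by lra.
  apply: (le_trans _ (ler_wpM2l c3 etaD)).
  rewrite mulrA ler_pM2r ?invr_gt0//; nra.
have thM : th / Num.sqrt M <= 7 / 4096 * (c * eta).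
  have q0 : 0 < Num.sqrt M by rewrite sqrtr_gt0.
  rewrite ler_pdivrMr// thE.
  (* [D <= 2 * M + 1 <= 3 * M], and 3 is less than the square of [7 / 4]. *)
  have h : Num.sqrt D <= 7 / 4 * Num.sqrt M.
    rewrite -(@ler_pXn2r _ 2)// ?nnegrE ?mulr_ge0 ?sqrtr_ge0//.
    by rewrite exprMn !sqr_sqrtr ?(ltW D0) ?(ltW M0)//; lra.
  have := ler_wpM2l (mulr_ge0 (ltW c0) (ltW eta0)) h; lra.
(* The first summand forces [32 * M * th * delta <= c * eta / 20], with [640 = 32 * 20]; the second
   forces [delta <= 1]. *)
pose B := 640 * M * th ^+ 2 / (c * eta) + th.
have B1 : 0 <= 640 * M * th ^+ 2 / (c * eta).
  apply: divr_ge0 (ltW ce0); apply: mulr_ge0 (sqr_ge0 _).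
  by clear -M0; lra.
have B0 : 0 <= B by rewrite addr_ge0// ltW.
pose N := (Num.truncn B).+1.
have BN : B < N%:R by rewrite truncnS_gt.
have N0 : 0 < N%:R :> R by rewrite ltr0n.
pose delta := th / N%:R.
have Nd : N%:R * delta = th by rewrite /delta mulrC divfK// gt_eqF.
have d0 : 0 < delta by rewrite divr_gt0.
have d1 : delta <= 1.
  by rewrite /delta ler_pdivrMr// mul1r (le_trans _ (ltW BN))// /B lerDr.
have small : 32 * (M * th * delta) <= c * eta / 20.
  rewrite /delta !mulrA ler_pdivrMr//.
  have : 640 * M * th ^+ 2 / (c * eta) <= N%:R by apply: le_trans (ltW BN); rewrite lerDl ltW.
  by rewrite ler_pdivrMr//; clear; lra.
set u := 1 - cos delta.
have u0 : 0 <= u by rewrite subr_ge0 cos_le1.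
have ud : u <= delta ^+ 2 / 2 by apply: one_sub_cos_le; exact: ltW.
have cs0 : 1 + cos delta != 0.
  have d2 : delta ^+ 2 <= 1 by rewrite expr_le1// ltW.
  by apply: lt0r_neq0; move: ud d2; rewrite /u; clear; lra.
have q0 : 0 < Num.sqrt M by rewrite sqrtr_gt0.
(* In order: [tt] is the tangent of half the angle, [eps] balances the cost of one move, and
   [lambda] is the rate of label erasures. *)
exists N, delta, (sin delta / (1 + cos delta)), (Num.sqrt M * delta), (2 / D).
have qM : Num.sqrt M ^+ 2 = M by rewrite sqr_sqrtr ?ltW.
set q := Num.sqrt M in q0 qM thM *.
have lam01 : 0 <= 2 / D <= 1.
  rewrite divr_ge0 ?(ltW D0)//= ler_pdivrMr// mul1r.
  by clear -M1 MD; lra.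
have lossle : N%:R * (32 * M * u) <= 16 * (M * th * delta).
  rewrite -Nd.
  have h : 0 <= 32 * (N%:R * M).
    by have := mulr_ge0 (ltW N0) (ltW M0); clear; lra.
  by have := ler_wpM2l h ud; clear; lra.
split=> //.
- split; first by rewrite divfK.
  rewrite mulrAC -expr2 sin2cos2; apply: (canLR (mulfK cs0)); rewrite /u; clear; ring.
- by split=> //; rewrite mulr_gt0.
(* Cleared of denominators this is [D - 2 <= 2 * M], true for both parities of the dimension. *)
- have mass : (1 - 2 / D) * M^-1 <= 2 / D.
    rewrite ler_pdivrMr//.
    have -> : 1 - 2 / D = (D - 2) / D by field; rewrite gt_eqF.
    rewrite [leRHS]mulrAC ler_pM2r ?invr_gt0//.
    by clear -DM; lra.
  have /andP[s0 sle] := step_cost_le q0 qM d0 u0 ud.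
  set S := M^-1 * _ in s0 sle *.
  have Nle : N%:R * S <= 32 * (th / q) + 16 * (th * delta).
    apply: le_trans (ler_wpM2l (ltW N0) sle) _.
    by rewrite -Nd le_eqVlt; apply/orP; left; apply/eqP; clear; ring.
  have thd : th * delta <= M * th * delta.
    by rewrite -mulrA ler_peMl// mulr_ge0 ?ltW.
  have T1 : (1 - 2 / D) * (N%:R * S) <= N%:R * S.
    apply: ler_piMl; first by rewrite mulr_ge0 ?(ltW N0).
    by rewrite gerBl; case/andP: lam01.
  rewrite mulrDr -/u.
  (* The bounds just collected add [32 * 7 / 4096 + 1 / 20 < 1 / 6] of [c * eta] to
     [2 / D <= (1 - c / 3) * eta]. *)
  have cmp : 2 / D + 32 * (th / q) + 32 * (M * th * delta) <= (1 - c / 6) * eta.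
    by move: dimle thM small (ltW ce0); clear; lra.
  by move: mass T1 Nle thd lossle cmp; clear; lra.
- rewrite -/u.
  by move: lossle dimle small (ltW ce0) (mulr_ge0 (mulr_ge0 (ltW M0) (ltW th0)) (ltW d0)); clear; lra.
Qed.

Lemma rotation_separation {R : realType} (th : R) : 0 <= th <= 1 ->
  th ^+ 2 / 4 <= (cos th - 1) ^+ 2 + sin th ^+ 2.
Proof.
move=> th01; have /andP[th0 _] := th01; have := sin_ge_half th01 => /[dup] h.
have th2 : 0 <= th / 2 by rewrite divr_ge0.
move=> /(le_trans th2) s0.
have : (th / 2) ^+ 2 <= sin th ^+ 2 by rewrite ler_pXn2r// nnegrE.
by have := sqr_ge0 (cos th - 1); rewrite expr_div_n; lra.
Qed.

(* In dimension one the budget [eta >= 2 + c] allows erasing everything. *)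
Section full_scheme.
Variables (d : nat) (sigma p : RR) (beta : bool -> d.-tuple RR).
Hypothesis p1 : 1 <= p.

Definition full_mask (_ : unit) : Defs.mask d := ([tuple true | j < d], true).

Lemma full_scheme : mask_scheme sigma p beta.
Proof.
apply: (@MaskScheme _ _ _ _ unit full_mask (fun _ _ _ => 1)) => //.
- by move=> s x; rewrite big_const card_unit/= addr0.
- move=> j; apply: (@le_trans _ _ 1%E); last by rewrite lee_fin.
  rewrite big_mkcond/= big_const card_unit/= adde0.
  by case: ifP => // _; rewrite integral_prob_cst.
- apply: (@le_trans _ _ 1%E); last by rewrite lee_fin.
  by rewrite big_mkcond/= big_const card_unit/= adde0 integral_prob_cst.
Qed.
End full_scheme.

Lemma hard_pair_one (sigma eta c b : RR) : 0 < c < 1 -> 2 + c <= eta <= 4 -> 0 <= b ->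
  exists beta : bool -> 1.-tuple RR, [/\ forall s, vnorm (beta s) = b,
    4 * (eta * (c / 4096) * b) ^+ 2 <= \sum_(j < 1) (tnth (beta true) j - tnth (beta false) j) ^+ 2
    & inhabited (mask_scheme sigma ((1 - c / 6) * eta) beta)].
Proof.
move=> /andP[c0 c1] /andP[eta2 eta4] b0.
(* With everything erased any two regressors look alike, so the antipodal pair, at distance [2 * b],
   is taken. *)
exists (fun s => [tuple (if s then b else - b) | j < 1]); split.
- move=> s; rewrite /vnorm big_ord_recl big_ord0 addr0 tnth_mktuple.
  by case: s; rewrite ?sqrrN sqrtr_sqr ger0_norm.
- rewrite big_ord_recl big_ord0 addr0 !tnth_mktuple.
  have h0 : 0 <= c / 4096 by lra.
  have h1 : c / 4096 <= 1 / 4 by lra.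
  move: (c / 4096) h0 h1 => h h0 h1.
  have k0 : 0 <= eta * h by apply: mulr_ge0 => //; lra.
  have k1 : eta * h <= 1 by nra.
  have -> : (b - - b) ^+ 2 = 4 * b ^+ 2 by ring.
  by rewrite exprMn ler_wpM2l// ler_piMl ?sqr_ge0// expr_le1.
- by split; apply: full_scheme; nra.
Qed.

Lemma hard_pair_ge2 (d : nat) (sigma eta c b : RR) : (1 < d)%N -> 0 < c < 1 ->
  (2 + c) / d%:R <= eta <= 4 / Num.sqrt d%:R -> 0 <= b ->
  exists beta : bool -> d.-tuple RR, [/\ forall s, vnorm (beta s) = b,
    4 * (eta * (c * Num.sqrt d%:R / 4096) * b) ^+ 2 <=
      \sum_(j < d) (tnth (beta true) j - tnth (beta false) j) ^+ 2
    & inhabited (mask_scheme sigma ((1 - c / 6) * eta) beta)].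
Proof.
move=> d1 c01 /andP[etaD eta4] b0; have /andP[c0 c1] := c01.
(* When [d] is odd, the last coordinate belongs to neither group and carries a zero coefficient. *)
pose m := d./2.
have m0 : (0 < m)%N by rewrite /m; lia.
have md : (m + m <= d)%N by rewrite /m; lia.
have dm : (d <= (m + m).+1)%N by rewrite /m; lia.
have e1d (i : 'I_m) : (i < d)%N by apply: leq_trans (ltn_ord i) _; lia.
have e2d (i : 'I_m) : (m + i < d)%N by have := ltn_ord i; lia.
pose e1 i := Ordinal (e1d i); pose e2 i := Ordinal (e2d i).
have e1I : injective e1 by move=> i j /(congr1 val)/= /val_inj.
have e2I : injective e2 by move=> i j /(congr1 val)/= /addnI/val_inj.
have e12 i j : e1 i != e2 j.
  by apply/eqP => /(congr1 val)/= E; have := ltn_ord i; rewrite E; lia.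
pose M : RR := m%:R; pose D : RR := d%:R; pose th := c * eta * Num.sqrt D / 1024.
have M1 : 1 <= M by rewrite ler1n.
have MD : 2 * M <= D by rewrite -natrM ler_nat; lia.
have DM : D <= 2 * M + 1 by rewrite -natrM natr1 ler_nat; lia.
have D0 : 0 < D by rewrite ltr0n; lia.
have sD : 0 < Num.sqrt D by rewrite sqrtr_gt0.
have eta0 : 0 <= eta by apply: le_trans etaD; rewrite divr_ge0 ?ler0n//; lra.
have th01 : 0 <= th <= 1.
  rewrite /th; move: eta4; rewrite ler_pdivlMr// => eta4.
  have cs0 : 0 <= eta * Num.sqrt D by rewrite mulr_ge0 ?(ltW sD).
  by apply/andP; split; nra.
have [N [delta [tt [eps [lambda [Nd [tt1 tt2] [eps0 lam01] pc pl]]]]]] :=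
  rotation_parameters M1 MD DM c01 etaD (erefl th).
pose r := b / Num.sqrt M.
have Mr : M * r ^+ 2 = b ^+ 2.
  have M0 : 0 < M by exact: lt_le_trans M1.
  by rewrite /r expr_div_n sqr_sqrtr ?ltW// mulrC divfK// gt_eqF.
exists (rot_beta N e1 e2 delta r); split.
- move=> s; rewrite /vnorm /rot_beta sum_gvec_sqr// -/M.
  set phi := (if s then _ else _).
  have -> : M * ((r * trigo.cos phi) ^+ 2 + (r * trigo.sin phi) ^+ 2) = b ^+ 2.
    by rewrite -Mr !exprMn -mulrDr trigo.cos2Dsin2 mulr1.
  by rewrite sqrtr_sqr ger0_norm.
- under eq_bigr do rewrite /rot_beta gvecB.
  rewrite sum_gvec_sqr// -/M Nd trigo.cos0 trigo.sin0.
  have := ler_wpM2l (sqr_ge0 b) (rotation_separation th01).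
  have -> : M * ((r * trigo.cos th - r * 1) ^+ 2 + (r * trigo.sin th - r * 0) ^+ 2) =
      b ^+ 2 * ((trigo.cos th - 1) ^+ 2 + trigo.sin th ^+ 2) by rewrite -Mr; ring.
  by apply: le_trans; rewrite le_eqVlt; apply/orP; left; apply/eqP; rewrite /th; field.
- split; apply: (rot_scheme e1I e2I e12 m0 tt1 tt2 eps0 sigma r lam01 pc pl).
Qed.

Theorem theorem1 :
  exists C kappa : RR, 0 < C /\ 0 < kappa /\
  forall (d : nat) (c sigma eta b : RR) (n : nat),
    (0 < d)%N -> 0 < c < 1 -> 0 <= sigma ->
    (2 + c) / d%:R <= eta <= 4 / Num.sqrt (d%:R) -> 0 <= b ->
  forall (dO : measure_display) (Omega : measurableType dO) (P : probability Omega RR)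
    (dU : measure_display) (TU : measurableType dU)
    (G : 'I_n -> 'I_d -> Omega -> RR) (Z : 'I_n -> Omega -> RR)
    (V : Omega -> RR) (U : Omega -> TU),
    model_setup P G Z V U ->
  forall (Alg : RR -> RR -> RR -> TU * idataset n d -> d.-tuple RR),
    measurable_fun setT (Alg eta sigma b) ->
  exists (beta : d.-tuple RR) (adv : dataset n d * RR -> dmask n d),
    vnorm beta = b /\
    measurable_fun setT adv /\
    (forall S v, mask_admissible eta (adv (S, v))) /\
    ((1 / 2 * (1 - d.+1%:R * expR (- (kappa * c ^+ 2 * eta * n%:R))))%:E <=
     P [set w | let S := lr_dataset beta sigma G Z w in
                let beta_hat := Alg eta sigma b (U w, censor S (adv (S, V w))) in
                (eta * (c * Num.sqrt (d%:R) / C) * vnorm beta <= vdist beta_hat beta)%R])%E.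
Proof.
(* The regressors are at distance at least [b * th / 2], and half of it is guaranteed as error; with
   [th = c * eta * sqrt d / 1024] this gives [4 * 1024]. The value of [kappa] comes from
   [chernoff_exponent]. *)
exists 4096, 160^-1; split; first by rewrite ltr0n.
split=> [|d c sigma eta b n d0 c01 _ etaI b0]; first by rewrite invr_gt0 ltr0n.
move=> dO Omega P dU TU G Z V U setup Alg mAlg.
have [c0 _] := andP c01.
have eta0 : 0 <= eta.
  by have /andP[+ _] := etaI; apply: le_trans; rewrite divr_ge0 ?ler0n//; lra.
have [beta [nb sep [sch]]] : exists beta : bool -> d.-tuple RR, [/\ forall s, vnorm (beta s) = b,
    4 * (eta * (c * Num.sqrt d%:R / 4096) * b) ^+ 2 <=
      \sum_(j < d) (tnth (beta true) j - tnth (beta false) j) ^+ 2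
    & inhabited (mask_scheme sigma ((1 - c / 6) * eta) beta)].
  case: d d0 etaI {G setup Alg mAlg} => [//|[|d]] _ etaI; last exact: hard_pair_ge2.
  move: etaI; rewrite sqrtr1 !divr1 mulr1 => etaI; exact: hard_pair_one.
have r0 : 0 <= eta * (c * Num.sqrt d%:R / 4096) * b.
  by rewrite !mulr_ge0 ?invr_ge0 ?ler0n ?sqrtr_ge0 ?(ltW c0).
have [s [adv [madv admissible prob]]] :=
  two_point_lower_bound setup eta0 c01 r0 sep sch mAlg.
by exists (beta s), adv; rewrite nb.
Qed.
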